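(* Let $M$ be a compact connected smooth manifold without boundary. Then there exist an integer $\ell\ge2$ and a nonempty open set $\mathcal V$ in $(\mathrm{Diff}^1(M))^\ell$ such that for every $G\in\mathcal V$ there exists a compact $\varphi_G$-invariant set $\Lambda_G\subset\ell^{\mathbb Z}\times M$ with the following properties: (1) all Lyapunov exponents tangent to $M$ of all $\varphi_G$-invariant Borel probability measures with support contained in $\Lambda_G$ are zero; (2) the restriction of $\varphi_G$ to $\Lambda_G$ has positive topological entropy. In particular, $\varphi_G$ has an ergodic invariant measure with positive metric entropy and only zero fibered Lyapunov exponents.
   Context: $\mathrm{Diff}^1(M)$ is the space of $C^1$ diffeomorphisms of $M$ with the $C^1$ topology, and $(\mathrm{Diff}^1(M))^\ell$ has the product topology. Write $\ell^{\mathbb Z}=\{0,\dots,\ell-1\}^{\mathbb Z}$ with the product topology and let $\sigma$ be the shift, $(\sigma(\omega))_n=\omega_{n+1}$. For $G=(g_0,\dots,g_{\ell-1})$, the $1$-step skew-product $\varphi_G\colon\ell^{\mathbb Z}\times M\to\ell^{\mathbb Z}\times M$ is $\varphi_G(\omega,x)=(\sigma(\omega),g_{\omega_0}(x))$. The Lyapunov exponents tangent to $M$ (fibered Lyapunov exponents) of a $\varphi_G$-invariant probability $\mu$ are the limits $$\lim_{n\to+\infty}\frac1n\log\|D(g_{\omega_{n-1}}\circ\cdots\circ g_{\omega_0})(x)\cdot v\|,\qquad v\in T_xM\setminus\{0\},$$ which exist for $\mu$-almost every $(\omega,x)$ by Oseledets' theorem; that they are all zero means that these limits are $0$ for $\mu$-almost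 every $(\omega,x)$ and every $v\in T_xM\setminus\{0\}$. *)

(* Defs.v *)
From HB Require Import structures.
From mathcomp Require Import all_boot all_order all_algebra.
From mathcomp Require Import all_classical all_reals all_analysis.
Set Implicit Arguments.
Unset Strict Implicit.
Unset Printing Implicit Defensive.
Import Order.TTheory GRing.Theory Num.Theory.
Import numFieldNormedType.Exports.
Local Open Scope classical_set_scope.
Local Open Scope ring_scope.

Section CkFunctions.
Context {R : realType} {V W : normedModType R}.

(* [U] is meant to be open and [V] finite-dimensional: then continuity of the
   differential is continuity of all its values ['d f x v]. *)
Fixpoint Ck (n : nat) (U : set V) (f : V -> W) : Prop :=
  match n with
  | 0 => forall x, U x -> {for x, continuous f}
  | m.+1 => (forall x, U x -> differentiable f x) /\
            (forall v, Ck m U (fun x => 'd f x v))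
  end.

Definition smooth (U : set V) (f : V -> W) : Prop := forall n, Ck n U f.

End CkFunctions.

(* [coord] and [param] are total functions, significant only on [dom] and on
   its image [cod], between which they are inverse homeomorphisms. *)
Record chart (R : realType) (d : nat) (M : topologicalType) := Chart {
  dom : set M ;
  coord :> M -> 'rV[R]_d ;
  param : 'rV[R]_d -> M ;
  chart_open_dom : open dom ;
  chart_open_cod : open (coord @` dom) ;
  chart_paramK : forall x, dom x -> param (coord x) = x ;
  chart_coord_cts : forall x, dom x -> {for x, continuous coord} ;
  chart_param_cts : forall y, (coord @` dom) y -> {for y, continuous param}
}.

Definition cod {R : realType} {d : nat} {M : topologicalType}
  (c : chart R d M) : set 'rV[R]_d := c @` dom c.

(* [chart_at x] is a preferred chart at [x]; it only serves to represent
   T_xM by the coordinate space 'rV_d. *)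
Record smooth_atlas (R : realType) (d : nat) (M : topologicalType) :=
  SmoothAtlas {
  charts : set (chart R d M) ;
  chart_at : M -> chart R d M ;
  chart_at_charts : forall x, charts (chart_at x) ;
  chart_at_dom : forall x, dom (chart_at x) x ;
  charts_compat : forall c1 c2, charts c1 -> charts c2 ->
    smooth (c1 @` (dom c1 `&` dom c2)) (c2 \o param c1)
}.

Section Diffeomorphisms.
Context {R : realType} {d : nat} {M : topologicalType}.
Variable A : smooth_atlas R d M.

Definition local_rep (c c' : chart R d M) (f : M -> M) : 'rV[R]_d -> 'rV[R]_d :=
  c' \o f \o param c.

Definition C1_map (f : M -> M) : Prop :=
  continuous f /\
  forall c c', charts A c -> charts A c' ->
    Ck 1 (c @` (dom c `&` f @^-1` dom c')) (local_rep c c' f).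

Definition C1_diffeo (f : M -> M) : Prop :=
  C1_map f /\ exists g, [/\ cancel f g, cancel g f & C1_map g].

Record diff1 := Diff1 { diff1_fun :> M -> M ; diff1P : C1_diffeo diff1_fun }.

HB.instance Definition _ := gen_eqMixin diff1.
HB.instance Definition _ := gen_choiceMixin diff1.

Definition C1_nbhd (f : diff1) (c c' : chart R d M) (K : set M) (e : R) :
    set diff1 :=
  [set g | forall x, K x ->
    [/\ dom c' (g x),
        `|c' (g x) - c' (f x)| < e &
        forall v, `|v| <= 1 ->
          `|'d (local_rep c c' g) (c x) v - 'd (local_rep c c' f) (c x) v|
            < e]].

Definition C1_subbase : set (set diff1) :=
  [set N | exists (f : diff1) (c c' : chart R d M) (K : set M) (e : R),
    [/\ charts A c, charts A c', compact K, K `<=` dom c &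
        [/\ f @` K `<=` dom c', 0 < e & N = C1_nbhd f c c' K e]]].

(* The C^1 compact-open topology; [M] being compact, it is the C^1 topology. *)
HB.instance Definition _ :=
  isSubBaseTopological.Build diff1 C1_subbase (id : set diff1 -> set diff1).

(* Df(x) : T_xM -> T_{f x}M, where T_pM is 'rV_d through [chart_at A p]. *)
Definition tangent_map (f : M -> M) (x : M) : 'rV[R]_d -> 'rV[R]_d :=
  'd (local_rep (chart_at A x) (chart_at A (f x)) f) (chart_at A x x).

(* The vector of T_pM, p = param c y, with coordinates [u] in the chart [c]. *)
Definition coord_vector (c : chart R d M) (y u : 'rV[R]_d) : 'rV[R]_d :=
  'd (chart_at A (param c y) \o param c) y u.

Record riemannian_metric := RiemannianMetric {
  inner : M -> 'rV[R]_d -> 'rV[R]_d -> R ;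
  inner_sym : forall x u v, inner x u v = inner x v u ;
  inner_lin : forall x a u v w,
    inner x (a *: u + v) w = a * inner x u w + inner x v w ;
  inner_pos : forall x u, u != 0 -> 0 < inner x u u ;
  inner_smooth : forall c u v, charts A c ->
    smooth (cod c) (fun y =>
      inner (param c y) (coord_vector c y u) (coord_vector c y v) : R^o)
}.

Definition tnorm (rho : riemannian_metric) (x : M) (v : 'rV[R]_d) : R :=
  Num.sqrt (inner rho x v v).

End Diffeomorphisms.

Section TopologicalEntropy.
Context {R : realType} {X : topologicalType}.
Implicit Types (f : X -> X) (K : set X) (U : set (set X)).

Definition open_cover K U : Prop :=
  (forall B, U B -> open B) /\ K `<=` \bigcup_(B in U) B.

(* An element of the join of U, f^-1 U, ..., f^-(n-1) U. *)
Definition join_cell f (n : nat) (a : nat -> set X) : set X :=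
  [set x | forall i, (i < n)%N -> a i (iter i f x)].

Definition join_card f K U (n : nat) : R :=
  inf [set m%:R | m in [set m : nat | exists a : 'I_m -> nat -> set X,
    (forall j i, U (a j i)) /\
    K `<=` \bigcup_(j in [set: 'I_m]) join_cell f n (a j)]].

Definition cover_entropy f K U : \bar R :=
  limn_esup (fun n => (ln (join_card f K U n) / n%:R)%:E).

(* Adler-Konheim-McAndrew entropy of the restriction of [f] to a compact
   invariant set [K]; covers of K by relatively open sets are traces of covers
   by open sets of X, and the limsup is a limit by subadditivity. *)
Definition top_entropy f K : \bar R :=
  ereal_sup [set cover_entropy f K U | U in open_cover K].

End TopologicalEntropy.

Definition Borel (X : ptopologicalType) := g_sigma_algebraType (@open X).

HB.instance Definition _ (X : ptopologicalType) := Measurable.on (Borel X).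

Section InvariantMeasures.
Context {R : realType} {X : ptopologicalType}.
Variables (f : X -> X) (mu : probability (Borel X) R).

Definition supp : set X :=
  [set x | forall U : set X, open U -> U x -> (0 < mu U)%E].

Definition invariant_measure : Prop :=
  forall B : set (Borel X), measurable B -> mu (f @^-1` B) = mu B.

Definition ergodic_measure : Prop :=
  invariant_measure /\
  forall B : set (Borel X), measurable B -> f @^-1` B = B ->
    mu B = 0%E \/ mu B = 1%E.

(* A finite measurable partition is given by its labelling xi : X -> 'I_k. *)
Definition measurable_partition (k : nat) (xi : X -> 'I_k) : Prop :=
  forall j, measurable (xi @^-1` [set j] : set (Borel X)).

(* The convention 0 log 0 = 0 is automatic. *)
Definition join_entropy (k : nat) (xi : X -> 'I_k) (n : nat) : R :=
  - \sum_(w : {ffun 'I_n -> 'I_k})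
      let p := fine (mu [set x | forall i : 'I_n, xi (iter i f x) = w i]) in
      p * ln p.

Definition partition_entropy (k : nat) (xi : X -> 'I_k) : \bar R :=
  limn_esup (fun n => (join_entropy xi n / n%:R)%:E).

Definition metric_entropy : \bar R :=
  ereal_sup [set h | exists k (xi : X -> 'I_k),
    measurable_partition xi /\ h = partition_entropy xi].

End InvariantMeasures.

(* The number of symbols is k.+1, so that the space is pointed, as required of
   measurable types. *)
Definition full_shift (k : nat) : Type :=
  {ptws int -> discrete_topology 'I_k.+1}.
HB.instance Definition _ (k : nat) := Topological.copy (full_shift k)
  {ptws int -> discrete_topology 'I_k.+1}.
HB.instance Definition _ (k : nat) :=
  isPointed.Build (full_shift k) (fun _ => ord0).

Definition shift (k : nat) (omega : full_shift k) : full_shift k :=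
  fun n : int => omega (n + 1).

HB.instance Definition _ (X Y : ptopologicalType) := Pointed.on (X * Y)%type.

Section SkewProducts.
Context {R : realType} {d : nat} {M : ptopologicalType}.
Variables (A : smooth_atlas R d M) (k : nat).
Variable G : {ptws 'I_k.+1 -> diff1 A}.

Definition skew_product (z : full_shift k * M) : full_shift k * M :=
  (shift z.1, G (z.1 0) z.2).

(* g_{omega_{n-1}} o ... o g_{omega_0} *)
Fixpoint fiber_iter (omega : full_shift k) (n : nat) (x : M) : M :=
  match n with
  | 0 => x
  | m.+1 => G (omega m%:Z) (fiber_iter omega m x)
  end.

(* Riemannian metrics exist by a partition of unity, and any two of them are
   uniformly equivalent on a compact manifold, so the limits do not depend on
   [rho]. *)
Definition zero_fibered_exponents
    (mu : probability (Borel (full_shift k * M)%type) R) : Prop :=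
  forall rho : riemannian_metric A,
  {ae mu, forall z : full_shift k * M, forall v : 'rV[R]_d, v != 0 ->
    (fun n : nat =>
       ln (tnorm rho (fiber_iter z.1 n z.2)
             (tangent_map A (fiber_iter z.1 n) z.2 v)) / n%:R)
      @ \oo --> (0 : R)}.

End SkewProducts.

(* Main.v *)
Require Import Defs.
From HB Require Import structures.
From mathcomp Require Import all_boot all_order all_algebra.
From mathcomp Require Import all_classical all_reals all_analysis.
From mathcomp Require Import zify ring lra.

(** The dynamics is controlled on the frame bundle over a chart: a map f acts
    on pairs (u, B), B an invertible matrix, by (f u, B * Df(u)).  For the box
    S = {|u - p| <= r, |B - 1| <= r} choose finitely many diffeomorphisms,
    equal near p to u |-> p + (u - a)(1 - H) with (a, H) running through a fine
    net, each of them listed twice, with labels 0 and 1.  For any maps C^1-close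
    to these, every frame of S is sent back into S by some map carrying any
    prescribed label.  Hence orbits that stay in S forever exist and realize
    every sequence of labels; along them the derivative cocycle stays bounded
    together with its inverse, so that the exponents vanish, and the entropy is
    at least log 2.

    The set Lambda is the image of a subshift: a point of the subshift records
    at each time a letter and the binary digits of a frame of S, the digits
    being carried by the labels of further letters, subject to the closed
    condition that consecutive frames are related by the map of the letter.
    Limits along an ultrafilter of averaged orbit measures with independent fair
    labels give invariant means on its clopen sets with Bernoulli(1/2) label
    marginal.  These form a face of the invariant means (a mean dominated by a
    multiple of such a mean also has fair labels, by the law of large numbers),
    and one that maximizes a strictly convex functional is extreme, hence
    extends to an ergodic measure. *)

Set Implicit Arguments.
Unset Strict Implicit.
Unset Printing Implicit Defensive.
Import Order.TTheory GRing.Theory Num.Theory.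
Import numFieldNormedType.Exports.
Local Open Scope classical_set_scope.
Local Open Scope ring_scope.

(** * Clopen means and their extension to Borel measures *)

(** The frame records the derivative: since B_n = B_0 * D(g^n), frames that stay near 1 bound the
    cocycle in both directions. The maps need not contract: the letter chosen for (u, B) brings it
    so close to (p, 1) that a C1 error of a quarter of the box is still absorbed, and this is why
    the construction survives perturbation. Listing each map twice makes the label independent of
    the state, so the labels carry the entropy whatever the geometry does. The letters alone are not
    known to determine the orbit in the box, hence the state is recorded too; its binary digits make
    the phase space zero-dimensional. There countably many clopen sets generate the Borel sets and
    compactness upgrades finite additivity, so that weak limits of measures become limits of
    numbers. An ergodic component of an arbitrary invariant measure could lose the entropy; the
    rigidity of the fair label law under domination prevents this. The maximizer of a strictly
    convex functional replaces an ergodic decomposition: its two halves along an invariant set must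
    coincide. *)

Section UltraLimit.
Context {R : realType}.

(** One ultrafilter gives a limit to all bounded sequences at once, so no diagonal extraction is
    needed. The inclusion of [\oo] makes ordinary limits limits along U as well. *)
Lemma ultralimit_exists : exists U : set_system nat, [/\ UltraFilter U, \oo `<=` U &
  forall x : nat -> R, (exists b, forall n, `|x n| <= b) -> cvg (x @ U)].
Proof.
have [U [UU sU]] := @ultraFilterLemma nat \oo _.
exists U; split => // x [b xb].
have cb : compact `[- b, b] by exact: segment_compact.
have FP : ProperFilter U by exact: ultra_proper.
have Uultra : UltraFilter (x @ U).
  split; first exact: fmap_proper_filter.
  move=> G GP sG; apply/seteqP; split => // A GA.
  have [//|UnA] := in_ultra_setVsetC (x @^-1` A) UU.
  have /sG GnA : (x @ U) (~` A) by [].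
  have /filter_ex[z [Az]] : G (A `&` ~` A) by exact: filterI.
  by [].
have := cb; rewrite compact_ultra => /(_ (x @ U) Uultra).
case=> [|l [_ xl]]; last by apply/cvg_ex; exists l.
by apply: nearW => n /=; rewrite in_itv/= -ler_norml.
Qed.

End UltraLimit.

Section ClopenAlgebra.
Context {T : ptopologicalType}.

(** An alias, so that the algebra of sets formed by the clopen sets does not compete with the Borel
    structure on the same points. *)
Definition clopen_algebra : Type := T.
HB.instance Definition _ := Pointed.on clopen_algebra.
HB.instance Definition _ := isAlgebraOfSets.Build default_measure_display
  clopen_algebra clopen0 clopenU (fun A cA => @clopenC T A set0 cA).

End ClopenAlgebra.
Arguments clopen_algebra : clear implicits.

(* The values on sets that are not clopen are meaningless. *)
Record clopen_mean (R : realType) (T : topologicalType) := ClopenMean {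
  mean_fun :> set T -> R ;
  mean_ge0 : forall C, 0 <= mean_fun C ;
  meanU : forall C D, clopen C -> clopen D -> C `&` D = set0 ->
    mean_fun (C `|` D) = mean_fun C + mean_fun D ;
  meanT : mean_fun setT = 1
}.
Arguments meanT {R T}.
Arguments mean_ge0 {R T}.

Section ClopenMean.
Context {R : realType} {T : topologicalType} (m : clopen_mean R T).

Lemma mean0 : m set0 = 0.
Proof.
have := meanU m clopenT clopen0 (setI0 _).
by rewrite setU0 -[LHS]addr0 => /addrI.
Qed.

Lemma mean_le C D : clopen C -> clopen D -> C `<=` D -> m C <= m D.
Proof.
move=> cC cD CD; have -> : D = C `|` (D `&` ~` C).
  by rewrite -setDE setDUK.
rewrite meanU ?lerDl ?mean_ge0//.
- by apply: clopenI => //; exact: clopenC.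
- by rewrite setICA setICr setI0.
Qed.

Lemma mean_subadd C D : clopen C -> clopen D -> m (C `|` D) <= m C + m D.
Proof.
move=> cC cD; have cDC : clopen (D `&` ~` C).
  by apply: clopenI => //; exact: clopenC.
have -> : C `|` D = C `|` (D `&` ~` C) by apply/seteqP; split => x /=; have [|] := pselect (C x); tauto.
rewrite meanU//; last by rewrite setICA setICr setI0.
by rewrite lerD2l mean_le.
Qed.

End ClopenMean.

Section ClopenContent.
Context {R : realType} {T : ptopologicalType} (T_compact : compact [set: T]).
Context (m : clopen_mean R T).

(* Compactness is an argument only so that the measure instance below can
   depend on it. *)
Definition clopen_content of compact [set: T] := fun (C : set (clopen_algebra T)) => (m C)%:E.

Lemma clopen_content_ge0 C : (0 <= clopen_content T_compact (C : set (clopen_algebra T)))%E.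
Proof. by rewrite lee_fin mean_ge0. Qed.

Lemma clopen_content_semi_additive : measure_function.semi_additive (clopen_content T_compact).
Proof.
apply/additive2P.
  by rewrite /clopen_content mean0.
by move=> C D cC cD CD; rewrite /clopen_content meanU.
Qed.

HB.instance Definition _ := isContent.Build _ _ _ (clopen_content T_compact)
  clopen_content_ge0 clopen_content_semi_additive.

(* A clopen set covered by countably many clopen sets is, by compactness,
   covered by finitely many of them. *)
Lemma clopen_content_sigma_subadditive :
  measurable_subset_sigma_subadditive (clopen_content T_compact).
Proof.
move=> A F cF cA AF.
have : compact A by apply: (subclosed_compact _ T_compact) => //; case: cA.
rewrite compact_cover => /(_ nat setT F) [].
- by move=> i _; have [] := cF i.
- exact: AF.
move=> D _ AD.
pose n := (\max_(i <- finmap.enum_fset D) i).+1.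
have An : A `<=` \big[setU/set0]_(i < n) F i.
  move=> x /AD [i /= iD Fix]; rewrite -bigcup_mkord; exists i => //=.
  by rewrite /n ltnS; exact: leq_bigmax_seq.
have cUn k : clopen (\big[setU/set0]_(i < k) F i).
  elim: k => [|k IH]; first by rewrite big_ord0; exact: clopen0.
  by rewrite big_ord_recr; apply: clopenU => //; exact: cF.
apply: (@le_trans _ _ (\sum_(i < n) clopen_content T_compact (F i))%E); last first.
  rewrite -(big_mkord xpredT (fun i => clopen_content T_compact (F i))).
  exact: nneseries_lim_ge.
rewrite /clopen_content sumEFin lee_fin (le_trans (mean_le m cA (cUn n) An))//.
elim: n {An} => [|k IH]; first by rewrite !big_ord0 mean0.
rewrite !big_ord_recr/= (le_trans (mean_subadd m (cUn k) (cF k)))//.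
by rewrite lerD2r.
Qed.

HB.instance Definition _ := Content_SigmaSubAdditive_isMeasure.Build _ _ _
  (clopen_content T_compact) clopen_content_sigma_subadditive.

End ClopenContent.

Section ImageProbability.
Context d d' (T : measurableType d) (T' : measurableType d') (R : realType).
Context (nu : {measure set T -> \bar R}) (f : T -> T').
Context (mf : measurable_fun setT f) (nu1 : nu setT = 1%E).

(** [nu] is only known as a measure of total mass 1, so both proofs are arguments: the instances
    below recover from them additivity and the total mass. *)
Definition image_probability of measurable_fun setT f & nu setT = 1%E :
  set T' -> \bar R := fun A => nu (f @^-1` A).

Notation P := (image_probability mf nu1).

Lemma image_probability0 : P set0 = 0%E.
Proof. by rewrite /image_probability preimage_set0 measure0. Qed.

Lemma image_probability_ge0 A : (0 <= P A)%E.
Proof. exact: measure_ge0. Qed.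

Lemma image_probability_sigma_additive : semi_sigma_additive P.
Proof.
move=> F mF tF mUF; rewrite /image_probability preimage_bigcup.
apply: measure_semi_sigma_additive.
- by move=> n; rewrite -[X in measurable X]setTI; exact: mf.
- apply/trivIsetP => /= i j _ _ ij; rewrite -preimage_setI.
  by move/trivIsetP : tF => /(_ _ _ _ _ ij) ->//; rewrite preimage_set0.
- by rewrite -preimage_bigcup -[X in measurable X]setTI; exact: mf.
Qed.

HB.instance Definition _ := isMeasure.Build _ _ _ P
  image_probability0 image_probability_ge0 image_probability_sigma_additive.

Lemma image_probabilityT : P setT = 1%E.
Proof. by rewrite /image_probability preimage_setT. Qed.

HB.instance Definition _ := Measure_isProbability.Build _ _ _ P
  image_probabilityT.

End ImageProbability.

Definition countable_base (X : topologicalType) (I : countType)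
    (b : I -> set X) :=
  (forall i, open (b i)) /\
  forall x U, nbhs x U -> exists i, b i x /\ b i `<=` U.

Section ClopenGenerated.
Context {T : ptopologicalType} {I : countType} (b : I -> set T).
Context (b_clopen : forall i, clopen (b i)) (b_base : countable_base b).

Lemma open_bigcup_base (U : set T) : open U ->
  U = \bigcup_(i in [set i | b i `<=` U]) b i.
Proof.
move=> oU; apply/seteqP; split => [x Ux|x [i /= bU /bU//]].
have [i [bx bU]] := b_base.2 x U (open_nbhs_nbhs (conj oU Ux)).
by exists i.
Qed.

Lemma open_sigma_clopen (U : set T) : open U -> <<s @clopen T >> U.
Proof.
move=> /open_bigcup_base ->; rewrite bigcup_mkcond.
apply: (@countable_bigcupT_measurable _ (g_sigma_algebraType (@clopen T))) => [|i].
  exact: countableP.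
case: ifPn => _; last exact: measurable0.
exact: sub_sigma_algebra.
Qed.

Lemma sigma_clopenE : <<s @open T >> = <<s @clopen T >>.
Proof.
apply/seteqP; split; apply: smallest_sub;
  [exact: smallest_sigma_algebra| |exact: smallest_sigma_algebra|].
  by move=> U; exact: open_sigma_clopen.
by move=> U [oU _]; exact: sub_sigma_algebra.
Qed.

(** Caratheodory extension of the content, which compactness has made sigma-subadditive. *)
Lemma clopen_extension {R : realType} (m : clopen_mean R T) :
  compact [set: T] ->
  exists mu : probability (Borel T) R,
    forall C, clopen C -> mu C = (m C)%:E.
Proof.
move=> cT.
pose mc := clopen_content m cT.
pose nu := measure_extension mc.
have nuE C : clopen C -> nu C = (m C)%:E.
  by move=> cC; rewrite /nu /measure_extension measurable_mu_extE.
(* The identity between two presentations of one sigma-algebra; the image measure along it only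
   changes the type. *)
pose f : g_sigma_algebraType (@measurable _ (clopen_algebra T)) -> Borel T := id.
have mf : measurable_fun setT f.
  move=> _ Y mY; rewrite setTI; move: mY; rewrite /measurable/= sigma_clopenE.
  exact.
have nu1 : nu setT = 1%E by rewrite nuE ?meanT//; exact: clopenT.
by exists (image_probability mf nu1) => C cC; exact: nuE.
Qed.

Lemma clopen_measure_unique {R : realType} (mu nu : {measure set (Borel T) -> \bar R}) :
  (mu setT < +oo)%E -> (forall C, clopen C -> mu C = nu C) ->
  forall A : set (Borel T), measurable A -> mu A = nu A.
Proof.
move=> mufin munu A mA.
apply: (@measure_unique _ _ (Borel T) (@clopen T) (fun=> setT)) => //.
- by rewrite /measurable/= sigma_clopenE.
- exact: clopenI.
- by move=> _; exact: clopenT.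
- by rewrite bigcup_const//; exists 0%N.
Qed.

End ClopenGenerated.

(** * Extremal means give ergodic measures *)

Lemma continuous_Borel_measurable (X Y : ptopologicalType) (f : X -> Y) :
  continuous f -> measurable_fun setT (f : Borel X -> Borel Y).
Proof.
move=> cf; apply: (@measurability _ _ (Borel X) (Borel Y) setT f (@open Y)) => //.
move=> _ [U oU <-]; rewrite setTI.
by apply: sub_sigma_algebra; move/continuousP: cf; exact.
Qed.

Section MeanTheory.
Context {R : realType} {T : topologicalType} (m : clopen_mean R T).

Lemma mean_le1 C : clopen C -> m C <= 1.
Proof. by move=> cC; rewrite -(meanT m) mean_le//; exact: clopenT. Qed.

End MeanTheory.

Section MeanLimit.
Context {R : realType} {T : topologicalType}.
Context (U : set_system nat) (UF : ProperFilter U).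
Context (ucvg : forall x : nat -> R, (exists b, forall n, `|x n| <= b) -> cvg (x @ U)).

Lemma bounded_by (x : nat -> R) b : (forall n, 0 <= x n) -> (forall n, x n <= b) ->
  cvg (x @ U).
Proof. by move=> x0 xb; apply: ucvg; exists b => n; rewrite ger0_norm. Qed.

Context (m : nat -> set T -> R).
Context (m_ge0 : forall n C, 0 <= m n C) (m_le1 : forall n C, clopen C -> m n C <= 1).

(** The bound [m_le1], hence the limit, is available on clopen sets only; the value 0 elsewhere
    keeps the mean nonnegative on all sets. *)
Definition mean_limit (C : set T) : R :=
  if `[< clopen C >] then lim (m n C @[n --> U]) else 0.

Lemma mean_limitE C : clopen C -> mean_limit C = lim (m n C @[n --> U]).
Proof. by move=> cC; rewrite /mean_limit asboolT. Qed.

Lemma mean_cvg C : clopen C -> m n C @[n --> U] --> mean_limit C.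
Proof. by move=> cC; rewrite mean_limitE//; apply: bounded_by => // n; exact: m_le1. Qed.

Lemma mean_limit_exists :
  (forall n C D, clopen C -> clopen D -> C `&` D = set0 ->
    m n (C `|` D) = m n C + m n D) ->
  (forall n, m n setT = 1) ->
  exists mm : clopen_mean R T, forall C, clopen C -> m n C @[n --> U] --> mm C.
Proof.
move=> mU mT.
unshelve eexists (@ClopenMean _ _ mean_limit _ _ _).
- move=> C; have [cC|ncC] := pselect (clopen C); last first.
    by rewrite /mean_limit asboolF.
  rewrite mean_limitE//; apply: limr_ge; first exact: (cvgP _ (mean_cvg cC)).
  by apply: nearW => n; exact: m_ge0.
- move=> C D cC cD CD; apply: (@cvg_unique R _ (m n (C `|` D) @[n --> U])) => //.
    by apply: mean_cvg; exact: clopenU.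
  have -> : (fun n => m n (C `|` D)) = (fun n => m n C + m n D).
    by apply/funext => n; exact: mU.
  by apply: cvgD; exact: mean_cvg.
- apply: (@cvg_unique R _ (m n setT @[n --> U])) => //.
    by apply: mean_cvg; exact: clopenT.
  have -> : (fun n => m n setT) = (fun=> 1) by apply/funext.
  exact: cvg_cst.
by move=> C cC; exact: mean_cvg.
Qed.

End MeanLimit.

(** * A strictly convex functional on means *)

Section StrictlyConvex.
Context {R : realType} {T : topologicalType} (e : nat -> set T).
Context (e_clopen : forall n, clopen (e n)).
Implicit Types m : clopen_mean R T.

(* A strictly convex function of the restriction of m to the sets e j. *)
Definition square_sum (J : nat) m : R :=
  \sum_(j < J) (2^-1) ^+ j.+1 * m (e j) ^+ 2.

Definition square_series m : R := sup (range (square_sum ^~ m)).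

Lemma square_term_ge0 (m : clopen_mean R T) j : 0 <= (2^-1) ^+ j.+1 * m (e j) ^+ 2.
Proof. by rewrite mulr_ge0// ?sqr_ge0// exprn_ge0. Qed.

Lemma square_sum_nd m J K : (J <= K)%N -> square_sum J m <= square_sum K m.
Proof.
move=> JK; rewrite /square_sum -(subnKC JK) big_split_ord/= lerDl.
by apply: sumr_ge0 => i _; exact: square_term_ge0.
Qed.

(** The tail bound is uniform in m, each [m (e j)] lying in [0, 1]. This uniformity lets the series
    pass to limits of means. *)
Lemma square_sum_tail m J K : square_sum K m <= square_sum J m + (2^-1) ^+ J.
Proof.
have [JK|/ltW KJ] := leP J K; last first.
  by rewrite (le_trans (square_sum_nd _ KJ))// lerDl exprn_ge0.
(* Strengthened by the term in K so that the induction telescopes. *)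
suff : square_sum K m <= square_sum J m + (2^-1) ^+ J - (2^-1) ^+ K.
  by move=> /le_trans; apply; rewrite gerDl oppr_le0 exprn_ge0.
rewrite -(subnKC JK); elim: (K - J)%N => [|n IH]; first by rewrite addn0 addrK.
rewrite addnS {1}/square_sum big_ord_recr/= -/(square_sum _ m).
have : m (e (J + n)) ^+ 2 <= 1.
  by rewrite expr_le1// ?mean_ge0// mean_le1.
have : 0 <= (2^-1 : R) ^+ (J + n) by rewrite exprn_ge0.
rewrite (exprS _ (J + n)); move: IH.
move: (square_sum J m) (square_sum (J + n) m) (_ ^+ J) (_ ^+ (J + n)) (_ ^+ 2).
move=> a a' x y z IH y0 z1.
have yz : y * z <= y by rewrite ler_piMr.
lra.
Qed.

Lemma square_sum_has_sup m : has_sup (range (square_sum ^~ m)).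
Proof.
split; first by exists (square_sum 0 m), 0%N.
by exists (square_sum 0 m + (2^-1) ^+ 0) => _ [K _ <-]; exact: square_sum_tail.
Qed.

Lemma square_sum_le m J : square_sum J m <= square_series m.
Proof. by apply: ub_le_sup; [have [] := square_sum_has_sup m|exists J]. Qed.

Lemma square_series_tail m J : square_series m <= square_sum J m + (2^-1) ^+ J.
Proof.
apply: ge_sup; first by have [] := square_sum_has_sup m.
by move=> _ [K _ <-]; exact: square_sum_tail.
Qed.

(** From t x^2 + (1 - t) y^2 - (t x + (1 - t) y)^2 = t (1 - t) (x - y)^2: if the means differ on
    [e j], the j-th term alone leaves a fixed gap [dl] below the convex combination in all partial
    sums beyond j. *)
Lemma square_series_convex m m1 m2 t : 0 < t < 1 ->
  (forall C, clopen C -> m C = t * m1 C + (1 - t) * m2 C) ->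
  square_series m1 <= square_series m -> square_series m2 <= square_series m ->
  forall j, m1 (e j) = m2 (e j).
Proof.
move=> /andP[t0 t1] mE F1 F2 j; apply/eqP/negPn/negP => /eqP neq.
pose dl := (2^-1) ^+ j.+1 * (t * (1 - t) * (m1 (e j) - m2 (e j)) ^+ 2).
have dl0 : 0 < dl.
  rewrite mulr_gt0 ?exprn_gt0// mulr_gt0//.
    by rewrite mulr_gt0// subr_gt0.
  by rewrite exprn_even_gt0//= subr_eq0; exact/eqP.
suff : square_series m <= square_series m - dl.
  by rewrite lerBrDr gerDl leNgt dl0.
have ub J : (j < J)%N -> square_sum J m <= square_series m - dl.
  move=> jJ; rewrite lerBrDr.
  have -> : square_series m =
      t * square_series m + (1 - t) * square_series m by ring.
  apply: (@le_trans _ _ (t * square_sum J m1 + (1 - t) * square_sum J m2)).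
    rewrite -lerBrDl /square_sum !mulr_sumr -big_split/= -sumrB.
    rewrite (bigD1 (Ordinal jJ))//= -[leLHS]addr0.
    apply: lerD; first by rewrite mE// le_eqVlt; apply/orP; left; apply/eqP; rewrite /dl; ring.
    apply: sumr_ge0 => i _; rewrite mE//.
    have : 0 <= (2^-1 : R) ^+ i.+1 * (t * (1 - t) * (m1 (e i) - m2 (e i)) ^+ 2).
      apply: mulr_ge0; first by rewrite exprn_ge0.
      by rewrite mulr_ge0 ?sqr_ge0// mulr_ge0 ?subr_ge0// ltW.
    by move=> /le_trans; apply; rewrite le_eqVlt; apply/orP; left; apply/eqP; ring.
  have := square_sum_le m1 J; have := square_sum_le m2 J.
  move: F1 F2; nra.
apply: ge_sup; first by have [] := square_sum_has_sup m.
move=> _ [J _ <-]; have [jJ|Jj] := ltnP j J; first exact: ub.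
by apply: (le_trans (square_sum_nd m (leqW Jj))); exact: ub.
Qed.

End StrictlyConvex.

Section ErgodicExtremal.
Context {R : realType} {T : ptopologicalType} {B : countType} (b : B -> set T).
Context (T_compact : compact [set: T]).
Context (b_clopen : forall i, clopen (b i)) (b_base : countable_base b).
Context (tau : T -> T) (tau_cts : continuous tau).
Context (I : Type) (E : I -> set T) (p : I -> R).
Context (E_clopen : forall i, clopen (E i)).

Definition invariant_mean (m : clopen_mean R T) :=
  forall C, clopen C -> m (tau @^-1` C) = m C.

Definition prescribed (m : clopen_mean R T) := forall i, m (E i) = p i.

Lemma clopen_enumeration : exists2 e : nat -> set T, forall n, clopen (e n) &
  forall C, clopen C -> exists n, e n = C.
Proof.
have sc : @second_countable T.
  exists (range b); first by apply: card_le_trans (card_image_le _ _) _; exact: countableP.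
  split=> [_ [i _ <-]|x U Ux]; first by have [] := b_clopen i.
  have [i [bix biU]] := b_base.2 x U Ux.
  by exists (b i) => //; split => //; exists i.
have /pfcard_geP h := clopen_countable T_compact sc.
case: h => [c0|[f]].
  by have := @clopen0 T; rewrite c0.
exists f => [n|C cC]; first exact: funS.
by have [n _ <-] := 'surj_f cC; exists n.
Qed.

(** The limit of a maximizing sequence along the ultrafilter: invariance and prescribed values are
    equations between values on clopen sets, so they survive. *)
Lemma maximal_mean (e : nat -> set T) : (forall n, clopen (e n)) ->
  (exists m, invariant_mean m /\ prescribed m) ->
  exists m, [/\ invariant_mean m, prescribed m &
    forall m', invariant_mean m' -> prescribed m' ->
      square_series e m' <= square_series e m].
Proof.
move=> ce [m0 [im0 pm0]].
pose S := [set square_series e m | m in [set m | invariant_mean m /\ prescribed m]].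
have supS : has_sup S.
  split; first by exists (square_series e m0), m0.
  exists (1 : R) => _ [m _ <-]; apply: (le_trans (square_series_tail ce m 0)).
  by rewrite /square_sum big_ord0 add0r expr0.
have mn n : exists m, [/\ invariant_mean m, prescribed m &
    sup S - n.+1%:R^-1 < square_series e m].
  have [//|_ [m [im pm] <-] ltm] := @sup_adherent _ S n.+1%:R^-1 _ supS.
  by exists m.
have {mn}[m_ /all_and3[im pm ltm]] := choice mn.
have [U [UU sU ucvg]] := @ultralimit_exists R.
have UP : ProperFilter U by exact: ultra_proper.
have [||||m mE] := @mean_limit_exists R T U UP ucvg (fun n C => m_ n C).
- by move=> n C; exact: mean_ge0.
- by move=> n C cC; exact: mean_le1.
- by move=> n C D cC cD CD; exact: meanU.
- by move=> n; exact: meanT.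
exists m; split.
- move=> C cC; apply: (@cvg_unique R _ (m_ n (tau @^-1` C) @[n --> U])) => //.
    by apply: mE; exact: preimage_clopen.
  have -> : (fun n => m_ n (tau @^-1` C)) = (fun n => m_ n C).
    by apply/funext => n; exact: im.
  exact: mE.
- move=> i; apply: (@cvg_unique R _ (m_ n (E i) @[n --> U])) => //.
    exact: mE.
  have -> : (fun n => m_ n (E i)) = (fun=> p i) by apply/funext => n; exact: pm.
  exact: cvg_cst.
move=> m' im' pm'; apply: (@le_trans _ _ (sup S)).
  by apply: ub_le_sup; [have [] := supS|exists m'].
have half_cvg : (fun n : nat => (2^-1 : R) ^+ n) @ \oo --> (0 : R).
  by apply: cvg_expr; rewrite ger0_norm// invf_lt1// ltr1n.
(* A finite partial sum passes to the limit along U; the uniform tail costs 2^-J, which is sent to 0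
   afterwards. *)
have supJ J : sup S <= square_sum e J m + (2^-1) ^+ J.
  have cvgJ : square_sum e J (m_ n) @[n --> U] --> square_sum e J m.
    rewrite /square_sum; elim: J => [|J IH].
      rewrite big_ord0 (_ : (fun n => _) = fun=> 0); first exact: cvg_cst.
      by apply/funext => n; rewrite big_ord0.
    rewrite big_ord_recr/=.
    rewrite (_ : (fun n => _) = fun n => square_sum e J (m_ n) +
        (2^-1) ^+ J.+1 * (m_ n (e J) * m_ n (e J))); last first.
      by apply/funext => n; rewrite big_ord_recr.
    apply: cvgD; first exact: IH.
    apply: cvgM; first exact: cvg_cst.
    by apply: cvgM; exact: mE.
  have cvg1 : square_sum e J (m_ n) + (2^-1) ^+ J + n.+1%:R^-1 @[n --> U] -->
      square_sum e J m + (2^-1) ^+ J + 0.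
    apply: cvgD; first by apply: cvgD => //; exact: cvg_cst.
    by apply: cvg_trans (@cvg_harmonic R); apply: cvg_app.
  rewrite -[leRHS]addr0 -(cvg_lim _ cvg1)//.
  apply: limr_ge; first exact: (cvgP _ cvg1).
  apply: nearW => n; rewrite -lerBlDr (le_trans (ltW (ltm n)))//.
  exact: square_series_tail.
have cvg2 : (fun J => square_series e m + (2^-1) ^+ J) @ \oo -->
    square_series e m + 0.
  by apply: cvgD => //; exact: cvg_cst.
rewrite -[leRHS]addr0 -(cvg_lim _ cvg2)//.
apply: limr_ge; first exact: (cvgP _ cvg2).
apply: nearW => J; apply: (le_trans (supJ J)); rewrite lerD2r.
exact: square_sum_le.
Qed.

Lemma mean_conditional (mu : probability (Borel T) R) (A : set (Borel T)) :
  measurable A -> (0 < mu A)%E -> tau @^-1` A = A ->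
  invariant_measure tau mu ->
  exists2 m : clopen_mean R T, invariant_mean m &
    forall C, clopen C -> fine (mu (C `&` A)) = fine (mu A) * m C.
Proof.
move=> mA A0 tA imu.
have mC C : clopen C -> measurable (C : set (Borel T)).
  by move=> [oC _]; exact: sub_sigma_algebra.
have fin (C : set (Borel T)) : measurable C -> mu C \is a fin_num.
  by move=> mC'; exact: fin_num_measure.
have fA : mu A \is a fin_num by exact: fin.
have A0' : 0 < fine (mu A) by rewrite fine_gt0// A0/= ltey_eq fA.
have AC C : clopen C -> measurable (C `&` A : set (Borel T)).
  by move=> /mC mC'; exact: measurableI.
unshelve eexists (@ClopenMean _ _ (fun C => fine (mu (C `&` A)) / fine (mu A)) _ _ _).
- by move=> C; rewrite divr_ge0// ?fine_ge0.
- move=> C D cC cD CD /=; rewrite -mulrDl -fineD ?fin//; try exact: AC.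
  rewrite -measureU//; try exact: AC.
    by rewrite setIUl.
  by rewrite setIACA CD set0I.
- by rewrite /= setTI divff// gt_eqF.
- move=> C cC /=; rewrite -{1}tA -preimage_setI imu//; exact: AC.
by move=> C cC /=; rewrite mulrC divfK// gt_eqF.
Qed.

(* The second hypothesis makes the prescribed means a face of the simplex of
   invariant means, so that both halves of the decomposition of a maximizer
   along an invariant set are again prescribed. *)
Theorem ergodic_extremal :
  (exists m, invariant_mean m /\ prescribed m) ->
  (forall m m' c, invariant_mean m -> prescribed m -> invariant_mean m' ->
    (forall C, clopen C -> m' C <= c * m C) -> prescribed m') ->
  exists mu : probability (Borel T) R,
    ergodic_measure tau mu /\ forall i, mu (E i) = (p i)%:E.
Proof.
move=> exm face.
have [e ce eE] := clopen_enumeration.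
have [m [im pm mmax]] := maximal_mean ce exm.
have [mu muE] := clopen_extension b_clopen b_base m T_compact.
have mtau : measurable_fun setT (tau : Borel T -> Borel T).
  exact: continuous_Borel_measurable.
have imu : invariant_measure tau mu.
  have tau1 : mu setT = 1%E by rewrite probability_setT.
  move=> A mA; pose nu := image_probability mtau tau1.
  have -> : mu (tau @^-1` A) = nu A by [].
  apply/esym/(clopen_measure_unique b_clopen b_base) => //.
    by have := ltry (1 : R); rewrite -tau1.
  move=> C cC; transitivity (m C)%:E; first exact: muE.
  by rewrite -(im C cC); apply/esym/muE; exact: preimage_clopen.
exists mu; split; last by move=> i; rewrite muE ?pm.
split => // A mA tA.
have [|A0] := eqVneq (mu A) 0%E; first by left.
have [|A1] := eqVneq (mu A) 1%E; first by right.
exfalso.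
have mAc : measurable (~` A) by exact: measurableC.
have Apos : (0 < mu A)%E by rewrite lt0e A0/=.
have fA : mu A \is a fin_num by exact: fin_num_measure.
have muAc : mu (~` A) = (1 - mu A)%E by exact: probability_setC.
have t1 : fine (mu A) < 1.
  rewrite -lte_fin fineK// lt_neqAle A1/=.
  exact: probability_le1.
have Acpos : (0 < mu (~` A))%E.
  by rewrite muAc sube_gt0 -(fineK fA) lte_fin.
have [m1 im1 m1E] := mean_conditional mA Apos tA imu.
have [|m2 im2 m2E] := mean_conditional mAc Acpos _ imu.
  by rewrite preimage_setC; congr (~` _); exact: tA.
set t := fine (mu A) in m1E t1.
have t0 : 0 < t by rewrite fine_gt0// Apos ltey_eq fA.
have m2t : fine (mu (~` A)) = 1 - t by rewrite muAc fineB.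
have mE C : clopen C -> m C = t * m1 C + (1 - t) * m2 C.
  move=> cC; rewrite -m1E// -m2t -m2E//.
  have mC : measurable (C : set (Borel T)).
    by have [oC _] := cC; exact: sub_sigma_algebra.
  have mCA : measurable ((C : set (Borel T)) `&` A) by exact: measurableI.
  have mCAc : measurable ((C : set (Borel T)) `&` ~` A) by exact: measurableI.
  have muD : (mu (C `&` A) + mu (C `&` ~` A) = mu C)%E.
    by rewrite -measureU// -?setIUr ?setUv ?setIT// setIACA setICr setI0.
  rewrite -fineD; [|exact: fin_num_measure|exact: fin_num_measure].
  by rewrite muD muE.
have pm1 : prescribed m1.
  apply: (face m m1 t^-1) => // C cC.
  rewrite mE// mulrDr mulrA mulVf ?gt_eqF// mul1r lerDl.
  by rewrite !mulr_ge0// ?invr_ge0 ?mean_ge0// ?subr_ge0 ltW.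
have pm2 : prescribed m2.
  apply: (face m m2 (1 - t)^-1) => // C cC.
  rewrite mE// mulrDr (mulrA _ (1 - t)) mulVf ?gt_eqF ?subr_gt0// mul1r lerDr.
  by rewrite !mulr_ge0// ?invr_ge0 ?mean_ge0// ?subr_ge0 ltW.
(* Both halves are admissible, so neither exceeds the maximum attained at m; strict convexity then
   identifies them. *)
have m12 C : clopen C -> m1 C = m2 C.
  move=> /eE[n <-]; apply: (square_series_convex ce _ mE).
  - by rewrite t0.
  - exact: mmax.
  - exact: mmax.
have m1m C : clopen C -> m1 C = m C.
  by move=> cC; rewrite mE// -m12//; ring.
(* Conditioning on A gives back m, so A is independent of every clopen set, hence of every Borel set
   and of A itself: t = t * t, which excludes 0 < t < 1. *)
have muAt (D : set (Borel T)) : measurable D -> mu (D `&` A) = (t%:E * mu D)%E.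
  move=> mD.
  apply: (@clopen_measure_unique _ _ _ b_clopen b_base R (mrestr mu mA)
    (mscale (NngNum (ltW t0)) mu)) => //.
    by apply: (@le_lt_trans _ _ (mu setT)); [exact: measureIl|
      have := ltry (1 : R); rewrite -(probability_setT mu)].
  move=> C cC; have mC : measurable (C : set (Borel T)).
    by have [oC _] := cC; exact: sub_sigma_algebra.
  transitivity (fine (mu (C `&` A)))%:E.
    by rewrite fineK//; apply: fin_num_measure; exact: measurableI.
  rewrite m1E// m1m// EFinM; congr (_ * _)%E.
  by apply/esym/muE.
have := muAt A mA; rewrite setIid -[in LHS](fineK fA) -[in RHS](fineK fA) -EFinM.
move=> [] /eqP; rewrite -/t -subr_eq0 -{1}[t]mulr1 -mulrBr mulf_eq0 gt_eqF//=.
by rewrite subr_eq0 => /eqP te; rewrite -te ltxx in t1.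
Qed.

End ErgodicExtremal.

(** * Equidistribution *)

Section FinitePartition.
Context {R : realType} {T : topologicalType} (m : clopen_mean R T).
Context (V : finType) (f : T -> V) (f_clopen : forall v, clopen (f @^-1` [set v])).

Lemma clopen_fiber (P : pred V) : clopen [set x | P (f x)].
Proof.
have -> : [set x | P (f x)] = \bigcup_(v in [set` P]) f @^-1` [set v].
  apply/seteqP; split => [x Px|x [v Pv /= ->//]].
  by exists (f x).
have fP : finite_set [set` P] by exact: finite_finset.
split; first by apply: bigcup_open => v _; have [] := f_clopen v.
by apply: closed_bigcup => // v _; have [] := f_clopen v.
Qed.

Lemma mean_partition (P : pred V) :
  m [set x | P (f x)] = \sum_(v | P v) m (f @^-1` [set v]).
Proof.
have h (s : seq V) : uniq s ->
    m [set x | f x \in s] = \sum_(v <- s) m (f @^-1` [set v]).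
  elim: s => [|a s IH] /=.
    move=> _; rewrite big_nil (_ : [set _ | _] = set0) ?mean0//.
    by apply/seteqP; split.
  move=> /andP[nas us]; rewrite big_cons -IH//.
  rewrite -meanU//; last 2 first.
  - exact: clopen_fiber.
  - apply/seteqP; split => // x [/= -> fxs].
    by rewrite fxs in nas.
  congr (m _); apply/seteqP; split => x /=; rewrite inE.
    by move=> /orP[/eqP ->|]; [left|right].
  by move=> [->|->]; rewrite ?eqxx ?orbT.
rewrite -big_filter -h ?filter_uniq ?index_enum_uniq//.
congr (m _); apply/seteqP; split => x /=; rewrite mem_filter mem_index_enum andbT//.
Qed.

End FinitePartition.

(** Uniform words have independent letters, and X is centred, so the off-diagonal products sum to
    zero; only the N diagonal terms remain, each at most 1 per word. *)
Lemma sum_square_words (R : realFieldType) (L : finType) (N : nat) (X : L -> R) :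
  \sum_l X l = 0 -> (forall l, `|X l| <= 1) ->
  \sum_(v : {ffun 'I_N -> L}) (\sum_j X (v j)) ^+ 2 <= N%:R * #|L|%:R ^+ N.
Proof.
move=> X0 X1.
under eq_bigr => v _ do rewrite expr2 mulr_suml.
rewrite exchange_big/=.
have -> : N%:R * #|L|%:R ^+ N = \sum_(j < N) #|L|%:R ^+ N :> R.
  by rewrite sumr_const card_ord mulr_natl.
apply: ler_sum => j _.
under eq_bigr => v _ do rewrite mulr_sumr.
rewrite exchange_big/= (bigD1 j)//= [Y in _ + Y]big1 ?addr0.
  apply: (@le_trans _ _ (\sum_(v : {ffun 'I_N -> L}) 1)).
    apply: ler_sum => v _; rewrite -expr2 -real_normK ?num_real//.
    by rewrite expr_le1.
  by rewrite sumr_const card_ffun card_ord natrX.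
move=> k kj.
(* The product of the two factors is written as a product over all positions, so that the sum over
   words factors and the factor at j is the zero sum of X. *)
pose F (i : 'I_N) (l : L) := if (i == j) || (i == k) then X l else 1.
transitivity (\sum_(v : {ffun 'I_N -> L}) \prod_i F i (v i)).
  apply: eq_bigr => v _; rewrite (bigD1 j)//= (bigD1 k)//= big1 ?mulr1.
    by rewrite /F !eqxx orbT.
  by move=> i /andP[ij ik]; rewrite /F (negbTE ij) (negbTE ik).
rewrite -(bigA_distr_bigA F) (bigD1 j)//= {1}/F eqxx/= X0 mul0r//.
Qed.

Section LawOfLargeNumbers.
Context {R : realType} {T : topologicalType} (m : clopen_mean R T).
Context (L : finType) (l : T -> L) (l_clopen : forall a, clopen (l @^-1` [set a])).
Context (S : T -> T) (S_cts : continuous S).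
Context (m_inv : forall C, clopen C -> m (S @^-1` C) = m C).

Definition word (N : nat) (x : T) : {ffun 'I_N -> L} :=
  [ffun j : 'I_N => l (iter j S x)].

Lemma iter_cts j : continuous (iter j S).
Proof.
elim: j => [|j IH] x; first exact: cvg_id.
by apply: continuous_comp; [exact: IH|exact: S_cts].
Qed.

Lemma word_clopen N v : clopen (@word N @^-1` [set v]).
Proof.
have -> : @word N @^-1` [set v] =
    \bigcap_(j in [set: 'I_N]) (l \o iter j S) @^-1` [set v j].
  apply/seteqP; split => x /=.
    by move=> <- j _ /=; rewrite ffunE.
  by move=> h; apply/ffunP => j; rewrite ffunE; exact: h.
have h (j : 'I_N) : clopen ((l \o iter j S) @^-1` [set v j]).
  by rewrite comp_preimage; apply: preimage_clopen => //; exact: iter_cts.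
split; last by apply: closed_bigI => j _; have [] := h j.
rewrite -[X in open X]setCK setC_bigcap; apply: closed_openC.
apply: closed_bigcup => [|j _]; first exact: finite_finset.
by apply: open_closedC; have [] := h j.
Qed.

Lemma mean_iter j C : clopen C -> m (iter j S @^-1` C) = m C.
Proof.
elim: j C => [|j IH] C cC; first by [].
have -> : iter j.+1 S @^-1` C = iter j S @^-1` (S @^-1` C) by [].
by rewrite IH ?m_inv//; exact: preimage_clopen.
Qed.

(* Chebyshev: under the uniform measure on words, hence under m up to the
   factor c, the square of the deviation of the number of a's has mean O(N). *)
Lemma equidistribution c :
  (forall N v, m (@word N @^-1` [set v]) <= c * #|L|%:R^-1 ^+ N) ->
  forall a, m (l @^-1` [set a]) = #|L|%:R^-1.
Proof.
move=> mc a; set p := #|L|%:R^-1 : R.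
have L0 : (0 < #|L|)%N by apply/card_gt0P; exists a.
have p0 : 0 < p by rewrite invr_gt0 ltr0n.
have p1 : p <= 1 by rewrite invf_le1 ?ltr0n// ler1n.
have c0 : 0 <= c.
  have := mc 0%N [ffun=> a]; rewrite expr0 mulr1.
  by apply: le_trans; exact: mean_ge0.
pose X b : R := (b == a)%:R - p.
have X0 : \sum_b X b = 0.
  rewrite sumrB (bigD1 a)//= eqxx big1 ?addr0; last first.
    by move=> b /negbTE ->.
  by rewrite sumr_const -[p *+ _]mulr_natl mulfV ?subrr// pnatr_eq0 -lt0n.
have X1 b : `|X b| <= 1.
  by rewrite /X ler_norml; case: (b == a) => /=; apply/andP; split; lra.
(* The parameter s comes from the AM-GM inequality and is optimized at the end. *)
have key N s : 0 < s ->
    N%:R * `|m (l @^-1` [set a]) - p| <= s / 2 + c * N%:R / (2 * s).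
  move=> s0; pose q v := m (@word N @^-1` [set v]).
  have q1 : \sum_v q v = 1.
    have /= <- := mean_partition m (@word_clopen N) xpredT.
    by rewrite -[RHS](meanT m); congr (m _); apply/seteqP; split.
  have avg : N%:R * (m (l @^-1` [set a]) - p) = \sum_v q v * \sum_j X (v j).
    under eq_bigr do rewrite mulr_sumr.
    rewrite exchange_big/=.
    transitivity (\sum_(j < N) (m (l @^-1` [set a]) - p)).
      by rewrite sumr_const card_ord mulr_natl.
    apply: eq_bigr => j _; rewrite -(mean_iter j)//.
    under eq_bigr do rewrite mulrBr.
    rewrite sumrB -mulr_suml q1 mul1r; congr (_ - _).
    under eq_bigr do rewrite mulr_natr mulrb.
    rewrite -big_mkcond/= -(mean_partition m (@word_clopen N) (fun v => v j == a)).
    by congr (m _); apply/seteqP; split => x /=; rewrite ffunE => /eqP.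
  rewrite -{1}(ger0_norm (ler0n R N)) -normrM avg.
  apply: (le_trans (ler_norm_sum _ _ _)).
  apply: (@le_trans _ _ (\sum_(v : {ffun 'I_N -> L}) q v * (s / 2 + (\sum_j X (v j)) ^+ 2 / (2 * s)))).
    (* AM-GM: |y| <= s / 2 + y ^ 2 / (2 s) *)
    apply: ler_sum => v _; rewrite normrM ger0_norm ?mean_ge0//.
    apply: ler_wpM2l; first exact: mean_ge0.
    set y := \sum_j _; rewrite -(@ler_pM2r _ (2 * s)) ?mulr_gt0//.
    rewrite [leRHS](_ : _ = s ^+ 2 + y ^+ 2); last by field; rewrite gt_eqF.
    rewrite -[y ^+ 2]real_normK ?num_real//.
    have := sqr_ge0 (`|y| - s); rewrite sqrrB; move: (`|y|) => z; lra.
  under eq_bigr do rewrite mulrDr.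
  rewrite big_split/= -mulr_suml q1 mul1r lerD2l.
  under eq_bigr do rewrite mulrA.
  rewrite -mulr_suml ler_pM2r ?invr_gt0 ?mulr_gt0//.
  apply: (@le_trans _ _ (\sum_(v : {ffun 'I_N -> L}) (c * p ^+ N) * (\sum_j X (v j)) ^+ 2)).
    by apply: ler_sum => v _; apply: ler_wpM2r; [exact: sqr_ge0|exact: mc].
  rewrite -mulr_sumr.
  apply: (@le_trans _ _ ((c * p ^+ N) * (N%:R * #|L|%:R ^+ N))).
    by apply: ler_wpM2l; [rewrite mulr_ge0// exprn_ge0// ltW|exact: sum_square_words].
  rewrite (_ : _ * _ = c * N%:R * (p * #|L|%:R) ^+ N); last by rewrite exprMn; ring.
  by rewrite mulVf ?expr1n ?mulr1// pnatr_eq0 -lt0n.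
apply/eqP; rewrite -subr_eq0 -normr_le0; apply/ler_addgt0Pl => e e0; rewrite addr0.
(* With N = M^2 and s = M, [key] bounds the deviation by (1 + c) / (2 M), which is below e for this
   M. *)
pose M := (Num.truncn ((1 + c) / (2 * e))).+1.
have M0 : 0 < M%:R :> R by rewrite ltr0n.
have Me : (1 + c) / (2 * e) < M%:R by exact: truncnS_gt.
have := key (M * M)%N M%:R M0; rewrite natrM.
have -> : M%:R / 2 + c * (M%:R * M%:R) / (2 * M%:R) = M%:R * ((1 + c) / 2) :> R.
  by field; rewrite gt_eqF.
rewrite -mulrA ler_pM2l//= => h; rewrite -(ler_pM2l M0) (le_trans h)// -ler_pdivrMr//.
rewrite -mulrA -invfM; exact: ltW.
Qed.

End LawOfLargeNumbers.

(** * Symbolic lift of the dynamics *)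

Lemma ptws_cvg (I : Type) (V : topologicalType) (F : set_system (I -> V))
    (f : I -> V) : Filter F ->
  (forall i, (fun g : I -> V => g i) @ F --> f i) -> {ptws, F --> f}.
Proof.
move=> FF h; apply/cvg_sup => i U [W] [[V'] oV <-] Vfi WU.
by apply: (filterS WU); apply: (h i V'); exact: open_nbhs_nbhs.
Qed.

Lemma ptws_cts (Z : topologicalType) (I : Type) (V : topologicalType)
    (f : Z -> {ptws I -> V}) :
  (forall i, continuous (fun z => f z i)) -> continuous f.
Proof. by move=> h z; apply: ptws_cvg => i; exact: h. Qed.

Lemma ptws_eval (I : eqType) (V : topologicalType) (i : I) :
  continuous (fun g : {ptws I -> V} => g i).
Proof. exact: (@proj_continuous I (fun=> V) i). Qed.

Lemma discrete_cts (A : choiceType) (V : topologicalType) (f : discrete_topology A -> V) :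
  continuous f.
Proof. move=> x U /nbhs_singleton Ux.
by apply: (filterS _ (@discrete_set1 (discrete_topology A) x)) => _ ->. Qed.

Section Pattern.
Context {I A : countType}.
Local Notation seqs := {ptws I -> discrete_topology A}.

Lemma eval_clopen i (P : set A) : clopen [set f : seqs | P (f i)].
Proof.
apply: (@preimage_clopen seqs (discrete_topology A) (fun f => f i) P).
  by split; [exact: discrete_open|exact: discrete_closed].
exact: ptws_eval.
Qed.

Definition pattern (s : seq (I * A)) : set seqs :=
  [set f | forall ia, ia \in s -> f ia.1 = ia.2].

Lemma pattern_clopen s : clopen (pattern s).
Proof.
elim: s => [|[i a] s IH].
  by rewrite (_ : pattern _ = setT); [exact: clopenT|apply/seteqP; split].
have -> : pattern ((i, a) :: s) = [set f | f i = a] `&` pattern s.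
  apply/seteqP; split => f /=.
    move=> h; split; first by rewrite (h (i, a)) ?mem_head.
    by move=> r rs; apply: h; rewrite in_cons rs orbT.
  by move=> [fi h] r; rewrite in_cons => /orP[/eqP ->//|]; exact: h.
by apply: clopenI => //; exact: (eval_clopen i [set a]).
Qed.

Lemma pattern_base : countable_base pattern.
Proof.
split; first by move=> s; have [] := pattern_clopen s.
suff h f : filter_from [set s | pattern s f] pattern --> (f : seqs).
  by move=> f U /(h f)[s sf sU]; exists s.
have FF : Filter (filter_from [set s | pattern s f] pattern).
  apply: filter_from_filter; first by exists [::].
  move=> s s' sf s'f; exists (s ++ s').
    by move=> i; rewrite mem_cat => /orP[/sf|/s'f].
  by move=> e h; split => i is_; apply: h; rewrite mem_cat is_ ?orbT.
apply: ptws_cvg => i U /= /nbhs_singleton Uf.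
exists [:: (i, f i)]; first by move=> r; rewrite inE => /eqP ->.
by move=> e /= /(_ (i, f i)); rewrite mem_head => /(_ isT)/= ->.
Qed.

End Pattern.

Section SymbolicSpace.
Context (k : nat).

Definition symbolic : Type := {ptws int * nat -> discrete_topology 'I_k.+1}.
HB.instance Definition _ := Topological.copy symbolic
  {ptws int * nat -> discrete_topology 'I_k.+1}.
HB.instance Definition _ := isPointed.Build symbolic (fun _ => ord0).

Definition translate (y : symbolic) : symbolic := fun q => y (q.1 + 1, q.2).

(* Column 0 carries the letters; the columns j.+1 carry digits of states. *)
Definition symbol (y : symbolic) (n : int) : 'I_k.+1 := y (n, 0%N).

Lemma symbolic_compact : compact [set: symbolic].
Proof.
have fin : finite_set [set: 'I_k.+1] by exact: finite_finset.
have := @tychonoff (int * nat)%type (fun=> discrete_topology 'I_k.+1)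
  (fun=> setT) (fun=> @finite_compact (discrete_topology 'I_k.+1) setT fin).
by congr (compact _); apply/seteqP; split.
Qed.

Lemma symbolic_eval q : continuous (fun y : symbolic => y q : discrete_topology 'I_k.+1).
Proof. exact: ptws_eval. Qed.

Lemma translate_cts : continuous translate.
Proof.
apply: (@ptws_cts (symbolic : topologicalType) (int * nat)%type
  (discrete_topology 'I_k.+1) translate) => q.
exact: (@symbolic_eval (q.1 + 1, q.2)).
Qed.

Lemma iter_translate i y q : iter i translate y q = y (q.1 + i%:Z, q.2).
Proof.
elim: i y q => [|i IH] y [n j] /=; first by rewrite addr0.
by rewrite /translate IH/= -addrA intS.
Qed.

Definition cylinder (s : seq ((int * nat) * 'I_k.+1)) : set symbolic := pattern s.

Lemma cylinder_clopen s : clopen (cylinder s).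
Proof. exact: pattern_clopen. Qed.

Lemma cylinder_base : countable_base cylinder.
Proof. exact: pattern_base. Qed.

End SymbolicSpace.

Lemma closed_coincidence (X Z : topologicalType) (f g : X -> Z) :
  hausdorff_space Z -> continuous f -> continuous g -> closed [set x | f x = g x].
Proof.
move=> hZ cf cg x clx; apply: hZ => U V Ufx Vgx.
have /clx[y [/= fg [Uy Vy]]] : nbhs x (f @^-1` U `&` g @^-1` V).
  by apply: filterI; [exact: cf|exact: cg].
by exists (f y); split => //; rewrite fg.
Qed.

Section CodedDynamics.
Context (k : nat) (St : topologicalType) (St_hausdorff : hausdorff_space St).
Context (code : {ptws nat -> bool} -> St) (code_cts : continuous code).
Context (bit : 'I_k.+1 -> bool) (F : 'I_k.+1 -> St -> St).
Context (F_cts : forall i f, {for code f, continuous (F i)}).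
Context (F_pick : forall f b, exists i g, bit i = b /\ F i (code f) = code g).

Definition digits (y : symbolic k) (n : int) : {ptws nat -> bool} :=
  fun j => bit (y (n, j.+1)).

Definition state (y : symbolic k) (n : int) : St := code (digits y n).

Definition linked (n : int) : set (symbolic k) :=
  [set y | state y (n + 1) = F (symbol y n) (state y n)].

Definition orbits : set (symbolic k) := [set y | forall n, linked n y].

Lemma digits_cts n : continuous (digits ^~ n).
Proof.
apply: (@ptws_cts (symbolic k : topologicalType) nat bool (digits ^~ n)) => j y.
apply: (@continuous_comp (symbolic k) (discrete_topology 'I_k.+1) bool
  (fun y => y (n, j.+1)) bit).
  exact: symbolic_eval.
exact: discrete_cts.
Qed.

Lemma state_cts n : continuous (state ^~ n).
Proof.
by move=> y; apply: continuous_comp; [exact: (@digits_cts n y)|exact: code_cts].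
Qed.

(** The map applied depends on the letter, but near y the letter at n is constant; there one fixed
    map acts, and it is continuous at the coded state. *)
Lemma linked_closed n : closed (linked n).
Proof.
apply: closed_coincidence => //; first exact: state_cts.
move=> y U /= Uy.
have h1 : nbhs y ((fun z => F (symbol y n) (state z n)) @^-1` U).
  exact: (@continuous_comp _ _ _ (state ^~ n) (F (symbol y n)) y
    (@state_cts n y) (@F_cts (symbol y n) (digits y n)) U Uy).
have h2 : nbhs y [set z : symbolic k | [set symbol y n] (z (n, 0%N))].
  apply: open_nbhs_nbhs; split => //.
  by have [] := @eval_clopen _ _ (n, 0%N) [set symbol y n].
change (nbhs y [set z | U (F (symbol z n) (state z n))]).
apply: (@filterS _ (nbhs y) (nbhs_filter y) _ _ _ (filterI h1 h2)) => z /= [Uz zy].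
by rewrite /symbol zy.
Qed.

Lemma orbitsE : orbits = \bigcap_n linked n.
Proof. by apply/seteqP; split => [y h n _|y h n]; exact: h. Qed.

Lemma orbits_compact : compact orbits.
Proof.
apply: (subclosed_compact _ (@symbolic_compact k)) => //.
by rewrite orbitsE; apply: closed_bigI => n _; exact: linked_closed.
Qed.

Lemma iter_linked i n y : linked n (iter i (@translate k) y) <-> linked (n + i%:Z) y.
Proof.
have E j : iter i (@translate k) y (n + j, 0%N) = y (n + j + i%:Z, 0%N).
  by rewrite iter_translate.
have D r : state (iter i (@translate k) y) r = state y (r + i%:Z).
  congr code; apply/funext => j; rewrite /digits iter_translate//.
rewrite /linked /= !D /symbol iter_translate /= (addrAC n 1); tauto.
Qed.

Lemma translate_orbits y : orbits y -> orbits (translate y).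
Proof. by move=> h n; apply/(iter_linked 1 n y); exact: h. Qed.

Lemma orbits_translate y : orbits y -> exists2 z, orbits z & translate z = y.
Proof.
move=> h; exists (fun q => y (q.1 - 1, q.2)); last first.
  by apply/funext => -[n j]; rewrite /translate/= addrK.
move=> n.
have := iter_linked 1 (n - 1) (fun q => y (q.1 - 1, q.2)).
rewrite subrK => -[+ _]; apply.
rewrite (_ : iter _ _ _ = y); first exact: h.
by apply/funext => -[n' j]; rewrite /=/translate/= addrK.
Qed.

Definition words (n : nat) (w : nat -> bool) : set (symbolic k) :=
  [set y | forall i, (i < n)%N -> bit (symbol y i%:Z) = w i].

Lemma words_clopen n w : clopen (words n w).
Proof.
elim: n => [|n IH].
  by rewrite (_ : words _ _ = setT); [exact: clopenT|apply/seteqP; split].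
have -> : words n.+1 w = words n w `&` [set y | [set a | bit a = w n] (y (n%:Z, 0%N))].
  apply/seteqP; split => y /=.
    by move=> h; split; [move=> i ni; apply: h; rewrite ltnS ltnW|exact: h].
  move=> [h hn] i; rewrite ltnS leq_eqVlt => /orP[/eqP ->//|]; exact: h.
by apply: clopenI => //; exact: eval_clopen.
Qed.

Lemma bit_section : exists enc : bool -> 'I_k.+1, forall b, bit (enc b) = b.
Proof.
have h b : exists i, bit i = b.
  by have [i [_ [<- _]]] := F_pick (fun=> false) b; exists i.
by have [enc encP] := choice h; exists enc.
Qed.

(** [F_pick] always returns a coded state whatever label is demanded, so any label sequence drives
    an orbit forward. Negative times hold junk values, whose effect averaging over translates
    removes. *)
Lemma driven_orbit : exists orb : (nat -> bool) -> symbolic k, forall beta,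
  (forall n : nat, linked n%:Z (orb beta)) /\
  forall n : nat, bit (symbol (orb beta) n%:Z) = beta n.
Proof.
have [enc encP] := bit_section.
have : forall fb : (nat -> bool) * bool, exists ig : 'I_k.+1 * (nat -> bool),
    bit ig.1 = fb.2 /\ F ig.1 (code fb.1) = code ig.2.
  by move=> [f b]; have [i [g h]] := F_pick f b; exists (i, g).
move=> /choice[pick pickP].
pose dig beta := fix dig t := match t with
  | 0%N => fun _ : nat => false
  | t.+1 => (pick (dig t, beta t)).2 end.
pose orb beta : symbolic k := fun q => if q.1 is Posz t then
  (if q.2 is j.+1 then enc (dig beta t j) else (pick (dig beta t, beta t)).1)
  else ord0.
exists orb => beta.
have stE t : state (orb beta) t%:Z = code (dig beta t).
  by congr code; apply/funext => j; rewrite /digits/= encP.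
split => t; last by have [] := pickP (dig beta t, beta t).
rewrite /linked /=.
have -> : (t%:Z + 1) = t.+1%:Z by rewrite -addn1 PoszD.
by rewrite !stE /=; have [_] := pickP (dig beta t, beta t).
Qed.

End CodedDynamics.

Definition extend (M : nat) (u : {ffun 'I_M -> bool}) (t : nat) : bool :=
  if insub t is Some j then u j else false.

Lemma extendE M (u : {ffun 'I_M -> bool}) (t : 'I_M) : extend u t = u t.
Proof. by rewrite /extend insubT//= => h; congr (u _); exact: val_inj. Qed.

(** The sum over words factors over positions: each position of the window contributes 1/2 and every
    other one contributes 1. *)
Lemma window_frequency (R : realFieldType) (M n i : nat) (w : nat -> bool) :
  (i + n <= M)%N ->
  (2^-1) ^+ M * \sum_(u : {ffun 'I_M -> bool})
    `[< forall j, (j < n)%N -> extend u (i + j) = w j >]%:R = (2^-1) ^+ n :> R.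
Proof.
move=> inM.
pose inside t := (i <= t < i + n)%N.
pose g (t : 'I_M) (b : bool) : R :=
  2^-1 * (if inside t then (b == w (t - i)%N)%:R else 1).
transitivity (\sum_(u : {ffun 'I_M -> bool}) \prod_t g t (u t)).
  rewrite mulr_sumr; apply: eq_bigr => u _.
  rewrite big_split/= prodr_const card_ord; congr (_ * _).
  have [h|h] := pselect (forall j, (j < n)%N -> extend u (i + j) = w j).
    rewrite asboolT// big1// => t _; case: ifP => // /andP[it tn].
    rewrite -extendE -{1}(subnKC it) h ?eqxx//.
    by rewrite ltn_subLR.
  rewrite asboolF//.
  have [j jn jw] : exists2 j, (j < n)%N & extend u (i + j) <> w j.
    by apply: contrapT => h'; apply: h => j jn; apply: contrapT => jw; apply: h'; exists j.
  have ijM : (i + j < M)%N by lia.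
  rewrite (bigD1 (Ordinal ijM))//= /inside leq_addr ltn_add2l jn/=.
  by rewrite -extendE/= addKn; case: eqP => //; rewrite mul0r.
rewrite -(bigA_distr_bigA g).
have -> : \prod_t \sum_b g t b = \prod_(t < M) (if inside t then 2^-1 else 1).
  apply: eq_bigr => t _; rewrite big_bool /g; case: ifP => _; last first.
    by rewrite /= mulr1; lra.
  by case: (w _); rewrite /= ?mulr1 ?mulr0 ?addr0 ?add0r.
rewrite -(big_mkord xpredT (fun t => if inside t then 2^-1 else 1)).
rewrite (@big_cat_nat _ _ _ i)//=; last by lia.
rewrite (@big_cat_nat _ _ _ (i + n)%N _ M)//=; last by lia.
rewrite big_nat big1 ?mul1r; last first.
  by move=> t /andP[_ ti]; rewrite /inside leqNgt ti.
rewrite [X in _ * X]big_nat [X in _ * X]big1 ?mulr1; last first.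
  by move=> t /andP[int _]; rewrite /inside [(t < _)%N]ltnNge int andbF.
rewrite big_nat (eq_bigr (fun=> 2^-1)); last by move=> t; rewrite /inside => ->.
by rewrite -big_nat prodr_const_nat addKn.
Qed.

(** * Krylov-Bogoliubov averages of driven orbits *)

Section SymbolicErgodic.
Context (R : realType) (k : nat) (St : topologicalType).
Context (St_hausdorff : hausdorff_space St).
Context (code : {ptws nat -> bool} -> St) (code_cts : continuous code).
Context (bit : 'I_k.+1 -> bool) (F : 'I_k.+1 -> St -> St).
Context (F_cts : forall i f, {for code f, continuous (F i)}).
Context (F_pick : forall f b, exists i g, bit i = b /\ F i (code f) = code g).

Local Notation linked := (linked code bit F).
Local Notation words := (words bit).

Section Average.
Context (orb : (nat -> bool) -> symbolic k).

(* The law of the i-th translate of the orbit driven by N + N fair bits. *)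
Definition slice (N i : nat) (C : set (symbolic k)) : R :=
  (2^-1) ^+ (N + N) * \sum_(u : {ffun 'I_(N + N) -> bool})
    `[< C (iter i (@translate k) (orb (extend u))) >]%:R.

(** With N + N bits and shifts up to N, a window of length at most N never leaves the bits drawn at
    random. *)
Definition average (N : nat) (C : set (symbolic k)) : R :=
  N.+1%:R^-1 * \sum_(i < N.+1) slice N i C.

Lemma slice_ge0 N i C : 0 <= slice N i C.
Proof. by rewrite mulr_ge0 ?exprn_ge0// sumr_ge0. Qed.

Lemma sliceT N i : slice N i setT = 1.
Proof.
rewrite /slice (eq_bigr (fun=> 1)); last by move=> u _; rewrite asboolT.
rewrite sumr_const card_ffun card_bool card_ord natrX -exprMn mulVf ?expr1n//.
Qed.

Lemma slice_le1 N i C : slice N i C <= 1.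
Proof.
rewrite -(sliceT N i) ler_wpM2l ?exprn_ge0//; apply: ler_sum => u _.
by rewrite [X in _ <= (nat_of_bool X)%:R]asboolT// lern1 leq_b1.
Qed.

Lemma sliceU N i C D : C `&` D = set0 -> slice N i (C `|` D) = slice N i C + slice N i D.
Proof.
move=> CD; rewrite -mulrDr -big_split/=; congr (_ * _); apply: eq_bigr => u _.
set y := iter _ _ _.
have [Cy|Cy] := pselect (C y); have [Dy|Dy] := pselect (D y).
- by exfalso; have := conj Cy Dy; rewrite -[_ /\ _]/((C `&` D) y) CD.
- by rewrite (asboolT Cy) (asboolF Dy) asboolT ?addr0//; left.
- by rewrite (asboolF Cy) (asboolT Dy) asboolT ?add0r//; right.
- by rewrite (asboolF Cy) (asboolF Dy) asboolF ?addr0// => -[].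
Qed.

Lemma average_ge0 N C : 0 <= average N C.
Proof. by rewrite mulr_ge0// sumr_ge0// => i _; exact: slice_ge0. Qed.

Lemma averageT N : average N setT = 1.
Proof.
rewrite /average (eq_bigr (fun=> 1)); last by move=> i _; rewrite sliceT.
by rewrite sumr_const card_ord mulVf.
Qed.

Lemma average_le1 N C : average N C <= 1.
Proof.
rewrite -(averageT N) ler_wpM2l//; apply: ler_sum => i _.
by rewrite sliceT slice_le1.
Qed.

Lemma averageU N C D : C `&` D = set0 -> average N (C `|` D) = average N C + average N D.
Proof.
move=> CD; rewrite -mulrDr -big_split/=; congr (_ * _).
by apply: eq_bigr => i _; rewrite sliceU.
Qed.

(** The difference telescopes to two slices, both in [0, 1]. *)
Lemma average_translate N C :
  `|average N (@translate k @^-1` C) - average N C| <= N.+1%:R^-1.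
Proof.
rewrite -mulrBr -sumrB normrM ger0_norm// ler_piMr//.
have -> : \sum_(i < N.+1) (slice N i (@translate k @^-1` C) - slice N i C) =
    slice N N.+1 C - slice N 0 C.
  rewrite -(big_mkord xpredT (fun i => slice N i (@translate k @^-1` C) - slice N i C)).
  exact: telescope_sumr.
have := slice_ge0 N N.+1 C; have := slice_ge0 N 0 C.
have := slice_le1 N N.+1 C; have := slice_le1 N 0 C.
by rewrite ler_norml => *; apply/andP; split; lra.
Qed.

Context (orb_linked : forall beta (n : nat), linked n%:Z (orb beta)).
Context (orb_bit : forall beta (n : nat), bit (symbol (orb beta) n%:Z) = beta n).

(** From the [|n|]-th translate on, time n falls at a nonnegative time of the driven orbit, where
    the link holds; only the first [|n|] slices can charge C. *)
Lemma average_unlinked N n C : C `&` linked n = set0 ->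
  average N C <= `|n|%:R * N.+1%:R^-1.
Proof.
move=> Cn; rewrite /average mulrC ler_pM2r ?invr_gt0//.
have a0 i : (`|n| <= i)%N -> slice N i C = 0.
  move=> ni; rewrite /slice big1 ?mulr0// => u _; rewrite asboolF// => Cy.
  have : (C `&` linked n) (iter i (@translate k) (orb (extend u))).
    split => //; apply/iter_linked.
    have -> : n + i%:Z = (absz (n + i%:Z))%:Z by lia.
    exact: orb_linked.
  by rewrite Cn.
apply: (@le_trans _ _ (\sum_(i < N.+1 | (i < `|n|)%N) 1)).
  rewrite [leRHS]big_mkcond/=; apply: ler_sum => i _; case: ltnP => h.
    exact: slice_le1.
  by rewrite a0.
have -> : \sum_(i < N.+1 | (i < `|n|)%N) 1 = (minn N.+1 `|n|)%:R :> R.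
  elim: N.+1 => [|K IH]; first by rewrite big_ord0 min0n.
  rewrite big_mkcond big_ord_recr/= -big_mkcond/= IH.
  case: ltnP => h; rewrite ?addr0; last by congr (_%:R); lia.
  by rewrite natr1; congr (_%:R); lia.
by rewrite ler_nat geq_minr.
Qed.

Lemma average_words N n w : (n <= N)%N -> average N (words n w) = (2^-1) ^+ n.
Proof.
move=> nN; rewrite /average (eq_bigr (fun=> (2^-1) ^+ n)).
  by rewrite sumr_const card_ord -(mulr_natl (_ ^+ n)) mulrA mulVf ?mul1r.
move=> i _; rewrite -(@window_frequency R (N + N) n i w); last first.
  by have := ltn_ord i; lia.
congr (_ * _); apply: eq_bigr => u _; congr ((nat_of_bool _)%:R).
apply/asbool_equiv_eq; split => h j jn.
  by rewrite -(h j jn) /symbol iter_translate/= -PoszD addnC orb_bit.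
by rewrite /symbol iter_translate/= -PoszD addnC -[RHS]h// -orb_bit.
Qed.

End Average.

(** The set [linked n] is closed but need not be clopen, so m cannot be evaluated on it. Being
    carried by it is expressed by vanishing on the clopen sets that avoid it. *)
Lemma fair_mean : exists m : clopen_mean R (symbolic k),
  [/\ invariant_mean (@translate k) m,
      forall n C, clopen C -> C `&` linked n = set0 -> m C = 0 &
      forall n w, m (words n w) = (2^-1) ^+ n].
Proof.
have [orb orbP] := driven_orbit F_pick.
have ol beta n : linked n%:Z (orb beta) by have [] := orbP beta.
have ob beta n : bit (symbol (orb beta) n%:Z) = beta n by have [] := orbP beta.
have [U [UU sU ucvg]] := @ultralimit_exists R.
have UP : ProperFilter U by exact: ultra_proper.
have harm : (fun N : nat => N.+1%:R^-1) @ U --> (0 : R).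
  by apply: cvg_trans (@cvg_harmonic R); exact: cvg_app.
have [||||m mE] := @mean_limit_exists R (symbolic k) U UP ucvg (average orb).
- by move=> N C; exact: average_ge0.
- by move=> N C _; exact: average_le1.
- by move=> N C D _ _; exact: averageU.
- by move=> N; exact: averageT.
exists m; split.
- move=> C cC; apply/eqP; rewrite -subr_eq0 -normr_le0.
  have cC' : clopen (@translate k @^-1` C).
    by apply: preimage_clopen => //; exact: translate_cts.
  have h : `|average orb N (@translate k @^-1` C) - average orb N C| @[N --> U]
      --> `|m (@translate k @^-1` C) - m C|.
    by apply: cvg_norm; apply: cvgB; exact: mE.
  apply: (ler_cvg_to h harm); apply: nearW => N; exact: average_translate.
- move=> n C cC Cn; apply/eqP; rewrite eq_le mean_ge0 andbT.
  have h : (fun N => `|n|%:R * N.+1%:R^-1) @ U --> `|n|%:R * (0 : R).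
    by apply: cvgM => //; exact: cvg_cst.
  rewrite mulr0 in h.
  apply: (ler_cvg_to (mE _ cC) h); apply: nearW => N; exact: average_unlinked.
- move=> n w; have cw := words_clopen bit n w.
  (* The averages are exactly 2^-n as soon as N reaches n. *)
  have h : average orb N (words n w) @[N --> U] --> (2^-1 : R) ^+ n.
    apply: cvg_near_cst; apply: sU; exists n => // N /= nN.
    exact: average_words.
  by apply: cvg_unique (mE _ cw) h.
Qed.

End SymbolicErgodic.

Lemma measure0_bigcup d (T : measurableType d) (R : realType)
    (mu : {measure set T -> \bar R}) (I : countType) (P : set I) (F : I -> set T) :
  (forall i, P i -> measurable (F i)) -> (forall i, P i -> mu (F i) = 0%E) ->
  mu (\bigcup_(i in P) F i) = 0%E.
Proof.
move=> mF F0.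
pose G n := if unpickle n is Some i then (if `[< P i >] then F i else set0) else set0.
have -> : \bigcup_(i in P) F i = \bigcup_n G n.
  apply/seteqP; split => x.
    by move=> [i Pi Fix]; exists (pickle i) => //; rewrite /G pickleK asboolT.
  move=> [n _]; rewrite /G; case: (unpickle n) => [i|//].
  by case: asboolP => // Pi Fix; exists i.
have mG n : measurable (G n).
  by rewrite /G; case: (unpickle n) => [i|//]; case: asboolP => // /mF.
apply/negligibleP; first exact: bigcupT_measurable.
apply: negligible_bigcup => n; apply/negligibleP => //.
by rewrite /G; case: (unpickle n) => [i|//]; case: asboolP => // /F0.
Qed.

Section SymbolicErgodic.
Context (R : realType) (k : nat) (St : topologicalType).
Context (St_hausdorff : hausdorff_space St).
Context (code : {ptws nat -> bool} -> St) (code_cts : continuous code).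
Context (bit : 'I_k.+1 -> bool) (F : 'I_k.+1 -> St -> St).
Context (F_cts : forall i f, {for code f, continuous (F i)}).
Context (F_pick : forall f b, exists i g, bit i = b /\ F i (code f) = code g).

Local Notation linked := (linked code bit F).
Local Notation orbits := (orbits code bit F).
Local Notation words := (words bit).

Definition letters (n : nat) (y : symbolic k) : {ffun 'I_n -> bool} :=
  [ffun i : 'I_n => bit (symbol y i%:Z)].

Lemma letters_words n (v : {ffun 'I_n -> bool}) :
  @letters n @^-1` [set v] = words n (extend v).
Proof.
apply/seteqP; split => y /=.
  by move=> <- i ni; rewrite -[i]/(val (Ordinal ni)) extendE ffunE.
by move=> h; apply/ffunP => i; rewrite ffunE h ?extendE.
Qed.

Lemma words_letters n w :
  words n w = @letters n @^-1` [set [ffun i : 'I_n => w i]].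
Proof.
apply/seteqP; split => y /=.
  by move=> h; apply/ffunP => i; rewrite !ffunE h.
by move=> /ffunP h i ni; have := h (Ordinal ni); rewrite !ffunE.
Qed.

(** The law of large numbers is applied to blocks of n labels under the n-th iterate of the
    translation: m is uniform on words of N blocks, so m' is at most c times uniform, and a single
    block is then uniform for m'. *)
Lemma words_rigid (m m' : clopen_mean R (symbolic k)) c :
  invariant_mean (@translate k) m' ->
  (forall n w, m (words n w) = (2^-1) ^+ n) ->
  (forall C, clopen C -> m' C <= c * m C) ->
  forall n w, m' (words n w) = (2^-1) ^+ n.
Proof.
move=> im' mw cm n w; rewrite words_letters.
pose S := iter n (@translate k).
have S_cts : continuous S by apply: iter_cts; exact: translate_cts.
have l_clopen v : clopen (@letters n @^-1` [set v]).
  by rewrite letters_words; exact: words_clopen.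
have im'S C : clopen C -> m' (S @^-1` C) = m' C.
  by apply: mean_iter => //; exact: translate_cts.
have card2 : #|{ffun 'I_n -> bool}|%:R^-1 = (2^-1) ^+ n :> R.
  by rewrite card_ffun card_bool card_ord natrX exprVn.
rewrite -card2; apply: (equidistribution l_clopen S_cts im'S (c := c)) => N v.
(* The concatenation of the blocks of v: position t is entry [t %% n] of block [t %/ n]. *)
pose w' (t : nat) := if insub (t %/ n)%N is Some j then extend (v j) (t %% n)%N else false.
have -> : @word _ _ (@letters n) S N @^-1` [set v] = words (N * n)%N w'.
  have itS j y : iter j S y = iter (j * n) (@translate k) y.
    by rewrite iterM.
  apply/seteqP; split => y /=.
    move=> yv t tN.
    have n0 : (0 < n)%N by case: (n) tN; rewrite ?muln0.
    have tj : (t %/ n < N)%N by rewrite ltn_divLR.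
    have tn : (t %% n < n)%N by rewrite ltn_mod.
    rewrite /w' insubT/= -[X in extend _ X]/(val (Ordinal tn)) extendE -yv !ffunE/=.
    by rewrite itS /symbol iter_translate/= -PoszD addnC -divn_eq.
  move=> h; apply/ffunP => j; apply/ffunP => i; rewrite !ffunE itS.
  have tN : (j * n + i < N * n)%N.
    have := ltn_ord i; have := ltn_ord j => jN ni.
    apply: (@leq_trans (j.+1 * n)); first by rewrite mulSnr ltn_add2l.
    by rewrite leq_mul2r jN orbT.
  have n0 : (0 < n)%N by apply: leq_ltn_trans (ltn_ord i).
  have <- : w' (j * n + i)%N = v j i.
    rewrite /w' divnMDl// divn_small// addn0 modnMDl modn_small// valK.
    exact: extendE.
  by rewrite -(h _ tN) /symbol iter_translate/= -PoszD addnC.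
apply: (le_trans (cm _ (words_clopen _ _ _))).
by rewrite mw card2 -exprM mulnC.
Qed.

Theorem symbolic_ergodic : exists mu : probability (Borel (symbolic k)) R,
  [/\ ergodic_measure (@translate k) mu,
      mu (~` orbits) = 0%E &
      forall n w, mu (words n w) = ((2^-1) ^+ n)%:E].
Proof.
(* Both demands, to be carried by [orbits] and to have fair labels, become prescribed values on
   clopen sets, as [ergodic_extremal] requires. *)
pose J := ({C : set (symbolic k) | clopen C /\ exists n, C `&` linked n = set0} +
  (nat * (nat -> bool)))%type.
pose E (j : J) := match j with inl C => sval C | inr nw => words nw.1 nw.2 end.
pose p (j : J) : R := match j with inl _ => 0 | inr nw => (2^-1) ^+ nw.1 end.
have E_clopen j : clopen (E j).
  by case: j => [[C []]|[n w]] //=; exact: words_clopen.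
have pE m : prescribed E p m <->
    (forall n C, clopen C -> C `&` linked n = set0 -> m C = 0) /\
    forall n w, m (words n w) = (2^-1) ^+ n.
  split=> [h|[h h'] [[C [cC [n Cn]]]|[n w]]/=].
  - split=> [n C cC Cn|n w]; last exact: (h (inr (n, w))).
    exact: (h (inl (exist _ C (conj cC (ex_intro _ n Cn))))).
  - exact: (h n).
  - exact: h'.
have [|m m' c im /pE[mC mw] im' m'm|mu [emu muE]] :=
  @ergodic_extremal R _ _ _ (@symbolic_compact k)
    (@cylinder_clopen k) (@cylinder_base k)
    (@translate k) (@translate_cts k) J E p E_clopen.
- have [m [im mC mw]] := fair_mean R F_pick.
  by exists m; split => //; apply/pE.
- apply/pE; split.
    move=> n C cC Cn; apply/eqP; rewrite eq_le mean_ge0 andbT.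
    by rewrite (le_trans (m'm C cC))// (mC n)// mulr0.
  exact: words_rigid m'm.
exists mu; split => // [|n w]; last exact: (muE (inr (n, w))).
have mlink n : measurable (~` linked n : set (Borel (symbolic k))).
  by apply: sub_sigma_algebra; apply: closed_openC; exact: linked_closed.
have mlink0 n : mu (~` linked n) = 0%E.
  (* This open set is a countable union of cylinders avoiding [linked n], and each of them has
     prescribed mass 0. *)
  have oL : open (~` linked n) by apply: closed_openC; exact: linked_closed.
  rewrite (open_bigcup_base (@cylinder_base k) oL).
  apply: measure0_bigcup => s /= sL.
    by apply: sub_sigma_algebra; have [] := cylinder_clopen s.
  have sL0 : cylinder s `&` linked n = set0.
    by apply/seteqP; split => // y [/sL].
  exact: (muE (inl (exist _ (cylinder s)
    (conj (cylinder_clopen s) (ex_intro _ n sL0))))).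
rewrite orbitsE setC_bigcap.
by apply: (@measure0_bigcup _ _ _ mu int) => n _; [exact: mlink|exact: mlink0].
Qed.

End SymbolicErgodic.

(** * Realization of the symbolic orbits *)

Lemma limn_esup_ge (R : realType) (u : nat -> \bar R) (c : \bar R) :
  (\forall n \near \oo, (c <= u n)%E) -> (c <= limn_esup u)%E.
Proof.
move=> cu; apply: le_ereal_inf_tmp => _ [A [N' _ NA] <-].
have [n [cn An]] : exists n, (c <= u n)%E /\ A n.
  have : \forall n \near \oo, (c <= u n)%E /\ A n.
    by apply: filterS2 cu (ex_intro2 _ _ N' I NA) => n.
  by move=> /filter_ex.
by apply: le_trans cn _; apply: ereal_sup_ubound; exists n.
Qed.

Lemma pair_cts (Z X Y : topologicalType) (f : Z -> X) (h : Z -> Y) (z : Z) :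
  {for z, continuous f} -> {for z, continuous h} ->
  {for z, continuous (fun z => (f z, h z))}.
Proof. by move=> cf ch; exact: (cvg_pair cf ch). Qed.

Section Realization.
Context (R : realType) (k : nat) (St : topologicalType) (M : ptopologicalType).
Context (St_hausdorff : hausdorff_space St).
Context (code : {ptws nat -> bool} -> St) (code_cts : continuous code).
Context (bit : 'I_k.+1 -> bool) (F : 'I_k.+1 -> St -> St).
Context (F_cts : forall i f, {for code f, continuous (F i)}).
Context (F_pick : forall f b, exists i g, bit i = b /\ F i (code f) = code g).
Context (P : St -> M) (P_cts : continuous (P \o code)).
Context (g : 'I_k.+1 -> M -> M) (g_cts : forall i, continuous (g i)).
Context (Pg : forall i f, P (F i (code f)) = g i (P (code f))).

Local Notation orbits := (orbits code bit F).
Local Notation words := (words bit).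
Local Notation X := (full_shift k * M)%type.

Definition skew_map (z : X) : X := (Defs.shift z.1 : full_shift k, g (z.1 (0 : int)) z.2).

Definition realize (y : symbolic k) : X := (symbol y : full_shift k, P (state code bit y 0)).

Lemma full_shift_eval n : continuous (fun w : full_shift k => w n : discrete_topology 'I_k.+1).
Proof. exact: ptws_eval. Qed.

Lemma realize_cts : continuous realize.
Proof.
have c1 : continuous (@symbol k : symbolic k -> full_shift k).
  apply: (@ptws_cts (symbolic k : topologicalType) int (discrete_topology 'I_k.+1)
    (@symbol k)) => n.
  exact: (@symbolic_eval k (n, 0%N)).
have c2 : continuous (fun y : symbolic k => P (state code bit y 0)).
  move=> y; apply: (@continuous_comp _ _ _ (digits bit ^~ 0) (P \o code) y).
    exact: (@digits_cts k bit 0 y).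
  exact: P_cts.
move=> y; exact: (pair_cts (@c1 y) (@c2 y)).
Qed.

Lemma skew_cts : continuous skew_map.
Proof.
move=> [w x].
have c1 : continuous (@Defs.shift k).
  apply: (@ptws_cts (full_shift k : topologicalType) int (discrete_topology 'I_k.+1)
    (@Defs.shift k)) => n.
  exact: (@full_shift_eval (n + 1)).
apply: (@pair_cts X (full_shift k) M (fun z => Defs.shift z.1) (fun z => g (z.1 (0 : int)) z.2) (w, x)).
  apply: (@continuous_comp _ _ _ (@fst (full_shift k) M) (@Defs.shift k) (w, x)).
    exact: cvg_fst.
  exact: c1.
move=> U Ux.
have h1 : nbhs ((w, x) : X) ((fun z : X => g (w 0) z.2) @^-1` U).
  apply: (@continuous_comp _ _ _ (@snd (full_shift k) M) (g (w 0)) (w, x)) Ux.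
    exact: cvg_snd.
  exact: g_cts.
have h2 : nbhs ((w, x) : X) [set z | z.1 0 = w 0].
  apply: (@cvg_fst _ _ (nbhs (w : full_shift k)) (nbhs x) _ [set w' | w' 0 = w 0]).
  apply: (@full_shift_eval 0 w [set w 0]).
  exact: (@discrete_set1 (discrete_topology 'I_k.+1) (w 0)).
change (nbhs ((w, x) : X) [set z | U (g (z.1 0) z.2)]).
apply: (@filterS _ (nbhs ((w, x) : X)) (nbhs_filter _) _ _ _ (filterI h1 h2)).
by move=> z /= [Uz ->].
Qed.

Lemma realize_translate y : orbits y -> realize (translate y) = skew_map (realize y).
Proof.
move=> oy; rewrite /realize /skew_map /=; congr (_, _).
have -> : state code bit (translate y) 0 = state code bit y (0 + 1) by [].
by rewrite (oy 0) Pg.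
Qed.

Lemma iter_skew_symbol i (z : X) : (iter i skew_map z).1 0 = z.1 i%:Z.
Proof.
have h n : (iter i skew_map z).1 n = z.1 (n + i%:Z).
  elim: i n => [|i IH] n /=; first by rewrite addr0.
  by rewrite /Defs.shift IH -addrA intS.
by rewrite h add0r.
Qed.

Lemma translate_preimage_orbits : @translate k @^-1` orbits = orbits.
Proof.
apply/seteqP; split => y /= h; last exact: translate_orbits.
by move=> n; have /(iter_linked code bit F 1 (n - 1) y) := h (n - 1); rewrite subrK.
Qed.

Definition realized : set X := realize @` orbits.

Lemma realized_compact : compact realized.
Proof.
apply: continuous_compact; last exact: orbits_compact.
by apply: continuous_subspaceT; exact: realize_cts.
Qed.

(** Equality, not mere inclusion, comes from the orbits being two-sided: each is the translate of
    another. *)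
Lemma realized_invariant : skew_map @` realized = realized.
Proof.
apply/seteqP; split => z.
  move=> [_ [y oy <-] <-]; exists (translate y); first exact: translate_orbits.
  exact: realize_translate.
move=> [y /orbits_translate[y' oy' <-] <-].
by exists (realize y'); [exists y'|rewrite realize_translate].
Qed.

End Realization.

Lemma hausdorff_prod2 (X Y : topologicalType) :
  hausdorff_space X -> hausdorff_space Y -> hausdorff_space (X * Y)%type.
Proof.
move=> hX hY [x y] [x' y'] h; congr (_, _).
  apply: hX => A B Ax Bx'.
  have [] := h (A `*` setT) (B `*` setT).
  - by exists (A, setT) => //=; split => //; exact: filterT.
  - by exists (B, setT) => //=; split => //; exact: filterT.
  by move=> [a b] [[/= Aa _] [/= Ba _]]; exists a.
apply: hY => A B Ay By'.
have [] := h (setT `*` A) (setT `*` B).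
- by exists (setT, A) => //=; split => //; exact: filterT.
- by exists (setT, B) => //=; split => //; exact: filterT.
by move=> [a b] [[/= _ Ab] [/= _ Bb]]; exists b.
Qed.

(** * Entropy and ergodicity of the realized system *)

Section Realization.
Context (R : realType) (k : nat) (St : topologicalType) (M : ptopologicalType).
Context (St_hausdorff : hausdorff_space St).
Context (code : {ptws nat -> bool} -> St) (code_cts : continuous code).
Context (bit : 'I_k.+1 -> bool) (F : 'I_k.+1 -> St -> St).
Context (F_cts : forall i f, {for code f, continuous (F i)}).
Context (F_pick : forall f b, exists i g, bit i = b /\ F i (code f) = code g).
Context (P : St -> M) (P_cts : continuous (P \o code)).
Context (g : 'I_k.+1 -> M -> M) (g_cts : forall i, continuous (g i)).
Context (Pg : forall i f, P (F i (code f)) = g i (P (code f))).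

Local Notation orbits := (orbits code bit F).
Local Notation words := (words bit).
Local Notation X := (full_shift k * M)%type.
Local Notation skew_map := (skew_map g).
Local Notation realize := (realize code bit P).
Local Notation realized := (realized code bit F P).

Lemma ln2_gt0 : 0 < ln (2 : R).
Proof. by rewrite ln_gt0// ltr1n. Qed.

Section TopologicalEntropy.
Context (all_words : forall n w, exists2 y, orbits y & words n w y).

Definition bit_set (b : bool) : set X := [set z | bit (z.1 (0 : int)) = b].

Lemma bit_set_clopen b : clopen (bit_set b).
Proof.
apply: (@preimage_clopen X (discrete_topology 'I_k.+1) (fun z => z.1 (0 : int))
  [set a | bit a = b]).
  by split; [exact: discrete_open|exact: discrete_closed].
move=> z; apply: (@continuous_comp _ _ _ (@fst (full_shift k) M)
  (fun w : full_shift k => w (0 : int) : discrete_topology 'I_k.+1) z).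
  exact: cvg_fst.
exact: full_shift_eval.
Qed.

Let U : set (set X) := range bit_set.

Lemma bit_cover : open_cover realized U.
Proof.
split; first by move=> _ [b _ <-]; have [] := bit_set_clopen b.
by move=> z _; exists (bit_set (bit (z.1 (0 : int)))) => //; exists (bit (z.1 (0 : int))).
Qed.

(** A cell of the join fixes the n labels of its points, and every label word is realized by some
    orbit, so distinct words need distinct cells. *)
Lemma join_card_ge n : 2 ^+ n <= @join_card R X skew_map realized U n.
Proof.
pose T := {ffun 'I_n -> bool}.
have cT : #|T| = (2 ^ n)%N by rewrite card_ffun card_bool card_ord.
apply: lb_le_inf.
  (* The set of cardinals must be nonempty, since otherwise [inf] would be a default value. *)
  exists #|T|%:R; exists #|T| => //.
  exists (fun j i => bit_set (extend (enum_val j : T) i)); split.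
    by move=> j i; exists (extend (enum_val j : T) i).
  move=> z _; pose v : T := [ffun i : 'I_n => bit (z.1 i%:Z)].
  exists (enum_rank v) => // i ni /=.
  by rewrite enum_rankK /bit_set/= iter_skew_symbol -[i in extend _ i]/(val (Ordinal ni)) extendE ffunE.
move=> _ [m [a [aU cov]] <-].
have h (v : T) : exists j, exists2 y, words n (extend v) y & join_cell skew_map n (a j) (realize y).
  have [y oy wy] := all_words n (extend v).
  have [j _ ja] : (\bigcup_(j in [set: 'I_m]) join_cell skew_map n (a j)) (realize y).
    by apply: cov; exists y.
  by exists j, y.
have [f fP] := choice h.
have f_inj : injective f.
  move=> v v' vv'; apply/ffunP => i.
  have [y wy jy] := fP v; have [y' wy' jy'] := fP v'.
  have bitE (y0 : symbolic k) b : a (f v) i = bit_set b ->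
      a (f v) i (iter i skew_map (realize y0)) -> bit (symbol y0 i%:Z) = b.
    by move=> -> ; rewrite /bit_set/= iter_skew_symbol.
  have [b _ ab] := aU (f v) i.
  rewrite -extendE -(wy i (ltn_ord i)) (bitE y b (esym ab) (jy i (ltn_ord i))).
  rewrite -vv' in jy'.
  by rewrite -(bitE y' b (esym ab) (jy' i (ltn_ord i))) (wy' i (ltn_ord i)) extendE.
by rewrite -natrX ler_nat -cT -[m]card_ord; exact: leq_card f_inj.
Qed.

Lemma realized_entropy : (0 < @top_entropy R X skew_map realized)%E.
Proof.
apply: (@lt_le_trans _ _ (ln (2 : R))%:E); first by rewrite lte_fin ln2_gt0.
apply: (@le_trans _ _ (@cover_entropy R X skew_map realized U)); last first.
  by apply: ereal_sup_ubound; exists U => //; exact: bit_cover.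
apply: limn_esup_ge; exists 1%N => // n /= n0.
rewrite lee_fin ler_pdivlMr ?ltr0n//.
rewrite mulr_natr -lnXn// ler_ln ?posrE ?exprn_gt0//; first exact: join_card_ge.
by apply: lt_le_trans (join_card_ge n); rewrite exprn_gt0.
Qed.

End TopologicalEntropy.

Section MetricEntropy.
Context (mu : probability (Borel (symbolic k)) R).
Context (mu_ergodic : ergodic_measure (@translate k) mu).
Context (mu_orbits : mu (~` orbits) = 0%E).
Context (mu_words : forall n w, mu (words n w) = ((2^-1) ^+ n)%:E).

Lemma orbits_measurable : measurable (orbits : set (Borel (symbolic k))).
Proof.
rewrite -[X in measurable X]setCK; apply: measurableC.
apply: sub_sigma_algebra; apply: closed_openC.
by rewrite orbitsE; apply: closed_bigI => n _; exact: linked_closed.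
Qed.

Lemma mu_setI_orbits (A : set (Borel (symbolic k))) : measurable A ->
  mu (A `&` orbits) = mu A.
Proof.
move=> mA; have mO := orbits_measurable.
rewrite [RHS](@measureDI _ _ _ mu A orbits)//.
rewrite [X in (X + _)%E](_ : _ = 0%E) ?add0e//.
have mAO : measurable (A `\` orbits) by exact: measurableD.
have mOc : measurable (~` orbits : set (Borel (symbolic k))) by exact: measurableC.
by apply/eqP; rewrite -measure_le0 -mu_orbits le_measure ?inE// => y [].
Qed.

(** A set of positive measure meets the orbits, which have full measure; this supplies the words
    that the topological entropy counts. *)
Lemma all_words n w : exists2 y, orbits y & words n w y.
Proof.
apply: contrapT => h.
have : (mu (words n w) <= 0)%E.
  have mw : measurable (words n w : set (Borel (symbolic k))).
    by apply: sub_sigma_algebra; have [] := words_clopen bit n w.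
  have mOc : measurable (~` orbits : set (Borel (symbolic k))).
    by apply: measurableC; exact: orbits_measurable.
  by rewrite -mu_orbits le_measure ?inE// => y wy oy; apply: h; exists y.
by rewrite mu_words lee_fin leNgt exprn_gt0.
Qed.

Lemma realize_measurable : measurable_fun setT (realize : Borel (symbolic k) -> Borel X).
Proof. by apply: continuous_Borel_measurable; exact: realize_cts. Qed.

Lemma mu_total : mu setT = 1%E. Proof. exact: probability_setT. Qed.

Definition realized_measure : probability (Borel X) R :=
  image_probability realize_measurable mu_total.

Lemma realized_measureE A : realized_measure A = mu (realize @^-1` A).
Proof. by []. Qed.

Lemma realize_preimage_measurable (A : set (Borel X)) : measurable A ->
  measurable (realize @^-1` A : set (Borel (symbolic k))).
Proof. by move=> mA; rewrite -[X in measurable X]setTI; exact: realize_measurable. Qed.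

Lemma skew_preimage_measurable (A : set (Borel X)) : measurable A ->
  measurable (skew_map @^-1` A : set (Borel X)).
Proof.
move=> mA; rewrite -[X in measurable X]setTI.
by apply: continuous_Borel_measurable => //; exact: skew_cts.
Qed.

(** The semiconjugacy holds on [orbits] only. Intersecting with this invariant set of full measure
    makes preimages of invariant sets invariant in the strict sense of [ergodic_measure]. *)
Lemma realize_skew (A : set X) :
  realize @^-1` (skew_map @^-1` A) `&` orbits =
  @translate k @^-1` (realize @^-1` A) `&` orbits.
Proof.
apply/seteqP; split => y /= [Ay oy]; split => //.
  by rewrite (realize_translate Pg oy).
by rewrite -(realize_translate Pg oy).
Qed.

Lemma realized_measure_ergodic : ergodic_measure skew_map realized_measure.
Proof.
have [imu emu] := mu_ergodic.
have mtau (A : set (Borel (symbolic k))) : measurable A ->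
    measurable (@translate k @^-1` A : set (Borel (symbolic k))).
  move=> mA; rewrite -[X in measurable X]setTI.
  by apply: continuous_Borel_measurable => //; exact: translate_cts.
split => [A mA|A mA sA].
  have mB := realize_preimage_measurable mA.
  rewrite !realized_measureE -mu_setI_orbits ?realize_skew ?mu_setI_orbits//.
  - exact: imu.
  - exact: mtau.
  - by apply: realize_preimage_measurable; exact: skew_preimage_measurable.
have mB := realize_preimage_measurable mA.
rewrite !realized_measureE -mu_setI_orbits//; apply: emu.
  by apply: measurableI => //; exact: orbits_measurable.
by rewrite preimage_setI translate_preimage_orbits -realize_skew sA.
Qed.

Lemma realized_closed : hausdorff_space M -> closed realized.
Proof.
move=> hM; apply: compact_closed.
  apply: hausdorff_prod2 => //.
  by apply: hausdorff_product => _; exact: discrete_hausdorff.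
exact: realized_compact.
Qed.

Lemma realized_measurable : hausdorff_space M ->
  measurable (~` realized : set (Borel X)).
Proof.
move=> hM; apply: sub_sigma_algebra; apply: closed_openC.
exact: realized_closed.
Qed.

Lemma realized_measure_realized : hausdorff_space M ->
  realized_measure (~` realized) = 0%E.
Proof.
move=> hM.
have mOc : measurable (~` orbits : set (Borel (symbolic k))).
  by apply: measurableC; exact: orbits_measurable.
have mR := realize_preimage_measurable (realized_measurable hM).
have -> : realized_measure (~` realized) = mu (realize @^-1` (~` realized)) by [].
apply/eqP; rewrite -measure_le0 -mu_orbits le_measure ?inE//.
by move=> y /= ny oy; apply: ny; exists y.
Qed.

Definition bit_label (z : X) : 'I_2 := inord (bit (z.1 (0 : int))).

(** All 2^n cells of the join have mass 2^-n, so the join entropy is exactly n log 2. *)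
Lemma realized_measure_entropy : (0 < metric_entropy skew_map realized_measure)%E.
Proof.
apply: (@lt_le_trans _ _ (ln (2 : R))%:E); first by rewrite lte_fin ln2_gt0.
apply: (@le_trans _ _ (partition_entropy skew_map realized_measure bit_label)); last first.
  apply: ereal_sup_ubound; exists 2%N, bit_label; split => // j.
  have -> : bit_label @^-1` [set j] = bit_set (j == inord 1).
    apply/seteqP; split => z; rewrite /bit_label /bit_set/=.
      move=> <-; case: (bit _); rewrite ?eqxx//.
      by apply/esym/negbTE; rewrite -val_eqE/= !inordK.
    case: j => -[|[|//]] /= ij.
      have -> : (Ordinal ij == inord 1) = false by rewrite -val_eqE/= inordK.
      by move=> ->; apply/val_inj; rewrite /= inordK.
    have -> : Ordinal ij == inord 1 by rewrite -val_eqE/= inordK.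
    by move=> ->; apply/val_inj; rewrite /= inordK.
  by apply: sub_sigma_algebra; have [] := bit_set_clopen (j == inord 1).
apply: limn_esup_ge; exists 1%N => // n /= n0.
rewrite lee_fin ler_pdivlMr ?ltr0n// mulr_natr.
rewrite /join_entropy /=.
have pw (w : {ffun 'I_n -> 'I_2}) : fine (realized_measure
    [set x | forall i : 'I_n, bit_label (iter i skew_map x) = w i]) = (2^-1) ^+ n.
  pose w' : {ffun 'I_n -> bool} := [ffun i => w i == inord 1].
  have -> : realized_measure [set x | forall i : 'I_n, bit_label (iter i skew_map x) = w i]
      = mu (words n (extend w')).
    rewrite realized_measureE; congr (mu _); apply/seteqP; split => y /= h i.
      move=> ni; have := h (Ordinal ni); rewrite /bit_label iter_skew_symbol /=.
      rewrite -[i in extend _ i]/(val (Ordinal ni)) extendE ffunE => <-.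
      case: (bit _); rewrite ?eqxx//.
      by apply/esym/negbTE; rewrite -val_eqE/= !inordK.
    rewrite /bit_label iter_skew_symbol/= h// extendE ffunE.
    by case: eqP => [->//|]; case: (w i) => -[|[|//]] wi /= ne;
      [apply/val_inj; rewrite /= inordK|case: ne; apply/val_inj; rewrite /= inordK].
  by rewrite mu_words.
under eq_bigr do rewrite pw.
rewrite sumr_const card_ffun !card_ord -(mulr_natl (_ * _)) natrX mulrA -exprMn.
rewrite mulfV// expr1n mul1r exprVn lnV ?posrE ?exprn_gt0// opprK lnXn//.
Qed.

End MetricEntropy.

End Realization.

(** * Second countability *)

(** A point off the support has a null neighbourhood; a countable base reduces the union of these
    neighbourhoods to countably many null sets. *)
Lemma null_off_support (R : realType) (X : ptopologicalType) (I : countType)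
    (b : I -> set X) (mu : probability (Borel X) R) (C : set X) :
  countable_base b -> closed C -> supp mu `<=` C -> mu (~` C) = 0%E.
Proof.
move=> [ob bb] cC suppC.
have -> : ~` C = \bigcup_(i in [set i | mu (b i) = 0%E /\ b i `<=` ~` C]) b i.
  apply/seteqP; split => [x Cx|x [i [_ +]]]; last exact.
  have nsx : ~ supp mu x by move=> /suppC.
  have [U [oU Ux U0]] : exists U : set X, [/\ open U, U x & mu U = 0%E].
    apply: contrapT => h; apply: nsx => U oU Ux; rewrite lt0e measure_ge0 andbT.
    by apply/eqP => U0; apply: h; exists U.
  have nx : nbhs x (U `&` ~` C).
    apply: filterI; first exact: open_nbhs_nbhs.
    by apply: open_nbhs_nbhs; split => //; exact: closed_openC.
  have [i [bix biU]] := bb x _ nx.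
  exists i => //; split; last by move=> y /biU[].
  apply/eqP; rewrite -measure_le0 -U0 le_measure ?inE//.
  - by apply: sub_sigma_algebra; exact: ob.
  - exact: sub_sigma_algebra.
  - by move=> y /biU[].
apply: measure0_bigcup => i [bi0 _] //.
by apply: sub_sigma_algebra; exact: ob.
Qed.

Lemma countable_base_prod (X Y : topologicalType) (I J : countType)
    (b : I -> set X) (c : J -> set Y) :
  countable_base b -> countable_base c ->
  @countable_base (X * Y)%type (I * J)%type (fun ij => b ij.1 `*` c ij.2).
Proof.
move=> [ob bb] [oc cc]; split.
  move=> [i j] /=; rewrite openE => -[x y] [/= bx cy].
  by exists (b i, c j) => //=; split; apply: open_nbhs_nbhs.
move=> [x y] U [[V W] /= [Vx Wy] VW].
have [i [bix biV]] := bb x V Vx; have [j [cjy cjW]] := cc y W Wy.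
exists (i, j); split => // -[a e] [/= /biV Va /cjW We].
exact: VW.
Qed.

Lemma countable_base_rV (R : realType) (d : nat) :
  @countable_base 'rV[R]_d ('rV[rat]_d * nat)%type
    (fun an => ball (map_mx ratr an.1 : 'rV[R]_d) an.2.+1%:R^-1).
Proof.
split; first by move=> [a n] /=; apply: ball_open.
move=> x U /nbhs_ballP[e /= e0 xU].
pose n := Num.truncn (2 / e).
have ne : n.+1%:R^-1 < e / 2 :> R.
  rewrite -[ltRHS]invrK ltf_pV2 ?posrE ?invr_gt0 ?divr_gt0// invf_div.
  exact: truncnS_gt.
have n0 : 0 < n.+1%:R^-1 :> R by rewrite invr_gt0.
have h (j : 'I_d) : exists q : rat, `|x 0 j - ratr q| < n.+1%:R^-1.
  have [|q] := @rat_in_itvoo R (x 0 j - n.+1%:R^-1) (x 0 j + n.+1%:R^-1).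
    by rewrite ltrD2l gtrN.
  by rewrite in_itv/= => xq; exists q; rewrite distrC ltr_distl.
have [q qP] := choice h.
exists (\row_j q j, n) => /=; split.
  split => // i j; rewrite !mxE ord1.
  by rewrite -ball_normE /= distrC; exact: qP.
move=> y [_ qy]; apply: xU; split => // i j.
have := qy i j; rewrite !mxE ord1 -ball_normE/= => qyj.
rewrite -[x 0 j](subrK (ratr (q j))) -addrA.
apply: (le_lt_trans (ler_normD _ _)).
rewrite [ltRHS]splitr ltrD//; first exact: lt_trans (qP j) ne.
exact: lt_trans qyj ne.
Qed.

Lemma countable_base_manifold (R : realType) (d : nat) (M : ptopologicalType)
    (A : smooth_atlas R d M) : compact [set: M] ->
  exists (I : countType) (b : I -> set M), countable_base b.
Proof.
rewrite compact_cover => /(_ M setT (fun x => dom (chart_at A x))) [].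
- by move=> x _; exact: chart_open_dom.
- by move=> x _; exists x => //; exact: chart_at_dom.
move=> D _ cov.
pose s := finmap.enum_fset D.
pose c (i : 'I_(size s)) := chart_at A (nth point s i).
pose b (i : 'I_(size s) * ('rV[rat]_d * nat)) : set M := dom (c i.1) `&`
  c i.1 @^-1` (ball (map_mx ratr i.2.1 : 'rV[R]_d) i.2.2.+1%:R^-1).
have [oB bB] := countable_base_rV R d.
exists ('I_(size s) * ('rV[rat]_d * nat))%type, b; split.
  move=> [i an]; rewrite openE => x [/= dx bx].
  apply: filterI; first by apply: open_nbhs_nbhs; split => //; exact: chart_open_dom.
  apply: (chart_coord_cts dx); apply: open_nbhs_nbhs; split => //.
move=> x U Ux.
have [y /= yD dx] := cov x I.
have ys : (index y s < size s)%N by rewrite index_mem.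
pose i := Ordinal ys; have ci : c i = chart_at A y by rewrite /c/= nth_index.
rewrite -ci in dx.
have cx : (c i @` dom (c i)) (c i x) by exists x.
have Ux' : nbhs (param (c i) (c i x)) U by rewrite chart_paramK.
have [an [bx bU]] := bB _ _ (chart_param_cts cx Ux').
exists (i, an); split => // z [/= dz bz].
by have := bU _ bz; rewrite /= chart_paramK.
Qed.

Lemma countable_base_skew (R : realType) (d k : nat) (M : ptopologicalType)
    (A : smooth_atlas R d M) : compact [set: M] ->
  exists (I : countType) (b : I -> set (full_shift k * M)), countable_base b.
Proof.
move=> /(countable_base_manifold A)[I [b bb]].
have pb : countable_base (pattern : _ -> set (full_shift k)).
  exact: (@pattern_base int 'I_k.+1).
by eexists; eexists; exact: (countable_base_prod pb bb).
Qed.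

(** * Coding boxes by the Cantor set *)

Section BinaryExpansion.
Context {R : realType}.
Implicit Types f : nat -> bool.

Definition binary_sum (n : nat) f : R := \sum_(j < n) (f j)%:R * (2^-1) ^+ j.+1.

Definition binary f : R := sup (range (binary_sum ^~ f)).

Lemma half_exp_gt0 n : 0 < (2^-1 : R) ^+ n.
Proof. by rewrite exprn_gt0. Qed.

Lemma half_exp_lt (e : R) : 0 < e -> exists n, (2^-1) ^+ n < e.
Proof.
move=> e0; have : (fun n : nat => (2^-1 : R) ^+ n) @ \oo --> (0 : R).
  by apply: cvg_expr; rewrite ger0_norm// invf_lt1// ltr1n.
move=> /cvgrPdist_lt/(_ e e0)[n _ /(_ n (leqnn n))].
by rewrite sub0r normrN ger0_norm ?ltW ?half_exp_gt0//; exists n.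
Qed.

Lemma binary_sumS n f :
  binary_sum n.+1 f = binary_sum n f + (f n)%:R * (2^-1) ^+ n.+1.
Proof. by rewrite /binary_sum big_ord_recr. Qed.

Lemma binary_sum_nd n m f : (n <= m)%N -> binary_sum n f <= binary_sum m f.
Proof.
move=> /subnKC <-; elim: (m - n)%N => [|i IH]; first by rewrite addn0.
by rewrite addnS binary_sumS (le_trans IH)// lerDl mulr_ge0// ltW// half_exp_gt0.
Qed.

Lemma binary_sum_tail n m f : binary_sum m f <= binary_sum n f + (2^-1) ^+ n.
Proof.
have [nm|/ltnW mn] := leqP n m; last first.
  by rewrite (le_trans (binary_sum_nd f mn))// lerDl ltW// half_exp_gt0.
suff : binary_sum m f <= binary_sum n f + (2^-1) ^+ n - (2^-1) ^+ m.
  by move=> /le_trans; apply; rewrite gerDl oppr_le0 ltW// half_exp_gt0.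
rewrite -(subnKC nm); elim: (m - n)%N => [|i IH]; first by rewrite addn0 addrK.
rewrite addnS binary_sumS; have := half_exp_gt0 (n + i).
rewrite exprS; move: IH; case: (f _) => /=; lra.
Qed.

Lemma binary_has_sup f : has_sup (range (binary_sum ^~ f)).
Proof.
split; first by exists (binary_sum 0 f), 0%N.
by exists (binary_sum 0 f + (2^-1) ^+ 0) => _ [m _ <-]; exact: binary_sum_tail.
Qed.

Lemma binary_sum_le n f : binary_sum n f <= binary f.
Proof. by apply: ub_le_sup; [have [] := binary_has_sup f|exists n]. Qed.

Lemma binary_le n f : binary f <= binary_sum n f + (2^-1) ^+ n.
Proof.
apply: ge_sup; first by have [] := binary_has_sup f.
by move=> _ [m _ <-]; exact: binary_sum_tail.
Qed.

Lemma binary_itv f : 0 <= binary f <= 1.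
Proof.
have := binary_sum_le 0 f; have := binary_le 0 f.
by rewrite /binary_sum big_ord0 add0r expr0 => -> ->.
Qed.

Lemma binary_cts : continuous (binary : {ptws nat -> bool} -> R).
Proof.
move=> f; apply/cvgrPdist_lt => e e0.
have [n ne] := half_exp_lt e0.
have : nbhs (f : {ptws nat -> bool}) [set h | forall j, (j < n)%N -> h j = f j].
  elim: n {ne} => [|n IH]; first by apply: filterS filterT => h _ j.
  have h1 : nbhs (f : {ptws nat -> bool}) [set h | h n = f n].
    apply: (@ptws_eval _ bool n f [set f n]).
    exact: discrete_set1.
  apply: (@filterS _ (nbhs (f : {ptws nat -> bool})) _ _ _ _ (filterI h1 IH)).
  move=> h /= [hn hj] j; rewrite ltnS leq_eqVlt => /orP[/eqP -> //|]; exact: hj.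
apply: filterS => h hf.
have E : binary_sum n h = binary_sum n f.
  by apply: eq_bigr => j _; rewrite hf.
have := binary_sum_le n f; have := binary_le n f.
have := binary_sum_le n h; have := binary_le n h.
by rewrite E => *; apply: le_lt_trans ne; rewrite ler_norml; apply/andP; split; lra.
Qed.

(** Digits are read along the orbit of t under the doubling map; [rest n] is the remainder, rescaled
    to [0, 1], after n digits. *)
Lemma binary_surj (t : R) : 0 <= t <= 1 -> exists f, binary f = t.
Proof.
move=> t01.
pose step (s : R) := if 2^-1 <= s then 2 * s - 1 else 2 * s.
pose rest := fix rest n := if n is m.+1 then step (rest m) else t.
pose f n := 2^-1 <= rest n.
have restP n : 0 <= rest n <= 1.
  elim: n => [//|n /andP[]] /=; rewrite /step; case: ifPn; rewrite -?ltNge => *;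
    by apply/andP; split; lra.
have E n : binary_sum n f + (2^-1) ^+ n * rest n = t.
  elim: n => [|n IH]; first by rewrite /binary_sum big_ord0 add0r expr0 mul1r.
  rewrite -[RHS]IH binary_sumS exprS /f /= /step.
  by case: ifP => _ /=; rewrite ?mul1r ?mul0r ?addr0; field.
have ub n : binary_sum n f <= t.
  rewrite -[leRHS](E n) lerDl mulr_ge0 ?(ltW (half_exp_gt0 n))//.
  by have /andP[] := restP n.
have lb n : t <= binary_sum n f + (2^-1) ^+ n.
  rewrite -[leLHS](E n) lerD2l ler_piMr ?(ltW (half_exp_gt0 n))//.
  by have /andP[] := restP n.
exists f; apply/eqP; rewrite eq_le; apply/andP; split.
  apply: ge_sup; first by have [] := binary_has_sup f.
  by move=> _ [n _ <-]; exact: ub.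
apply/ler_addgt0Pl => e e0; have [n ne] := half_exp_lt e0.
rewrite (le_trans (lb n))// addrC lerD ?binary_sum_le//; exact: ltW.
Qed.

End BinaryExpansion.

Lemma mx_norm_leP (R : realType) m n (A : 'M[R]_(m, n)) e : 0 <= e ->
  (`|A| <= e) <-> forall i j, `|A i j| <= e.
Proof.
move=> e0; rewrite -[`|A|]/(mx_norm A) mx_normrE; split.
  by move=> /bigmax_leP[_ h] i j; exact: (h (i, j) isT).
by move=> h; apply/bigmax_leP; split => // -[i j] _; exact: h.
Qed.

Lemma mx_norm_ltP (R : realType) m n (A : 'M[R]_(m, n)) e : 0 < e ->
  (`|A| < e) <-> forall i j, `|A i j| < e.
Proof.
move=> e0; rewrite -[`|A|]/(mx_norm A) mx_normrE; split.
  by move=> /bigmax_ltP[_ h] i j; exact: (h (i, j) isT).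
by move=> h; apply/bigmax_ltP; split => // -[i j] _; exact: h.
Qed.

Lemma matrix_cts (R : realType) (T : topologicalType) m n (f : T -> 'M[R]_(m, n))
    (x : T) : (forall i j, {for x, continuous (fun y => f y i j)}) ->
  {for x, continuous f}.
Proof.
move=> cf; apply/cvgrPdist_lt => e e0.
have h (ij : 'I_m * 'I_n) : \forall y \near x, `|f x ij.1 ij.2 - f y ij.1 ij.2| < e.
  by have /cvgrPdist_lt/(_ e e0) := cf ij.1 ij.2.
have {h} : \forall y \near x, forall ij : 'I_m * 'I_n,
    `|f x ij.1 ij.2 - f y ij.1 ij.2| < e.
  exact: filter_forall.
apply: filterS => y h; apply/mx_norm_ltP => // i j; rewrite !mxE; exact: (h (i, j)).
Qed.

Section BoxCode.
Context {R : realType} (m n : nat) (c : 'M[R]_(m, n)) (r : R).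

(** Digit t of the entry (i, j) sits at [pickle (i, j, t)], so the entries use disjoint digits and
    range independently over intervals of radius r. In the max norm the image is a whole closed
    ball. *)
Definition box_code (f : {ptws nat -> bool}) : 'M[R]_(m, n) :=
  \matrix_(i, j) (c i j + r * (2 * binary (fun t => f (pickle (i, j, t))) - 1)).

Lemma box_code_cts : continuous box_code.
Proof.
move=> f; apply: matrix_cts => i j.
have cb : {for f, continuous (fun f : {ptws nat -> bool} =>
    binary (fun t => f (pickle (i, j, t))) : R)}.
  apply: (@continuous_comp {ptws nat -> bool} {ptws nat -> bool} R
    (fun f t => f (pickle (i, j, t))) binary); last exact: binary_cts.
  by apply: (@ptws_cts _ nat bool) => t; exact: ptws_eval.
rewrite (_ : (fun y => _) = (fun f : {ptws nat -> bool} =>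
    c i j + r * (2 * binary (fun t => f (pickle (i, j, t))) - 1))); last first.
  by apply/funext => h; rewrite mxE.
apply: cvgD; first exact: cvg_cst.
apply: cvgM; first exact: cvg_cst.
apply: cvgB; last exact: cvg_cst.
by apply: cvgM; [exact: cvg_cst|exact: cb].
Qed.

Lemma box_code_range : 0 < r ->
  range box_code = [set A | `|A - c| <= r].
Proof.
move=> r0; apply/seteqP; split => A /=.
  move=> [f _ <-]; apply/mx_norm_leP => [|i j]; first exact: ltW.
  rewrite !mxE/= addrC addKr normrM gtr0_norm// ler_piMr// ?(ltW r0)//.
  have /andP[] := @binary_itv R (fun t => f (pickle (i, j, t))).
  by rewrite ler_norml => *; apply/andP; split; lra.
move=> /(mx_norm_leP _ (ltW r0)) h.
have h' (ij : 'I_m * 'I_n) : exists f : nat -> bool,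
    binary f = ((A ij.1 ij.2 - c ij.1 ij.2) / r + 1) / 2.
  apply: binary_surj; have := h ij.1 ij.2; rewrite !mxE ler_norml => /andP[l u].
  have : -1 <= (A ij.1 ij.2 - c ij.1 ij.2) / r.
    by rewrite ler_pdivlMr// mulN1r.
  have : (A ij.1 ij.2 - c ij.1 ij.2) / r <= 1 by rewrite ler_pdivrMr// mul1r.
  by move=> *; apply/andP; split; lra.
have [b bP] := choice h'.
exists (fun N => if unpickle N is Some (i, j, t) then b (i, j) t else false) => //.
apply/matrixP => i j; rewrite mxE.
rewrite (_ : (fun t => _) = b (i, j)) ?bP/=; last by apply/funext => t; rewrite pickleK.
by field; rewrite gt_eqF.
Qed.

End BoxCode.

(** * Pointwise C1 calculus *)

Lemma near_eq_continuous (T U : topologicalType) (f g : T -> U) (x : T) :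
  (\forall y \near x, f y = g y) -> {for x, continuous f} -> {for x, continuous g}.
Proof.
move=> fg cf; have E : f x = g x by exact: (nbhs_singleton fg).
suff c : g @ x --> f x by rewrite E in c.
by apply: cvg_trans cf; exact: near_eq_cvg.
Qed.

Section PointwiseContinuity.
Context {R : realType} {T : topologicalType} {W : normedModType R} (x : T).

Lemma continuous_atP (f : T -> W) : {for x, continuous f} <->
  forall e, 0 < e -> nbhs x [set y | `|f x - f y| <= e].
Proof. by split=> [/cvgrPdist_le|h]; last apply/cvgrPdist_le. Qed.

Lemma continuousD_at (f g : T -> W) : {for x, continuous f} ->
  {for x, continuous g} -> {for x, continuous (fun y => f y + g y)}.
Proof. by move=> cf cg; exact: (cvgD cf cg). Qed.

Lemma continuousM_at (f g : T -> R) : {for x, continuous f} ->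
  {for x, continuous g} -> {for x, continuous (fun y => f y * g y)}.
Proof. by move=> cf cg; exact: (cvgM cf cg). Qed.

Lemma continuousZ_at (f : T -> R) (g : T -> W) : {for x, continuous f} ->
  {for x, continuous g} -> {for x, continuous (fun y => f y *: g y)}.
Proof. by move=> cf cg; exact: (cvgZ cf cg). Qed.

Lemma continuous_cst_at (a : W) : {for x, continuous (fun=> a)}.
Proof. exact: cvg_cst. Qed.

Lemma continuous_sum_at (I : Type) (s : seq I) (f : I -> T -> W) :
  (forall i, {for x, continuous (f i)}) ->
  {for x, continuous (fun y => \sum_(i <- s) f i y)}.
Proof.
move=> cf; elim: s => [|i s IH].
  rewrite (_ : (fun y => _) = fun=> 0); first exact: continuous_cst_at.
  by apply/funext => y; rewrite big_nil.
rewrite (_ : (fun y => _) = fun y => f i y + \sum_(i <- s) f i y).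
  exact: continuousD_at.
by apply/funext => y; rewrite big_cons.
Qed.

End PointwiseContinuity.

Section Differentiability.
Context {R : realType} {V W : normedModType R}.
Implicit Types (f g : V -> W) (x : V).

Lemma differential_near f x e : differentiable f x -> 0 < e ->
  \forall y \near x, `|f y - f x - 'd f x (y - x)| <= e * `|y - x|.
Proof.
move=> /diff_locallyP[_ /eqaddoP h] e0; have {}h := h e e0.
have c : (fun y => y - x) @ x --> (0 : V).
  by rewrite -(subrr x); apply: cvgB; [exact: cvg_id|exact: cvg_cst].
apply: (@filterS _ (nbhs x) (nbhs_filter x) _ _ _ (c _ h)) => y /=.
by rewrite !fctE /= subrK opprD addrA.
Qed.

Lemma differentiable_near f x (L : {linear V -> W}) : continuous L ->
  (forall e, 0 < e -> \forall y \near x, `|f y - f x - L (y - x)| <= e * `|y - x|) ->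
  differentiable f x /\ 'd f x = L :> (V -> W).
Proof.
move=> cL h.
have E : f \o shift x = cst (f x) + L +o_ 0 id.
  apply/eqaddoP => e e0.
  have c : (fun y => y + x) @ (0 : V) --> x.
    by rewrite -[X in _ --> X](add0r x); apply: cvgD; [exact: cvg_id|exact: cvg_cst].
  apply: (@filterS _ (nbhs (0 : V)) (nbhs_filter _) _ _ _ (c _ (h e e0))) => y /=.
  by rewrite !fctE /= addrK opprD addrA.
have dL := diff_unique cL E.
split; last exact: dL.
by apply/diff_locallyP; rewrite dL; split.
Qed.

Lemma near_eq_differentiable f g x : (\forall y \near x, f y = g y) ->
  differentiable f x -> differentiable g x /\ 'd g x = 'd f x :> (V -> W).
Proof.
move=> fg df; apply: differentiable_near.
  exact: (diff_continuous df).
move=> e e0; have fgx := nbhs_singleton fg.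
by apply: filterS2 fg (differential_near df e0) => y <-; rewrite fgx.
Qed.

(** The pointwise form of [Ck 1], convenient for composition without tracking domains.
    Differentiability is asked near x because ['d f y] carries no information where f is not
    differentiable. *)
Definition C1at f x := (\forall y \near x, differentiable f y) /\
  forall v, {for x, continuous (fun y => 'd f y v)}.

Lemma C1at_differentiable f x : C1at f x -> differentiable f x.
Proof. by move=> [/nbhs_singleton]. Qed.

Lemma C1at_continuous f x : C1at f x -> {for x, continuous f}.
Proof. by move=> /C1at_differentiable/differentiable_continuous. Qed.

Lemma C1at_near_eq f g x : (\forall y \near x, f y = g y) -> C1at f x -> C1at g x.
Proof.
move=> fg [df cf].
have h : \forall y \near x, differentiable g y /\ 'd g y = 'd f y :> (V -> W).
  have /nbhs_interior fg' := fg.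
  by apply: filterS2 fg' df => y fgy dfy; exact: near_eq_differentiable.
split; first by apply: filterS h => y [].
move=> v; have hv : \forall y \near x, 'd f y v = 'd g y v.
  by apply: filterS h => y [_ ->].
exact: near_eq_continuous hv (cf v).
Qed.

Lemma Ck1_C1at (U : set V) f : open U -> Ck 1 U f -> forall x, U x -> C1at f x.
Proof.
move=> oU [df cf] x Ux; split; last by move=> v; exact: cf.
by apply: filterS (open_nbhs_nbhs (conj oU Ux)); exact: df.
Qed.

Lemma C1at_Ck1 (U : set V) f : (forall x, U x -> C1at f x) -> Ck 1 U f.
Proof.
move=> h; split=> [x /h|v x /h [_]]; first exact: C1at_differentiable.
exact.
Qed.

Lemma C1at_everywhere f x : (forall y, differentiable f y) ->
  (forall v, {for x, continuous (fun y => 'd f y v)}) -> C1at f x.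
Proof. by move=> df cf; split => //; exact: nearW. Qed.

Lemma C1at_cst (a : W) x : C1at (fun=> a) x.
Proof.
split; first by apply: nearW => y; exact: differentiable_cst.
move=> v; rewrite (_ : (fun y => _) = fun=> 0); first exact: cvg_cst.
by apply/funext => y; rewrite diff_cst.
Qed.

Lemma C1atD f g x : C1at f x -> C1at g x -> C1at (fun y => f y + g y) x.
Proof.
move=> [df cf] [dg cg]; split.
  by apply: filterS2 df dg => y dfy dgy; exact: (differentiableD dfy dgy).
move=> v.
have E : \forall y \near x, 'd f y v + 'd g y v = 'd (fun y => f y + g y) y v.
  apply: filterS2 df dg => y dfy dgy.
  exact: (esym (congr1 (fun h => h v) (diffD dfy dgy))).
exact: near_eq_continuous E (continuousD_at (cf v) (cg v)).
Qed.

Lemma C1at_linear (L : {linear V -> W}) x : continuous L -> C1at L x.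
Proof.
move=> cL; split; first by apply: nearW => y; exact: linear_differentiable.
move=> v; rewrite (_ : (fun y => _) = fun=> L v); first exact: cvg_cst.
by apply/funext => y; rewrite diff_lin.
Qed.

End Differentiability.

Section ScalarC1.
Context {R : realType} {V W : normedModType R}.

Lemma C1atM (f g : V -> R) x : C1at f x -> C1at g x -> C1at (fun y => f y * g y) x.
Proof.
move=> Cf Cg; have [df cf] := Cf; have [dg cg] := Cg; split.
  by apply: filterS2 df dg => y dfy dgy; exact: (differentiableM dfy dgy).
move=> v.
have E : \forall y \near x, f y * 'd g y v + g y * 'd f y v =
    'd (fun y => f y * g y) y v.
  apply: filterS2 df dg => y dfy dgy.
  exact: (esym (congr1 (fun h => h v) (diffM dfy dgy))).
have c1 := continuousM_at (C1at_continuous Cf) (cg v).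
have c2 := continuousM_at (C1at_continuous Cg) (cf v).
have c := continuousD_at c1 c2.
exact: (near_eq_continuous E c).
Qed.

Lemma C1atZl (f : V -> R) (a : W) x : C1at f x -> C1at (fun y => f y *: a) x.
Proof.
move=> [df cf]; split.
  by apply: filterS df => y dfy; exact: differentiableZl.
move=> v.
have E : \forall y \near x, 'd f y v *: a = 'd (fun y => f y *: a) y v.
  by apply: filterS df => y dfy; rewrite diffZl.
have c := continuousZ_at (cf v) (@continuous_cst_at R V W x a).
exact: (near_eq_continuous E c).
Qed.

Lemma C1at_comp_scalar (h : R -> R) (f : V -> R) x :
  C1at f x -> C1at h (f x) -> C1at (fun y => h (f y)) x.
Proof.
move=> Cf Ch; have [df cf] := Cf; have [dh ch] := Ch.
have dh' : \forall y \near x, differentiable h (f y).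
  by have := C1at_continuous Cf dh; exact: id.
split; first by apply: filterS2 df dh' => y dfy dhy; exact: differentiable_comp.
move=> v.
have E : \forall y \near x, 'd f y v * 'd h (f y) 1 = 'd (fun y => h (f y)) y v.
  apply: filterS2 df dh' => y dfy dhy; rewrite (diff_comp dfy dhy)/=.
  by rewrite -[in RHS](mulr1 ('d f y v)) -[_ * 1]/(_ *: (1 : R)) linearZ.
have chf : {for x, continuous (fun y => 'd h (f y) 1)}.
  exact: (@continuous_comp _ _ _ f (fun t => 'd h t 1) x (C1at_continuous Cf) (ch 1)).
have c := continuousM_at (cf v) chf.
exact: (near_eq_continuous E c).
Qed.

End ScalarC1.

Section RowC1.
Context {R : realType}.

Lemma C1at_sum (V W : normedModType R) (I : Type) (s : seq I) (f : I -> V -> W) x :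
  (forall i, C1at (f i) x) -> C1at (fun y => \sum_(i <- s) f i y) x.
Proof.
move=> Cf; elim: s => [|i s IH].
  rewrite (_ : (fun y => _) = fun=> 0); first exact: C1at_cst.
  by apply/funext => y; rewrite big_nil.
rewrite (_ : (fun y => _) = fun y => f i y + \sum_(i <- s) f i y).
  exact: C1atD.
by apply/funext => y; rewrite big_cons.
Qed.

Definition entry m n (i : 'I_m) (j : 'I_n) (A : 'M[R]_(m, n)) : R := A i j.

Lemma entry_is_linear m n i j : linear (@entry m n i j).
Proof. by move=> a A B; rewrite /entry !mxE. Qed.

HB.instance Definition _ m n i j := GRing.isLinear.Build R 'M[R]_(m, n) R _
  (@entry m n i j) (@entry_is_linear m n i j).

Lemma C1at_coord (n : nat) (j : 'I_n) (x : 'rV[R]_n) :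
  C1at (fun y : 'rV[R]_n => y 0 j : R) x.
Proof. by apply: (C1at_linear (L := entry 0 j)); exact: coord_continuous. Qed.

End RowC1.

Lemma mx_normM (R : realType) m n q (A : 'M[R]_(m, n)) (B : 'M[R]_(n, q)) :
  `|A *m B| <= n%:R * (`|A| * `|B|).
Proof.
apply/mx_norm_leP => [|i k]; first by rewrite !mulr_ge0.
rewrite mxE (le_trans (ler_norm_sum _ _ _))//.
have -> : n%:R * (`|A| * `|B|) = \sum_(j < n) `|A| * `|B|.
  by rewrite sumr_const card_ord mulr_natl.
apply: ler_sum => j _; rewrite normrM ler_pM//.
  by move/mx_norm_leP: (lexx `|A|) => ->.
by move/mx_norm_leP: (lexx `|B|) => ->.
Qed.

Lemma mx_entry_le (R : realType) m n (A : 'M[R]_(m, n)) i j : `|A i j| <= `|A|.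
Proof. by move/mx_norm_leP: (lexx `|A|) => ->. Qed.

Lemma entry_cts_at (R : realType) (T : topologicalType) m n (f : T -> 'M[R]_(m, n))
    x i j : {for x, continuous f} -> {for x, continuous (fun y => f y i j)}.
Proof.
move=> cf.
exact: (@continuous_comp _ _ _ f (fun A : 'M[R]_(m, n) => A i j) x cf
  (@coord_continuous _ m n i j (f x))).
Qed.

Lemma mulmx_cts_at (R : realType) (T : topologicalType) m n q
    (f : T -> 'M[R]_(m, n)) (g : T -> 'M[R]_(n, q)) x :
  {for x, continuous f} -> {for x, continuous g} ->
  {for x, continuous (fun y => f y *m g y)}.
Proof.
move=> cf cg; apply: matrix_cts => i k.
rewrite (_ : (fun y => _) = fun y => \sum_j f y i j * g y j k); last first.
  by apply/funext => y; rewrite mxE.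
apply: (@continuous_sum_at R T R x) => j.
by apply: continuousM_at; exact: entry_cts_at.
Qed.

Section ChainRule.
Context {R : realType} {V W : normedModType R} {m : nat}.

Lemma linear_row (L : {linear 'rV[R]_m -> W}) u :
  L u = \sum_j u 0 j *: L (delta_mx 0 j).
Proof.
rewrite {1}(row_sum_delta u) linear_sum; apply: eq_bigr => j _.
by rewrite linearZ.
Qed.

(** In ['d g (f y) ('d f y v)] both the map and its argument vary, while continuity is known only at
    fixed vectors; expanding on the basis of the intermediate space separates the two. *)
Lemma C1at_comp (f : V -> 'rV[R]_m) (g : 'rV[R]_m -> W) x :
  C1at f x -> C1at g (f x) -> C1at (fun y => g (f y)) x.
Proof.
move=> Cf Cg; have [df cf] := Cf; have [dg cg] := Cg.
have dg' : \forall y \near x, differentiable g (f y).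
  by have := C1at_continuous Cf dg; exact: id.
split; first by apply: filterS2 df dg' => y dfy dgy; exact: differentiable_comp.
move=> v.
have E : \forall y \near x,
    \sum_j ('d f y v) 0 j *: 'd g (f y) (delta_mx 0 j) = 'd (fun y => g (f y)) y v.
  apply: filterS2 df dg' => y dfy dgy.
  rewrite -(linear_row ('d g (f y))).
  exact: (esym (congr1 (fun h => h v) (diff_comp dfy dgy))).
have c : {for x, continuous
    (fun y => \sum_j ('d f y v) 0 j *: 'd g (f y) (delta_mx 0 j))}.
  apply: continuous_sum_at => j; apply: continuousZ_at.
    by apply: entry_cts_at; exact: cf.
  exact: (@continuous_comp _ _ _ f (fun z => 'd g z (delta_mx 0 j)) x
    (C1at_continuous Cf) (cg _)).
exact: (near_eq_continuous E c).
Qed.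

End ChainRule.

Section Cutoff.
Context {R : realType}.

Definition ramp (t : R) : R := Num.max 0 t ^+ 2.

Definition mulr_by (a w : R) : R := w * a.

Lemma mulr_by_is_linear a : linear (mulr_by a).
Proof. by move=> b x y; rewrite /mulr_by mulrDl scalerAl. Qed.

HB.instance Definition _ a := GRing.isLinear.Build R R R _ (mulr_by a)
  (mulr_by_is_linear a).

Lemma mulr_by_cts a : continuous (mulr_by a).
Proof. by move=> x; apply: cvgM; [exact: cvg_id|exact: cvg_cst]. Qed.

Lemma ramp_taylor (x y : R) :
  `|ramp y - ramp x - (y - x) * (2 * Num.max 0 x)| <= (y - x) ^+ 2.
Proof.
rewrite ler_norml /ramp.
have x2 := sqr_ge0 x; have y2 := sqr_ge0 y; have xy2 := sqr_ge0 (y - x).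
rewrite sqrrB in xy2 *.
have [xl|xl] := leP 0 x; have [yl|yl] := leP 0 y;
  apply/andP; split; try nra.
Qed.

Lemma ramp_diff (x : R) : differentiable ramp x /\
  'd ramp x = mulr_by (2 * Num.max 0 x) :> (R -> R).
Proof.
apply: differentiable_near; first exact: mulr_by_cts.
move=> e e0; near=> y.
have ye : `|y - x| <= e.
  by near: y; apply/nbhs_ballP; exists e => //= y; rewrite -ball_normE/= distrC => /ltW.
apply: (@le_trans _ _ (`|y - x| * `|y - x|)); last by rewrite ler_wpM2r.
rewrite -expr2 real_normK ?num_real//.
exact: ramp_taylor.
Unshelve. all: by end_near. Qed.

Lemma max0_cts : continuous (fun t : R => Num.max 0 t).
Proof.
rewrite (_ : (fun t => _) = fun t => 2^-1 * (t + `|t|)); last first.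
  apply/funext => t; have [t0|t0] := leP 0 t.
    by rewrite ger0_norm//; lra.
  by rewrite ltr0_norm//; lra.
move=> x; apply: cvgM; first exact: cvg_cst.
by apply: cvgD; [exact: cvg_id|exact: norm_continuous].
Qed.

Lemma C1at_ramp (x : R) : C1at ramp x.
Proof.
apply: C1at_everywhere => [y|v]; first by have [] := ramp_diff y.
rewrite (_ : (fun y => _) = fun y => v * (2 * Num.max 0 y)); last first.
  by apply/funext => y; have [_ ->] := ramp_diff y.
have c2 : {for x, continuous (fun y : R => 2 * Num.max 0 y)}.
  by apply: cvgM; [exact: cvg_cst|exact: max0_cts].
exact: (cvgM (@cvg_cst _ v _ _ _) c2).
Qed.

(* A C1 piecewise quadratic transition from 0 to 1. *)
Definition step (t : R) : R := 2 * ramp t - 4 * ramp (t - 2^-1) + 2 * ramp (t - 1).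

Lemma ramp_neg t : t <= 0 -> ramp t = 0.
Proof. by move=> t0; rewrite /ramp max_l// expr0n. Qed.

Lemma ramp_pos t : 0 <= t -> ramp t = t ^+ 2.
Proof. by move=> t0; rewrite /ramp max_r. Qed.

Lemma step0 t : t <= 0 -> step t = 0.
Proof. by move=> t0; rewrite /step !ramp_neg; lra. Qed.

Lemma step1 t : 1 <= t -> step t = 1.
Proof. by move=> t1; rewrite /step !ramp_pos; try lra; field. Qed.

Lemma step_increment x y : x <= y -> 0 <= step y - step x <= 2 * (y - x).
Proof.
have cases t : [\/ t <= 0 /\ step t = 0,
    [/\ 0 <= t, t <= 2^-1 & step t = 2 * t ^+ 2],
    [/\ 2^-1 <= t, t <= 1 & step t = 1 - 2 * (1 - t) ^+ 2] |
    1 <= t /\ step t = 1].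
  have [t0|t0] := leP t 0; first by constructor 1; rewrite step0.
  have [th|th] := leP t 2^-1.
    by constructor 2; split => //; rewrite ?ltW// /step ramp_pos ?ramp_neg; lra.
  have [t1|t1] := leP t 1; last by constructor 4; rewrite step1 ltW.
  constructor 3; split => //; first exact: ltW.
  have e1 : ramp t = t ^+ 2 by apply: ramp_pos; lra.
  have e2 : ramp (t - 2^-1) = (t - 2^-1) ^+ 2 by apply: ramp_pos; lra.
  have e3 : ramp (t - 1) = 0 by apply: ramp_neg; lra.
  by rewrite /step e1 e2 e3; field.
case: (cases x) => [[x1 ->]|[x1 x2 ->]|[x1 x2 ->]|[x1 ->]];
  case: (cases y) => [[y1 ->]|[y1 y2 ->]|[y1 y2 ->]|[y1 ->]] xy;
  apply/andP; split; nra.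
Qed.

Lemma step_itv t : 0 <= step t <= 1.
Proof.
have [t0|t0] := leP t 0; first by rewrite (step0 t0) lexx ler01.
have [t1|t1] := leP t 1; last by rewrite (step1 (ltW t1)) lexx ler01.
have /andP[a _] := step_increment (ltW t0).
have /andP[b _] := step_increment t1.
move: a b; rewrite (@step0 0)// (@step1 1)// => a b.
by apply/andP; split; lra.
Qed.

Lemma step_lipschitz x y : `|step x - step y| <= 2 * `|x - y|.
Proof.
wlog yx : x y / y <= x => [h|].
  have [yx|xy] := leP y x; first exact: h.
  by rewrite distrC [`|x - y|]distrC; apply: h; exact: ltW.
have /andP[a b] := step_increment yx.
by rewrite !ger0_norm// subr_ge0.
Qed.

Lemma C1at_step (x : R) : C1at step x.
Proof.
have Cid (y : R) : C1at (id : R -> R) y.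
  have -> : (id : R -> R) = mulr_by 1 by apply/funext => t; rewrite /mulr_by/= mulr1.
  by apply: C1at_linear; exact: mulr_by_cts.
have Ct a : C1at (fun t => ramp (t - a)) x.
  apply: (@C1at_comp_scalar R R ramp (fun t => t - a)); last exact: C1at_ramp.
  by apply: C1atD; [exact: Cid|exact: C1at_cst].
apply: C1atD; last by apply: C1atM; [exact: C1at_cst|exact: Ct].
apply: (@C1atD R R R (fun t => 2 * ramp t) (fun t => - (4 * ramp (t - 2^-1)))).
  by apply: C1atM; [exact: C1at_cst|exact: C1at_ramp].
have -> : (fun t : R => - (4 * ramp (t - 2^-1))) = fun t => - 4 * ramp (t - 2^-1).
  by apply/funext => t; rewrite mulNr.
by apply: C1atM; [exact: C1at_cst|exact: Ct].
Qed.

End Cutoff.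

(** * Diffeomorphisms affine on a box *)

Section Bump.
Context {R : realType} {d : nat} (p : 'rV[R]_d) (rho : R) (rho0 : 0 < rho).

(* Vanishes on the box of radius rho and is at least 1 off that of radius
   2 * rho; unlike the norm, it is C1. *)
Definition escape (u : 'rV[R]_d) : R :=
  \sum_j (step ((u 0 j - p 0 j - rho) / rho) + step ((p 0 j - u 0 j - rho) / rho)).

Definition bump (u : 'rV[R]_d) : R := 1 - step (escape u).

Lemma escape_term_ge0 (u : 'rV[R]_d) (j : 'I_d) :
  0 <= step ((u 0 j - p 0 j - rho) / rho) + step ((p 0 j - u 0 j - rho) / rho).
Proof.
have /andP[a _] := step_itv ((u 0 j - p 0 j - rho) / rho).
have /andP[b _] := step_itv ((p 0 j - u 0 j - rho) / rho).
exact: addr_ge0.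
Qed.

Lemma bump_inside u : `|u - p| <= rho -> bump u = 1.
Proof.
move=> /(mx_norm_leP _ (ltW rho0)) h.
have e0 : escape u = 0.
  rewrite /escape big1// => j _; have := h 0 j; rewrite !mxE ler_norml => /andP[a b].
  by rewrite !step0 ?addr0// pmulr_lle0 ?invr_gt0//; lra.
by rewrite /bump e0 step0// subr0.
Qed.

Lemma bump_outside u : 2 * rho <= `|u - p| -> bump u = 0.
Proof.
move=> h; have rho20 : 0 < 2 * rho by rewrite mulr_gt0.
have [j hj] : exists j, 2 * rho <= `|u 0 j - p 0 j|.
  apply: contrapT => nj; move: h; rewrite leNgt => /negP; apply.
  apply/mx_norm_ltP => // i j; rewrite !mxE ord1 ltNge; apply/negP => hj.
  by apply: nj; exists j.
rewrite /bump step1 ?subrr// /escape (bigD1 j)//=.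
have : 0 <= \sum_(i < d | i != j) (step ((u 0 i - p 0 i - rho) / rho) +
    step ((p 0 i - u 0 i - rho) / rho)).
  by apply: sumr_ge0 => i _; exact: escape_term_ge0.
suff : 1 <= step ((u 0 j - p 0 j - rho) / rho) + step ((p 0 j - u 0 j - rho) / rho).
  by move=> *; lra.
have /andP[a _] := step_itv ((u 0 j - p 0 j - rho) / rho).
have /andP[b _] := step_itv ((p 0 j - u 0 j - rho) / rho).
move: hj; rewrite ler_normr => /orP[hj|hj].
  by rewrite (@step1 _ ((u 0 j - p 0 j - rho) / rho)) ?lerDl// ler_pdivlMr//; lra.
by rewrite (@step1 _ ((p 0 j - u 0 j - rho) / rho)) ?lerDr// ler_pdivlMr//; lra.
Qed.

Lemma bump_itv u : 0 <= bump u <= 1.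
Proof.
have /andP[a b] := step_itv (escape u).
by rewrite /bump; apply/andP; split; lra.
Qed.

(** The constant: [step] has Lipschitz constant 2, each of the d coordinates contributes two steps
    of slope at most 2 / rho, and the outer step doubles the total. *)
Lemma bump_lipschitz u v : `|bump u - bump v| <= 8 * d%:R / rho * `|u - v|.
Proof.
have -> : bump u - bump v = step (escape v) - step (escape u) by rewrite /bump; lra.
rewrite (le_trans (step_lipschitz _ _))//.
suff h : `|escape v - escape u| <= d%:R * (4 / rho * `|u - v|).
  have -> : 8 * d%:R / rho * `|u - v| = 2 * (d%:R * (4 / rho * `|u - v|)).
    by field; rewrite gt_eqF.
  by rewrite ler_pM2l.
rewrite /escape -sumrB (le_trans (ler_norm_sum _ _ _))//.
have -> : d%:R * (4 / rho * `|u - v|) = \sum_(j < d) 4 / rho * `|u - v|.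
  by rewrite sumr_const card_ord mulr_natl.
apply: ler_sum => j _; rewrite opprD addrACA (le_trans (ler_normD _ _))//.
have uvj : `|u 0 j - v 0 j| <= `|u - v|.
  by have := mx_entry_le (u - v) 0 j; rewrite !mxE.
have a := step_lipschitz ((v 0 j - p 0 j - rho) / rho) ((u 0 j - p 0 j - rho) / rho).
have b := step_lipschitz ((p 0 j - v 0 j - rho) / rho) ((p 0 j - u 0 j - rho) / rho).
apply: le_trans (lerD a b) _; rewrite -!mulrBl !normrM normfV (gtr0_norm rho0).
have -> : v 0 j - p 0 j - rho - (u 0 j - p 0 j - rho) = - (u 0 j - v 0 j) by lra.
have -> : p 0 j - v 0 j - rho - (p 0 j - u 0 j - rho) = u 0 j - v 0 j by lra.
rewrite normrN -mulrDl.
have -> : (2 + 2) * (`|u 0 j - v 0 j| / rho) = 4 / rho * `|u 0 j - v 0 j| by field; rewrite gt_eqF.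
by apply: ler_wpM2l uvj; rewrite divr_ge0// ltW.
Qed.

Lemma C1at_bump u : C1at bump u.
Proof.
have Ccst (a : R) : C1at (fun _ : 'rV[R]_d => a) u by exact: C1at_cst.
have CN (f : 'rV[R]_d -> R) : C1at f u -> C1at (fun u => - f u) u.
  move=> Cf; have -> : (fun u => - f u) = (fun u => -1 * f u).
    by apply/funext => v; rewrite mulN1r.
  exact: (C1atM (Ccst (-1)) Cf).
have Cj j : C1at (fun u : 'rV[R]_d => u 0 j : R) u by exact: C1at_coord.
have Cstep (f : 'rV[R]_d -> R) : C1at f u -> C1at (fun u => step (f u)) u.
  by move=> Cf; exact: (C1at_comp_scalar Cf (C1at_step (f u))).
have Cterm (f : 'rV[R]_d -> R) : C1at f u -> C1at (fun u => step ((f u - rho) / rho)) u.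
  move=> Cf; apply: Cstep.
  exact: (C1atM (C1atD Cf (Ccst (- rho))) (Ccst rho^-1)).
have Cescape : C1at escape u.
  apply: C1at_sum => j.
  exact: (C1atD (Cterm _ (C1atD (Cj j) (Ccst (- p 0 j))))
    (Cterm _ (C1atD (Ccst (p 0 j)) (CN _ (Cj j))))).
exact: (C1atD (Ccst 1) (CN _ (Cstep _ Cescape))).
Qed.

End Bump.

Section Shift.
Context {R : realType} {d : nat} (p a : 'rV[R]_d) (H : 'M[R]_d) (rho r : R).
Context (rho0 : 0 < rho) (r_rho : 0 <= r <= rho).
Context (pa : `|p - a| <= r) (Hr : `|H| <= r).

(** The displacement of the affine map u |-> p + (u - a)(1 - H). *)
Definition drift (u : 'rV[R]_d) : 'rV[R]_d := p - a - (u - a) *m H.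

Definition cut_drift (u : 'rV[R]_d) : 'rV[R]_d := bump p rho u *: drift u.

Lemma drift_lipschitz u v : `|drift u - drift v| <= d%:R * r * `|u - v|.
Proof.
have -> : drift u - drift v = - ((u - v) *m H).
  rewrite /drift opprD opprK addrACA subrr add0r -!mulNmx -mulmxDl.
  by congr (_ *m H); rewrite !opprB addrC addrA subrK.
rewrite normrN (le_trans (mx_normM _ _))// -mulrA ler_wpM2l// mulrC ler_wpM2r//.
Qed.

Lemma drift_bound v : `|v - p| <= 2 * rho -> `|drift v| <= r * (1 + 3 * d%:R * rho).
Proof.
move=> vp; rewrite /drift (le_trans (ler_normB _ _))//.
rewrite mulrDr mulr1 lerD// (le_trans (mx_normM _ _))//.
have va : `|v - a| <= 3 * rho.
  rewrite -[v](subrK p) -addrA (le_trans (ler_normD _ _))//.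
  have /andP[_ rr] := r_rho; move: vp pa; lra.
have -> : r * (3 * d%:R * rho) = d%:R * (3 * rho * r) by ring.
by rewrite ler_wpM2l// ler_pM.
Qed.

(** Product rule for Lipschitz constants: d r comes from the drift, and the other summand is the
    slope 8 d / rho of the bump times the size r (1 + 3 d rho) of the drift on the box of radius 2
    rho. Both are proportional to r, so a small r suffices. *)
Lemma cut_drift_lipschitz u v :
  r * (d%:R + 8 * d%:R / rho * (1 + 3 * d%:R * rho)) <= 2^-1 ->
  `|cut_drift u - cut_drift v| <= 2^-1 * `|u - v|.
Proof.
move=> small.
have half w z : `|z - p| <= 2 * rho -> `|cut_drift w - cut_drift z| <= 2^-1 * `|w - z|.
  move=> zp.
  have -> : cut_drift w - cut_drift z = bump p rho w *: (drift w - drift z) +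
      (bump p rho w - bump p rho z) *: drift z.
    by rewrite /cut_drift (scalerBr _ (drift w) (drift z)) (scalerBl (bump p rho w) (bump p rho z)) addrA subrK.
  rewrite (le_trans (ler_normD _ _))// !normrZ.
  have /andP[b0 b1] := bump_itv p rho w.
  have h1 : `|bump p rho w| * `|drift w - drift z| <= d%:R * r * `|w - z|.
    rewrite ger0_norm// (le_trans (ler_piMl _ b1))//; exact: drift_lipschitz.
  have h2 : `|bump p rho w - bump p rho z| * `|drift z| <=
      8 * d%:R / rho * `|w - z| * (r * (1 + 3 * d%:R * rho)).
    by rewrite ler_pM//; [exact: bump_lipschitz|exact: drift_bound].
  apply: le_trans (lerD h1 h2) _.
  rewrite [leLHS](_ : _ = r * (d%:R + 8 * d%:R / rho * (1 + 3 * d%:R * rho)) * `|w - z|).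
    by rewrite ler_wpM2r.
  by ring.
have [vp|vp] := leP `|v - p| (2 * rho); first exact: half.
have [up|up] := leP `|u - p| (2 * rho).
  by rewrite distrC [`|u - v|]distrC; exact: half.
rewrite /cut_drift !bump_outside ?scale0r ?subrr ?normr0 ?mulr_ge0//; exact: ltW.
Qed.

Lemma C1at_drift u : C1at drift u.
Proof.
have -> : drift = (fun u => (p - a + a *m H) + mulmxr (- H) u).
  by apply/funext => v; rewrite /drift /= mulmxBl mulmxN opprB addrA.
have c : continuous (mulmxr (- H) : 'rV[R]_d -> 'rV[R]_d).
  move=> x; apply: (@mulmx_cts_at R 'rV[R]_d 1 d d (fun v => v) (fun=> - H) x).
    by move=> U.
  exact: (@continuous_cst_at R 'rV[R]_d _ x (- H)).
exact: (C1atD (C1at_cst _ u) (C1at_linear u c)).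
Qed.

Lemma C1at_cut_drift u : C1at cut_drift u.
Proof.
have -> : cut_drift = (fun u => \sum_j (bump p rho u * drift u 0 j) *: delta_mx 0 j).
  apply/funext => v; rewrite /cut_drift {1}(row_sum_delta (drift v)) scaler_sumr.
  by apply: eq_bigr => j _; rewrite scalerA.
apply: C1at_sum => j; apply: C1atZl.
have Cj : C1at (fun u : 'rV[R]_d => drift u 0 j : R) u.
  exact: (C1at_comp (C1at_drift u) (C1at_coord j (drift u))).
exact: (C1atM (C1at_bump p rho u) Cj).
Qed.

Lemma shift_inside u : `|u - p| <= rho -> u + cut_drift u = p + (u - a) *m (1%:M - H).
Proof.
move=> up; rewrite /cut_drift bump_inside// scale1r /drift mulmxBr mulmx1.
by rewrite !addrA [u + p]addrC.
Qed.

Lemma shift_outside u : 2 * rho <= `|u - p| -> u + cut_drift u = u.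
Proof. by move=> up; rewrite /cut_drift bump_outside// scale0r addr0. Qed.

End Shift.

HB.instance Definition _ (R : realType) (d : nat) := Complete.on 'rV[R]_d.

Lemma lipschitz_differential (R : realType) (V W : normedModType R) (f : V -> W)
    (c : R) x v : 0 <= c -> (forall u w, `|f u - f w| <= c * `|u - w|) ->
  differentiable f x -> `|'d f x v| <= c * `|v|.
Proof.
move=> c0 lf df; have [->|v0] := eqVneq v 0.
  by rewrite linear0 !normr0 mulr0.
have nv0 : 0 < `|v| by rewrite normr_gt0.
apply/ler_addgt0Pl => e e0.
have [dl dl0 h] : exists2 dl : R, 0 < dl & forall y, `|x - y| < dl ->
    `|f y - f x - 'd f x (y - x)| <= e / `|v| * `|y - x|.
  have /nbhs_ballP[dl /= dl0 h] := differential_near df (divr_gt0 e0 nv0).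
  by exists dl => // y xy; apply: h; rewrite -ball_normE.
pose t := dl / 2 / `|v|.
have t0 : 0 < t by rewrite !divr_gt0.
have tv : `|t *: v| = dl / 2 by rewrite normrZ gtr0_norm// divfK// gt_eqF.
have xy : `|x - (x + t *: v)| < dl.
  by rewrite opprD addNKr normrN tv; lra.
have := h _ xy; rewrite [x + _]addrC addrK linearZ/= tv => hy.
have := lf (t *: v + x) x; rewrite addrK tv => ly.
rewrite -(ler_pM2l t0) -{1}(gtr0_norm t0) -normrZ.
have -> : t * (e + c * `|v|) = e / `|v| * (dl / 2) + c * (dl / 2).
  by rewrite /t; field; rewrite gt_eqF.
set a := f _ - f x in hy ly.
have -> : t *: 'd f x v = a - (a - t *: 'd f x v) by rewrite opprB addrC subrK.
by rewrite (le_trans (ler_normB _ _))// addrC lerD.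
Qed.

Lemma difference_identity (V : zmodType) (x y v a b c e : V) :
  x = v - a -> y = v - b -> c = b - e -> x - y = c - (a - e).
Proof.
move=> -> -> ->; rewrite opprB addrC addrA subrK.
by rewrite (opprB a e) addrA subrK.
Qed.

Lemma absorbed_difference (R : realType) (V : normedModType R) (x y c q : V) (e : R) :
  x - y = c - q -> `|c| <= 2^-1 * `|y - x| -> `|q| <= e / 2 -> `|x - y| <= e.
Proof.
move=> E h1 h2; have := ler_normB c q; rewrite -E.
by move: h1; rewrite distrC; lra.
Qed.

(** * Inverting a contractive perturbation of the identity *)

Section PerturbedIdentity.
Context {R : realType} {d : nat} (psi : 'rV[R]_d -> 'rV[R]_d).
Context (psi_lip : forall u v, `|psi u - psi v| <= 2^-1 * `|u - v|).
Context (psi_C1 : forall u, C1at psi u).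

Let g (u : 'rV[R]_d) : 'rV[R]_d := u + psi u.

Lemma perturbed_expansion u v : `|u - v| <= 2 * `|g u - g v|.
Proof.
have -> : u - v = (g u - g v) - (psi u - psi v).
  by rewrite /g opprD addrACA addrK.
have := psi_lip u v; have := ler_normB (g u - g v) (psi u - psi v).
have E : g u - g v - (psi u - psi v) = u - v by rewrite /g opprD addrACA addrK.
by rewrite E; lra.
Qed.

Lemma perturbed_surjective (y : 'rV[R]_d) : exists u : 'rV[R]_d, g u = y.
Proof.
pose f u := y - psi u.
pose F : {fun [set: 'rV[R]_d] >-> [set: 'rV[R]_d]} :=
  HB.pack f (isFun.Build _ _ setT setT f (fun _ _ => I)).
have cF : is_contraction F.
  exists (2^-1)%:nng; split => /=; first by rewrite invf_lt1// ltr1n.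
  move=> [u v] _ /=; rewrite /f opprB addrC subrKA distrC.
  exact: psi_lip.
have [u _ uE] := banach_fixed_point cF closedT (ex_intro _ 0 I).
by exists u; rewrite /g {1}uE /= /f subrK.
Qed.

(** A global inverse function theorem: surjectivity is a Banach fixed point, injectivity is
    expansion, and the Lipschitz constant 1/2 makes every Jacobian 1 + D psi invertible. *)
Lemma perturbed_inverse : exists k : 'rV[R]_d -> 'rV[R]_d, [/\ cancel g k, cancel k g & forall y, C1at k y].
Proof.
have [k kK] := choice perturbed_surjective.
have gK : cancel g k.
  move=> u; have := perturbed_expansion (k (g u)) u; rewrite kK subrr normr0 mulr0.
  by rewrite normr_le0 subr_eq0 => /eqP.
exists k; split; [exact: gK|exact: kK|move=> y0].
have klip y y' : `|k y - k y'| <= 2 * `|y - y'|.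
  by have := perturbed_expansion (k y) (k y'); rewrite !kK.
have kc (y : 'rV[R]_d) : {for y, continuous k}.
  apply/continuous_atP => e e0.
  have yb : nbhs y (ball y (2^-1 * e)) by apply: nbhsx_ballx; rewrite mulr_gt0.
  apply: (@filterS _ (nbhs y) (nbhs_filter y) _ _ _ yb) => z.
  rewrite -ball_normE /= => yz; apply: (le_trans (klip y z)).
  by rewrite -ler_pdivlMl// ltW.
have dpsi (u : 'rV[R]_d) : differentiable psi u by exact: C1at_differentiable.
have dlip u v : `|'d psi u v| <= 2^-1 * `|v| by exact: lipschitz_differential.
pose J u : 'M[R]_d := 1%:M + lin1_mx ('d psi u).
have JE u v : v *m J u = v + 'd psi u v by rewrite mulmxDr mulmx1 mul_rV_lin1.
have Junit u : J u \in unitmx.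
  rewrite -row_free_unit -kermx_eq0; apply/eqP/row_matrixP => i.
  rewrite row0; set v := row i _.
  have : v *m J u = 0 by apply/sub_kermxP; exact: row_sub.
  rewrite JE => /eqP; rewrite addr_eq0 => /eqP vE.
  have := dlip u v; rewrite -normrN -vE => h.
  by apply/eqP; rewrite -normr_le0; lra.
pose L y : {linear 'rV[R]_d -> 'rV[R]_d} := mulmxr (invmx (J (k y))).
have Lc y : continuous (L y).
  move=> x; apply: (@mulmx_cts_at R 'rV[R]_d 1 d d (fun v => v)
    (fun=> invmx (J (k y))) x); first by move=> U.
  exact: (@continuous_cst_at R 'rV[R]_d _ x).
have dk (y : 'rV[R]_d) : differentiable k y /\ 'd k y = L y :> ('rV[R]_d -> 'rV[R]_d).
  apply: (differentiable_near (Lc y)) => e e0.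
  (* The summand 1 keeps c positive, also when d = 0. *)
  pose c := d%:R * `|invmx (J (k y))| + 1.
  have c0 : 0 < c by rewrite ltr_wpDl// mulr_ge0.
  have e1 : 0 < e / (2 * c) by rewrite divr_gt0// mulr_gt0.
  apply: (@filterS _ (nbhs y) (nbhs_filter y) _ _ _
    (kc y _ (differential_near (dpsi (k y)) e1))) => z /=.
  set eta := k z - k y; set r := psi (k z) - psi (k y) - _ => hr.
  have zy : z - y = eta *m J (k y) + r.
    transitivity (g (k z) - g (k y)); first by rewrite !kK.
    rewrite JE -[RHS]addrA.
    have -> : 'd psi (k y) eta + r = psi (k z) - psi (k y) by rewrite /r addrC subrK.
    by rewrite /g opprD addrACA.
  have E : eta - L y (z - y) = - (r *m invmx (J (k y))).
    by rewrite zy /= mulmxDl mulmxK// opprD addrA subrr sub0r.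
  rewrite [leLHS](_ : _ = `|r *m invmx (J (k y))|); last by rewrite -[RHS]normrN -E.
  apply: (le_trans (mx_normM _ _)).
  apply: (@le_trans _ _ (c * `|r|)).
    by rewrite mulrCA [leRHS]mulrC ler_wpM2l// /c lerDl.
  rewrite (le_trans (ler_wpM2l (ltW c0) hr))//.
  have := klip z y; rewrite -/eta => etal.
  have -> : c * (e / (2 * c) * `|eta|) = e / 2 * `|eta|.
    by field; rewrite gt_eqF.
  have e2 : 0 < e / 2 by rewrite divr_gt0.
  by rewrite (le_trans (ler_wpM2l (ltW e2) etal))// mulrA divfK.
apply: C1at_everywhere => [y|v]; first by have [] := dk y.
(* The derivative of the inverse solves w = v - D psi(k y) w. The half of the variation of w that
   reappears on the right is absorbed on the left, so continuity follows from that of D psi at the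
   fixed vector [w y0], without inverting a varying matrix. *)
pose w (y : 'rV[R]_d) : 'rV[R]_d := 'd k y v.
have wE y : w y + 'd psi (k y) (w y) = v.
  have [_ dE] := dk y.
  have wl : w y = v *m invmx (J (k y)) := congr1 (fun h => h v) dE.
  by rewrite -JE wl mulmxKV.
have cw : {for y0, continuous (fun y => 'd psi (k y) (w y0))}.
  exact: (@continuous_comp _ _ _ k (fun u => 'd psi u (w y0)) y0 (kc y0)
    ((psi_C1 (k y0)).2 _)).
suff : {for y0, continuous w} by [].
apply/continuous_atP => e e0.
have e2 : 0 < e / 2 by rewrite divr_gt0.
have /continuous_atP/(_ _ e2) := cw.
apply: (@filterS _ (nbhs y0) (nbhs_filter y0)) => y /= hy.
have e0' : w y0 = v - 'd psi (k y0) (w y0) := canRL (addrK _) (wE y0).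
have e1' : w y = v - 'd psi (k y) (w y) := canRL (addrK _) (wE y).
exact: (absorbed_difference (difference_identity e0' e1' (linearB _ _ _))
  (dlip _ _) hy).
Qed.

End PerturbedIdentity.

Lemma local_affine_diffeo (R : realType) (d : nat) (p a : 'rV[R]_d) (H : 'M[R]_d)
    (rho r : R) : 0 < rho -> 0 <= r <= rho ->
  r * (d%:R + 8 * d%:R / rho * (1 + 3 * d%:R * rho)) <= 2^-1 ->
  `|p - a| <= r -> `|H| <= r ->
  exists g k : 'rV[R]_d -> 'rV[R]_d,
    [/\ cancel g k, cancel k g, forall u, C1at g u, forall u, C1at k u &
      (forall u, `|u - p| <= rho -> g u = p + (u - a) *m (1%:M - H)) /\
      (forall u, 2 * rho <= `|u - p| -> g u = u)].
Proof.
move=> rho0 rr small pa Hr.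
pose psi := cut_drift p a H rho.
have lip u v : `|psi u - psi v| <= 2^-1 * `|u - v| by exact: cut_drift_lipschitz small.
have psiC u : C1at psi u by exact: C1at_cut_drift.
have [k [gk kg kC]] := perturbed_inverse lip psiC.
have idC (u : 'rV[R]_d) : C1at (fun y : 'rV[R]_d => y) u.
  by apply: (@C1at_linear _ _ _ idfun) => x U.
have gC u : C1at (fun u => u + psi u) u by exact: C1atD (idC u) (psiC u).
exists (fun u => u + psi u), k; split; [exact: gk|exact: kg|exact: gC|exact: kC|].
by split => u up; [exact: shift_inside|exact: shift_outside].
Qed.

(** * Lifting coordinate diffeomorphisms to the manifold *)

Section Charts.
Context {R : realType} {d : nat} {M : topologicalType} (A : smooth_atlas R d M).
Implicit Types c : chart R d M.

Lemma chart_cod c x : dom c x -> (c @` dom c) (c x).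
Proof. by exists x. Qed.

Lemma chart_nbhs_dom c x : dom c x -> nbhs x (dom c).
Proof. by move=> dx; apply: open_nbhs_nbhs; split => //; exact: chart_open_dom. Qed.

Lemma chart_dom_param c y : (c @` dom c) y -> dom c (param c y).
Proof. by move=> [x dx <-]; rewrite chart_paramK. Qed.

Lemma chart_coordK c y : (c @` dom c) y -> c (param c y) = y.
Proof. by move=> [x dx <-]; rewrite chart_paramK. Qed.

Lemma chart_image_open c (U : set M) : open U -> open (c @` (dom c `&` U)).
Proof.
move=> oU; rewrite openE => _ [x [dx Ux] <-].
have cx := chart_cod dx.
have h1 : nbhs (c x) (c @` dom c).
  by apply: open_nbhs_nbhs; split => //; exact: chart_open_cod.
have h2 : nbhs (c x) (param c @^-1` U).
  apply: (chart_param_cts cx); rewrite chart_paramK//.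
  exact: open_nbhs_nbhs.
apply: (@filterS _ (nbhs (c x)) (nbhs_filter _) _ _ _ (filterI h1 h2)).
by move=> _ [[y dy <-] /= Uy]; exists y => //; split => //; rewrite chart_paramK in Uy.
Qed.

Lemma chart_param_nbhs c x U : dom c x -> nbhs x U -> nbhs (c x) (param c @^-1` U).
Proof.
by move=> dx Ux; apply: (chart_param_cts (chart_cod dx)); rewrite chart_paramK.
Qed.

Lemma transition_C1 c1 c2 x : charts A c1 -> charts A c2 -> dom c1 x -> dom c2 x ->
  C1at (c2 \o param c1) (c1 x).
Proof.
move=> A1 A2 d1 d2; apply: (Ck1_C1at _ (charts_compat A1 A2 1%N)).
  by apply: chart_image_open; exact: chart_open_dom.
by exists x.
Qed.

Lemma local_rep_C1 (f : M -> M) c1 c2 x : C1_map A f -> charts A c1 -> charts A c2 ->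
  dom c1 x -> dom c2 (f x) -> C1at (local_rep c1 c2 f) (c1 x).
Proof.
move=> [fc Cf] A1 A2 d1 d2; apply: (Ck1_C1at _ (Cf _ _ A1 A2)); last by exists x.
apply: chart_image_open; move/continuousP: fc; apply; exact: chart_open_dom.
Qed.

Section Lift.
Context (c : chart R d M) (Ac : charts A c) (M_hausdorff : hausdorff_space M).
Context (p : 'rV[R]_d) (rho : R) (rho0 : 0 < rho).
Context (box : forall y, `|y - p| <= 2 * rho -> (c @` dom c) y).

Definition chart_lift (g : 'rV[R]_d -> 'rV[R]_d) (x : M) : M :=
  if `[< dom c x >] then param c (g (c x)) else x.

Section LiftC1.
Context (g : 'rV[R]_d -> 'rV[R]_d) (gC : forall u, C1at g u).
Context (g_inj : injective g) (g_out : forall u, 2 * rho <= `|u - p| -> g u = u).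

(** A point inside the box cannot leave it: g would fix its image [g u], and injectivity would give
    g u = u. *)
Lemma lift_cod u : (c @` dom c) u -> (c @` dom c) (g u).
Proof.
move=> cu; have [h|h] := leP (2 * rho) `|u - p|; first by rewrite g_out.
have [h'|/ltW h'] := leP (2 * rho) `|g u - p|; last exact: box.
by have := g_inj (g_out h') => guE; rewrite guE leNgt h in h'.
Qed.

Lemma lift_in x : dom c x -> chart_lift g x = param c (g (c x)).
Proof. by move=> dx; rewrite /chart_lift asboolT. Qed.

Lemma lift_dom x : dom c x -> dom c (chart_lift g x).
Proof. by move=> dx; rewrite lift_in//; apply: chart_dom_param; exact/lift_cod/chart_cod. Qed.

Lemma coord_lift x : dom c x -> c (chart_lift g x) = g (c x).
Proof. by move=> dx; rewrite lift_in// chart_coordK//; exact/lift_cod/chart_cod. Qed.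

(** The image of the closed box is compact, hence closed in the Hausdorff space M; a point off the
    chart domain therefore has a neighbourhood missing it. This makes the extension by the identity
    smooth across the boundary of the domain, to the order that g has. *)
Lemma lift_near_id x : ~ dom c x -> \forall y \near x, chart_lift g y = y.
Proof.
move=> ndx; pose K := param c @` [set y | `|y - p| <= 2 * rho].
have cK : closed K.
  apply: compact_closed => //; apply: continuous_compact; last first.
    have -> : [set y | `|y - p| <= 2 * rho] = range (box_code p (2 * rho)).
      by rewrite box_code_range// mulr_gt0.
    apply: continuous_compact.
      by apply: continuous_subspaceT; exact: box_code_cts.
    have := @tychonoff nat (fun=> bool) (fun=> setT) (fun=> bool_compact).
    by congr (compact _); apply/seteqP; split.
  apply: continuous_in_subspaceT => y /set_mem yb.
  exact/chart_param_cts/box.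
have xK : (~` K) x.
  by move=> [y yb xy]; apply: ndx; rewrite -xy; exact/chart_dom_param/box.
apply: filterS (open_nbhs_nbhs (conj (closed_openC cK) xK)) => y yK.
rewrite /chart_lift; case: asboolP => // dy.
rewrite g_out ?chart_paramK//.
by rewrite leNgt; apply/negP => /ltW h; apply: yK; exists (c y) => //; exact: chart_paramK.
Qed.

Lemma lift_cts : continuous (chart_lift g).
Proof.
move=> x; have [dx|ndx] := pselect (dom c x).
  have h : {for x, continuous (fun y => param c (g (c y)))}.
    have h1 : {for x, continuous (fun y => g (c y))}.
      exact: (@continuous_comp _ _ _ c g x (chart_coord_cts dx)
        (C1at_continuous (gC (c x)))).
    apply: (@continuous_comp _ _ _ (fun y => g (c y)) (param c) x h1).
    by apply: chart_param_cts; exact/lift_cod/chart_cod.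
  apply: near_eq_continuous h.
  by apply: filterS (chart_nbhs_dom dx) => y dy; rewrite lift_in.
have h : {for x, continuous (id : M -> M)} by move=> U.
by apply: near_eq_continuous h; apply: filterS (lift_near_id ndx) => y ->.
Qed.

Lemma lift_C1_map : C1_map A (chart_lift g).
Proof.
split; first exact: lift_cts.
move=> c1 c2 A1 A2; apply: C1at_Ck1 => _ [x [d1 /= d2] <-].
have [dx|ndx] := pselect (dom c x).
  have C1 := transition_C1 A1 Ac d1 dx.
  have C2 : C1at g ((c \o param c1) (c1 x)) by exact: gC.
  have C12 := C1at_comp C1 C2.
  have C3 : C1at (c2 \o param c) (g ((c \o param c1) (c1 x))).
    have -> : g ((c \o param c1) (c1 x)) = c (chart_lift g x).
      by rewrite coord_lift //; congr g; apply: (congr1 c); exact: chart_paramK.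
    exact: (transition_C1 Ac A2 (lift_dom dx) d2).
  have C123 := C1at_comp C12 C3.
  apply: C1at_near_eq C123.
  have := chart_param_nbhs d1 (chart_nbhs_dom dx).
  apply: (@filterS _ (nbhs (c1 x)) (nbhs_filter _)) => y /= dy.
  by rewrite /local_rep /= lift_in.
have lx : chart_lift g x = x by exact: nbhs_singleton (lift_near_id ndx).
rewrite lx in d2.
apply: C1at_near_eq (transition_C1 A1 A2 d1 d2).
have := chart_param_nbhs d1 (lift_near_id ndx).
apply: (@filterS _ (nbhs (c1 x)) (nbhs_filter _)) => y /= yE.
by rewrite /local_rep /= yE.
Qed.

Lemma lift_rep u : (c @` dom c) u -> \forall w \near u, local_rep c c (chart_lift g) w = g w.
Proof.
move=> cu; have := open_nbhs_nbhs (conj (@chart_open_cod _ _ _ c) cu).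
apply: (@filterS _ (nbhs u) (nbhs_filter u)) => w cw; rewrite /local_rep /= coord_lift ?chart_coordK//.
exact: chart_dom_param.
Qed.

End LiftC1.

Lemma lift_cancel g k : injective g -> (forall u, 2 * rho <= `|u - p| -> g u = u) ->
  cancel g k -> cancel (chart_lift g) (chart_lift k).
Proof.
move=> gi go gk x; have [dx|ndx] := pselect (dom c x); last first.
  by rewrite /chart_lift asboolF// asboolF.
rewrite [LHS]lift_in; last exact: lift_dom.
by rewrite coord_lift// gk chart_paramK.
Qed.

Lemma lift_diffeo g k : cancel g k -> cancel k g -> (forall u, C1at g u) ->
  (forall u, C1at k u) -> (forall u, 2 * rho <= `|u - p| -> g u = u) ->
  exists f : diff1 A, f = chart_lift g :> (M -> M).
Proof.
move=> gk kg gC kC go.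
have ko u : 2 * rho <= `|u - p| -> k u = u by move=> /go {1}<-; rewrite gk.
have gi := can_inj gk; have ki := can_inj kg.
have P : C1_diffeo A (chart_lift g).
  split; first exact: lift_C1_map.
  exists (chart_lift k); split; [exact: lift_cancel|exact: lift_cancel|exact: lift_C1_map].
by exists (Diff1 P).
Qed.

End Lift.

End Charts.

(** * Tangent maps and fibered exponents *)

Section ChainRule.
Context {R : realType} {U V W : normedModType R}.

Lemma chain_near m (T : U -> 'rV[R]_m) (S : 'rV[R]_m -> W) (L : U -> W) x y :
  T x = y -> (\forall z \near x, S (T z) = L z) -> C1at T x -> C1at S y ->
  C1at L x /\ forall v, 'd L x v = 'd S y ('d T x v).
Proof.
move=> <- E CT CS; have CST := C1at_comp CT CS.
split; first exact: C1at_near_eq E CST.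
move=> v; have [_ ->] := near_eq_differentiable E (C1at_differentiable CST).
exact: (congr1 (fun h => h v) (diff_comp (C1at_differentiable CT) (C1at_differentiable CS))).
Qed.

End ChainRule.

Section Tangent.
Context {R : realType} {d : nat} {M : topologicalType} (A : smooth_atlas R d M).
Implicit Types (c : chart R d M) (f g : M -> M).

Lemma local_rep_chain f g c1 c2 c3 x : continuous f -> dom c1 x -> dom c2 (f x) ->
  C1at (local_rep c1 c2 f) (c1 x) -> C1at (local_rep c2 c3 g) (c2 (f x)) ->
  C1at (local_rep c1 c3 (g \o f)) (c1 x) /\
  forall v, 'd (local_rep c1 c3 (g \o f)) (c1 x) v =
    'd (local_rep c2 c3 g) (c2 (f x)) ('d (local_rep c1 c2 f) (c1 x) v).
Proof.
move=> fc d1 d2 CT CS; apply: (chain_near _ _ CT CS).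
  by rewrite /local_rep /= chart_paramK.
have := chart_param_nbhs d1 (fc x (dom c2) (chart_nbhs_dom d2)).
apply: (@filterS _ (nbhs (c1 x)) (nbhs_filter _)) => y /= dy.
by rewrite /local_rep /= chart_paramK.
Qed.

Lemma C1_map_id : C1_map A id.
Proof.
split; first by move=> x U.
move=> c1 c2 A1 A2; apply: C1at_Ck1 => _ [x [d1 d2] <-].
exact: transition_C1 A1 A2 d1 d2.
Qed.

Lemma C1_map_comp f g : C1_map A f -> C1_map A g -> C1_map A (g \o f).
Proof.
move=> Cf Cg; have [fc _] := Cf; have [gc _] := Cg.
split; first by move=> x; exact: (@continuous_comp _ _ _ f g x (fc x) (gc (f x))).
move=> c1 c2 A1 A2; apply: C1at_Ck1 => _ [x [d1 d2] <-].
have Ac := chart_at_charts A (f x); have dc := chart_at_dom A (f x).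
have C1 := local_rep_C1 Cf A1 Ac d1 dc.
have C2 := local_rep_C1 Cg Ac A2 dc d2.
by have [] := local_rep_chain fc d1 dc C1 C2.
Qed.

(** The composite and the intermediate point enter through equalities, so that the rule applies to
    [id \o f] and to iterates without rewriting under a differential. *)
Lemma differential_chain f g h c1 c2 c3 x y v : h = g \o f -> f x = y -> C1_map A f -> C1_map A g ->
  charts A c1 -> charts A c2 -> charts A c3 ->
  dom c1 x -> dom c2 y -> dom c3 (g y) ->
  'd (local_rep c1 c3 h) (c1 x) v =
    'd (local_rep c2 c3 g) (c2 y) ('d (local_rep c1 c2 f) (c1 x) v).
Proof.
move=> -> <- Cf Cg A1 A2 A3 d1 d2 d3; have [fc _] := Cf.
have C1 := local_rep_C1 Cf A1 A2 d1 d2.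
have C2 := local_rep_C1 Cg A2 A3 d2 d3.
by have [_ E] := local_rep_chain fc d1 d2 C1 C2; exact: E.
Qed.

Lemma differential_rep_id c x v : dom c x -> 'd (local_rep c c id) (c x) v = v.
Proof.
move=> dx; have E : \forall y \near c x, idfun y = local_rep c c id y.
  apply: (@filterS _ (nbhs (c x)) (nbhs_filter _) _ _ _
    (open_nbhs_nbhs (conj (@chart_open_cod _ _ _ c) (chart_cod dx)))) => y cy.
  by rewrite /local_rep /= chart_coordK.
have ci : continuous (idfun : 'rV[R]_d -> 'rV[R]_d) by move=> y U.
have di : differentiable (idfun : 'rV[R]_d -> 'rV[R]_d) (c x).
  exact: linear_differentiable.
have [_ h] := near_eq_differentiable E di.
exact: (congr1 (fun L => L v) (etrans h (diff_lin _ ci))).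
Qed.

Section CoordVector.
Context (c : chart R d M) (Ac : charts A c).

(** A change of chart is a local representative of the identity, so the chain rule for maps covers
    it. *)
Lemma coord_vectorE x v : dom c x ->
  coord_vector A c (c x) v = 'd (local_rep c (chart_at A x) id) (c x) v.
Proof. by move=> dx; rewrite /coord_vector chart_paramK. Qed.

Lemma coord_vector_onto x v : dom c x -> exists w, v = coord_vector A c (c x) w.
Proof.
move=> dx; have Ax := chart_at_charts A x; have dax := chart_at_dom A x.
exists ('d (local_rep (chart_at A x) c id) (chart_at A x x) v).
rewrite coord_vectorE// -[LHS](differential_rep_id v dax).
exact: (differential_chain v (erefl : id = id \o id) (erefl : id x = x) C1_map_id C1_map_id Ax Ac Ax dax dx dax).
Qed.

Lemma coord_vector_neq0 x v : dom c x -> v != 0 -> coord_vector A c (c x) v != 0.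
Proof.
move=> dx; apply: contra => /eqP; rewrite coord_vectorE// => h.
have Ax := chart_at_charts A x; have dax := chart_at_dom A x.
rewrite -(differential_rep_id v dx).
have -> := differential_chain v (erefl : id = id \o id) (erefl : id x = x) C1_map_id C1_map_id Ac Ax Ac dx dax dx.
by rewrite [X in 'd _ _ X]h linear0.
Qed.

Lemma tangent_map_coord f x v : C1_map A f -> dom c x -> dom c (f x) ->
  tangent_map A f x (coord_vector A c (c x) v) =
  coord_vector A c (c (f x)) ('d (local_rep c c f) (c x) v).
Proof.
move=> Cf dx dfx.
have Ax := chart_at_charts A x; have dax := chart_at_dom A x.
have Af := chart_at_charts A (f x); have daf := chart_at_dom A (f x).
have h1 := differential_chain v (erefl : f = f \o id) (erefl : id x = x) C1_map_id Cf Ac Ax Af dx dax daf.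
have h2 := differential_chain v (erefl : f = id \o f) (erefl (f x)) Cf C1_map_id Ac Ac Af dx dfx daf.
have e1 := coord_vectorE v dx.
have e2 := coord_vectorE ('d (local_rep c c f) (c x) v) dfx.
rewrite e1 [RHS]e2.
exact: etrans (esym h1) h2.
Qed.

End CoordVector.

End Tangent.

Lemma cantor_compact : compact [set: {ptws nat -> bool}].
Proof.
have := @tychonoff nat (fun=> bool) (fun=> setT) (fun=> bool_compact).
by congr (compact _); apply/seteqP; split.
Qed.

Lemma cantor_bounded (R : realType) (f : {ptws nat -> bool} -> R) : continuous f ->
  exists C, forall x, `|f x| <= C.
Proof.
move=> fc.
have cf : {within [set: {ptws nat -> bool}], continuous f} by exact: continuous_subspaceT.
have ne : [set: {ptws nat -> bool}] !=set0 by exists (fun=> false).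
have [a _ ha] := compact_EVT_max ne cantor_compact cf.
have [b _ hb] := compact_EVT_min ne cantor_compact cf.
exists (`|f a| + `|f b|) => x.
have h1 := ha x (mem_set I); have h2 := hb x (mem_set I).
have h3 := ler_norm (f a); have h4 := ler_norm (- f b); rewrite normrN in h4.
have h5 := normr_ge0 (f a); have h6 := normr_ge0 (f b).
by rewrite ler_norml; apply/andP; split; lra.
Qed.

Lemma near_identity_unit (R : realType) d (B : 'M[R]_d) r : d%:R * r < 1 ->
  `|B - 1%:M| <= r -> B \in unitmx.
Proof.
move=> dr Br; rewrite -row_free_unit; apply: inj_row_free => v vB.
have E : v = - (v *m (B - 1%:M)) by rewrite mulmxBr vB mulmx1 sub0r opprK.
have h : `|v| <= d%:R * r * `|v|.
  rewrite {1}E normrN (le_trans (mx_normM _ _))// -mulrA ler_wpM2l// mulrC.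
  by rewrite ler_wpM2r.
apply/eqP; rewrite -normr_le0.
have : 0 <= (1 - d%:R * r) * - `|v| by rewrite mulrN mulrBl mul1r; lra.
by rewrite pmulr_rge0 ?subr_gt0// oppr_ge0.
Qed.

Lemma bounded_over_n (R : realType) (a : nat -> R) C : (forall n, `|a n| <= C) ->
  (fun n => a n / n%:R) @ \oo --> (0 : R).
Proof.
move=> aC; apply/cvgrPdist_lt => e e0.
exists (Num.truncn (C / e)).+1 => // n /= hn.
have n0 : 0 < n%:R :> R by rewrite ltr0n; exact: leq_trans hn.
rewrite sub0r normrN normrM normfV (gtr0_norm n0) ltr_pdivrMr// (le_lt_trans (aC n))//.
rewrite mulrC -ltr_pdivrMr//; apply: lt_le_trans (truncnS_gt _) _.
by rewrite ler_nat.
Qed.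

Section DerivativeMatrix.
Context {R : realType} {d : nat}.

(** Vectors are rows, so the chain rule multiplies these matrices on the right, in the order of
    time. *)
Definition deriv_mx (f : 'rV[R]_d -> 'rV[R]_d) (u : 'rV[R]_d) : 'M[R]_d :=
  \matrix_i 'd f u (delta_mx 0 i).

Lemma mul_deriv_mx f u w : w *m deriv_mx f u = 'd f u w.
Proof.
rewrite (linear_row ('d f u)) mulmx_sum_row; apply: eq_bigr => i _.
by rewrite /deriv_mx rowK.
Qed.

Lemma deriv_mx_cts f u : C1at f u -> {for u, continuous (deriv_mx f)}.
Proof.
move=> [_ cf]; apply: matrix_cts => i j.
rewrite (_ : (fun y => _) = fun y => ('d f y (delta_mx 0 i)) 0 j); last first.
  by apply/funext => y; rewrite mxE.
exact: entry_cts_at (cf (delta_mx 0 i)).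
Qed.

End DerivativeMatrix.

(** * Frames along orbits and vanishing of the exponents *)

Section FrameBundle.
Context {R : realType} {d : nat} {M : ptopologicalType} (A : smooth_atlas R d M).
Context (c : chart R d M) (Ac : charts A c) (p : 'rV[R]_d) (r : R) (r0 : 0 < r).
Context (box : forall y, `|y - p| <= r -> (c @` dom c) y).

Local Notation frame := ('rV[R]_d * 'M[R]_d)%type.

(* Even digits code the point, odd digits the frame. *)
Definition frame_code (f : {ptws nat -> bool}) : frame :=
  (box_code p r (fun n => f n.*2), box_code 1%:M r (fun n => f n.*2.+1)).

Definition frame_map (f : M -> M) (s : frame) : frame :=
  (local_rep c c f s.1, s.2 *m deriv_mx (local_rep c c f) s.1).

Lemma frame_code_cts : continuous frame_code.
Proof.
have sub (h : nat -> nat) : continuous (fun f : {ptws nat -> bool} => (fun n => f (h n)) : {ptws nat -> bool}).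
  by apply: (@ptws_cts _ nat bool) => t; exact: ptws_eval.
move=> f; apply: pair_cts.
  exact: (@continuous_comp _ _ _ _ (box_code p r) f (sub double f) (@box_code_cts _ _ _ p r _)).
exact: (@continuous_comp _ _ _ _ (box_code 1%:M r) f (sub (fun n => n.*2.+1) f)
  (@box_code_cts _ _ _ 1%:M r _)).
Qed.

Lemma frame_code_itv f : `|(frame_code f).1 - p| <= r /\ `|(frame_code f).2 - 1%:M| <= r.
Proof.
have h m n (a : 'M[R]_(m, n)) g : `|box_code a r g - a| <= r.
  have : range (box_code a r) (box_code a r g) by exists g.
  by rewrite box_code_range.
by split; exact: h.
Qed.

Lemma frame_code_surj (s : frame) : `|s.1 - p| <= r -> `|s.2 - 1%:M| <= r ->
  exists f, frame_code f = s.
Proof.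
case: s => u B /= up B1.
have : range (box_code p r) u by rewrite box_code_range.
have : range (box_code 1%:M r) B by rewrite box_code_range.
move=> [g _ gB] [f _ fu].
exists (fun n => if odd n then g n./2 else f n./2); congr (_, _).
  by rewrite -fu; congr box_code; apply/funext => n; rewrite odd_double doubleK.
by rewrite -gB; congr box_code; apply/funext => n; rewrite /= odd_double /= uphalf_double.
Qed.

Lemma frame_param_cts : continuous ((fun s : frame => param c s.1) \o frame_code).
Proof.
move=> f; apply: (@continuous_comp _ _ _ (fun f => (frame_code f).1) (param c) f).
  apply: (@continuous_comp _ _ _ frame_code fst f); first exact: frame_code_cts.
  exact: cvg_fst.
by apply: chart_param_cts; apply: box; have [] := frame_code_itv f.
Qed.

Section StayInChart.
Context (g : M -> M) (Cg : C1_map A g).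
Context (g_dom : forall u, `|u - p| <= r -> dom c (g (param c u))).

Lemma box_rep_C1 u : `|u - p| <= r -> C1at (local_rep c c g) u.
Proof.
move=> up; have cu := box up.
have := local_rep_C1 Cg Ac Ac (chart_dom_param cu) (g_dom up).
by rewrite chart_coordK.
Qed.

Lemma frame_map_cts f : {for frame_code f, continuous (frame_map g)}.
Proof.
have [up _] := frame_code_itv f; have C := box_rep_C1 up.
have c1 (s : frame) : {for s, continuous (@fst 'rV[R]_d 'M[R]_d)} by exact: cvg_fst.
have c2 (s : frame) : {for s, continuous (@snd 'rV[R]_d 'M[R]_d)} by exact: cvg_snd.
apply: pair_cts.
  exact: (@continuous_comp _ _ _ fst (local_rep c c g) _ (c1 _) (C1at_continuous C)).
apply: mulmx_cts_at; first exact: c2.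
exact: (@continuous_comp _ _ _ fst (deriv_mx (local_rep c c g)) _ (c1 _) (deriv_mx_cts C)).
Qed.

Lemma frame_map_param f : param c (frame_map g (frame_code f)).1 =
  g (param c (frame_code f).1).
Proof.
have [up _] := frame_code_itv f.
by rewrite /frame_map /local_rep /= chart_paramK//; exact: g_dom.
Qed.

End StayInChart.

Section Exponents.
Context (dr : d%:R * r < 1).
Context (k : nat) (bit : 'I_k.+1 -> bool) (G : {ptws 'I_k.+1 -> diff1 A}).
Context (G_dom : forall i u, `|u - p| <= r -> dom c (G i (param c u))).

Local Notation orbits := (orbits frame_code bit (fun i => frame_map (G i))).
Local Notation state := (state frame_code bit).

Lemma fiber_iter_C1 w n : C1_map A (fiber_iter G w n).
Proof.
elim: n => [|n IH]; first exact: C1_map_id.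
have [h _] := diff1P (G (w n%:Z)).
exact: (C1_map_comp IH h).
Qed.

Section Orbit.
Context (y : symbolic k) (oy : orbits y).
Let x := param c (state y 0).1.
Let iterate := fiber_iter G (symbol y : full_shift k).

Lemma orbit_point n : iterate n x = param c (state y n%:Z).1.
Proof.
elim: n => [//|n IH].
have -> : n.+1%:Z = n%:Z + 1 by rewrite intS addrC.
rewrite (oy n%:Z).
rewrite /iterate /= -/iterate IH.
by rewrite (frame_map_param (G_dom (symbol y n%:Z))).
Qed.

Lemma orbit_coord n : c (param c (state y n%:Z).1) = (state y n%:Z).1.
Proof. by apply: chart_coordK; apply: box; have [] := frame_code_itv (digits bit y n%:Z). Qed.

Lemma orbit_dom n : dom c (param c (state y n%:Z).1).
Proof. by apply: chart_dom_param; apply: box; have [] := frame_code_itv (digits bit y n%:Z). Qed.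

(** The derivative along the orbit is B_0^-1 B_n, a quotient of two frames of the box; this is how
    staying in the box controls it for all n. *)
Lemma orbit_frame n w : w *m (state y n%:Z).2 =
  'd (local_rep c c (iterate n)) (c x) (w *m (state y 0).2).
Proof.
elim: n => [|n IH]; first by rewrite (differential_rep_id _ (orbit_dom 0)).
have -> : n.+1%:Z = n%:Z + 1 by rewrite intS addrC.
rewrite (oy n%:Z) /frame_map mulmxA mul_deriv_mx.
have [CG _] := diff1P (G (symbol y n%:Z)).
have Ch := fiber_iter_C1 (symbol y) n.
have d0 := orbit_dom 0; have dn := orbit_dom n.
have dn1 : dom c (G (symbol y n%:Z) (param c (state y n%:Z).1)).
  by apply: G_dom; have [] := frame_code_itv (digits bit y n%:Z).
have E := differential_chain (w *m (state y 0).2) (erefl (iterate n.+1))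
  (orbit_point n) Ch CG Ac Ac Ac d0 dn dn1.
have E' := congr2 (fun a b => 'd (local_rep c c (G (symbol y n%:Z))) a b)
  (orbit_coord n) (esym IH).
exact: esym (etrans E E').
Qed.

End Orbit.

Section Metric.
Context (rho : riemannian_metric A) (w : 'rV[R]_d) (w0 : w != 0).

(** The squared length of the vector with coordinates w B at the coded point, taken as a function on
    the Cantor space: continuous and positive on a compact space, it has a bounded logarithm. *)
Definition frame_norm2 (f : {ptws nat -> bool}) : R :=
  let s := frame_code f in
  let v := coord_vector A c s.1 (w *m s.2) in inner rho (param c s.1) v v.

Lemma inner0 x v : inner rho x 0 v = 0.
Proof. by have := inner_lin rho x 1 0 0 v; rewrite scaler0 addr0 mul1r; lra. Qed.

Lemma inner_suml x n (a : 'I_n -> R) (u : 'I_n -> 'rV[R]_d) v :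
  inner rho x (\sum_i a i *: u i) v = \sum_i a i * inner rho x (u i) v.
Proof.
elim: n a u => [|n IH] a u; first by rewrite !big_ord0 inner0.
by rewrite !big_ord_recl inner_lin IH.
Qed.

Lemma inner_sum x n (a : 'I_n -> R) (u : 'I_n -> 'rV[R]_d) :
  inner rho x (\sum_i a i *: u i) (\sum_i a i *: u i) =
  \sum_i \sum_j a i * (a j * inner rho x (u i) (u j)).
Proof.
rewrite inner_suml; apply: eq_bigr => i _.
rewrite inner_sym inner_suml mulr_sumr; apply: eq_bigr => j _.
by rewrite inner_sym.
Qed.

Lemma frame_norm2_gt0 f : 0 < frame_norm2 f.
Proof.
have [up B1] := frame_code_itv f; have cu := box up.
apply: inner_pos; rewrite -{1}(chart_coordK cu).
apply: (coord_vector_neq0 Ac (chart_dom_param cu)).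
apply: contra w0 => /eqP h; rewrite -(mulmxK (near_identity_unit dr B1) w) h.
by rewrite mul0mx.
Qed.

Lemma frame_norm2_cts : continuous frame_norm2.
Proof.
move=> f; have [up B1] := frame_code_itv f; have cu := box up.
pose a (i : 'I_d) g := (w *m (frame_code g).2) 0 i : R.
pose q (i j : 'I_d) (y : 'rV[R]_d) := inner rho (param c y)
  (coord_vector A c y (delta_mx 0 i)) (coord_vector A c y (delta_mx 0 j)) : R.
have c1 : {for f, continuous (fun g => (frame_code g).1)}.
  apply: (@continuous_comp _ _ _ frame_code fst f); first exact: frame_code_cts.
  exact: cvg_fst.
have c2 : {for f, continuous (fun g => (frame_code g).2)}.
  apply: (@continuous_comp _ _ _ frame_code snd f); first exact: frame_code_cts.
  exact: cvg_snd.
have ca i : {for f, continuous (a i)}.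
  by apply: entry_cts_at; apply: mulmx_cts_at => //; exact: continuous_cst_at.
have cq i j : {for f, continuous (fun g => q i j (frame_code g).1)}.
  apply: (@continuous_comp _ _ _ (fun g => (frame_code g).1) (q i j) f c1).
  have h := @inner_smooth _ _ _ _ rho c (delta_mx 0 i) (delta_mx 0 j) Ac 0%N.
  have h' := h (frame_code f).1 cu.
  exact: h'.
(* Smoothness of the metric is stated for fixed coordinate vectors, so the norm is expanded as a
   quadratic form in the entries of w B. *)
have E : frame_norm2 = fun g =>
    \sum_i \sum_j a i g * (a j g * q i j (frame_code g).1).
  apply/funext => g; rewrite /frame_norm2 /= /coord_vector linear_row.
  exact: inner_sum.
rewrite E; apply: (@continuous_sum_at R) => i; apply: (@continuous_sum_at R) => j.
by apply: continuousM_at => //; apply: continuousM_at.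
Qed.

Lemma frame_norm2_bounded : exists C, forall f, `|ln (Num.sqrt (frame_norm2 f))| <= C.
Proof.
apply: cantor_bounded => f.
have l : {for Num.sqrt (frame_norm2 f), continuous (@ln R)}.
  by apply: continuous_ln; rewrite sqrtr_gt0; exact: frame_norm2_gt0.
have sl : {for f, continuous (fun g => Num.sqrt (frame_norm2 g))}.
  exact: (@continuous_comp _ _ _ frame_norm2 Num.sqrt f (@frame_norm2_cts f)
    (@sqrt_continuous R _)).
exact: (@continuous_comp _ _ _ (fun g => Num.sqrt (frame_norm2 g)) (@ln R) f sl l).
Qed.

End Metric.

Lemma orbit_zero_exponents (rho : riemannian_metric A) (y : symbolic k) v :
  orbits y -> v != 0 ->
  (fun n : nat => ln (tnorm rho (fiber_iter G (symbol y) n (param c (state y 0).1))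
     (tangent_map A (fiber_iter G (symbol y) n) (param c (state y 0).1) v)) / n%:R)
    @ \oo --> (0 : R).
Proof.
move=> oy v0; set x := param c (state y 0).1.
have dx : dom c x := orbit_dom y 0.
have [w' vE] := coord_vector_onto Ac v dx.
have [_ B1] := frame_code_itv (digits bit y 0).
have uB := near_identity_unit dr B1.
(* In the initial frame the vector is w B_0, so its image at time n is w B_n with w independent of
   n. *)
pose w := w' *m invmx (state y 0).2.
have w'E : w' = w *m (state y 0).2 by rewrite /w mulmxKV.
have w0 : w != 0.
  apply: contra v0 => /eqP w0; rewrite vE w'E w0 mul0mx.
  by rewrite /coord_vector linear0.
have [C hC] := frame_norm2_bounded rho w0.
apply: (@bounded_over_n _ _ C) => n.
suff -> : tnorm rho (fiber_iter G (symbol y) n x)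
    (tangent_map A (fiber_iter G (symbol y) n) x v) =
    Num.sqrt (frame_norm2 rho w (digits bit y n%:Z)) by exact: hC.
rewrite /tnorm /frame_norm2 /=.
have px := orbit_point oy n; have dn := orbit_dom y n.
rewrite -/x in px; rewrite -px in dn.
have E : tangent_map A (fiber_iter G (symbol y) n) x v =
    coord_vector A c (state y n%:Z).1 (w *m (state y n%:Z).2).
  rewrite vE (tangent_map_coord Ac _ (fiber_iter_C1 (symbol y) n) dx dn).
  by rewrite (orbit_frame oy) -w'E px orbit_coord.
by rewrite E px.
Qed.

End Exponents.

End FrameBundle.

(** * The open set of perturbations *)

Lemma C1_subbase_open (R : realType) (d : nat) (M : topologicalType)
  (A : smooth_atlas R d M) (N : set (diff1 A)) : C1_subbase N -> open N.
Proof.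
move=> sN; exists [set N]; last by rewrite bigcup_set1.
by move=> _ ->; exact: (finI_from1 id sN).
Qed.

Lemma ptws_open_finite (I : finType) (T : topologicalType) (N : I -> set T) :
  (forall i, open (N i)) -> open [set g : {ptws I -> T} | forall i, N i (g i)].
Proof.
move=> oN; rewrite openE => g gN.
apply: (@filter_forall {ptws I -> T} I (fun i g => N i (g i)) (nbhs g) (nbhs_filter g)) => i.
by apply: (@ptws_eval I T i g); apply: open_nbhs_nbhs; split => //; exact: gN.
Qed.

Lemma finite_enumeration (T : choiceType) (s : seq T) : (0 < size s)%N ->
  exists k (f : 'I_k.+1 -> T), [/\ k.+1 = size s, forall i, f i \in s &
    forall x, x \in s -> exists i, f i = x].
Proof.
case: s => // x0 s _; exists (size s), (fun i => nth x0 (x0 :: s) i); split => //.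
  by move=> i; rewrite mem_nth.
move=> x xs; have h : (index x (x0 :: s) < (size s).+1)%N by rewrite -index_mem in xs.
by exists (Ordinal h) => /=; rewrite nth_index.
Qed.

Lemma box_net (R : realType) m n (c : 'M[R]_(m, n)) r e : 0 < r -> 0 < e ->
  exists s : seq 'M[R]_(m, n), (forall a, a \in s -> `|a - c| <= r) /\
    forall B, `|B - c| <= r -> exists2 a, a \in s & `|B - a| <= e.
Proof.
move=> r0 e0; pose K := [set B : 'M[R]_(m, n) | `|B - c| <= r].
have : compact K.
  rewrite /K -box_code_range//; apply: continuous_compact; last exact: cantor_compact.
  by apply: continuous_subspaceT; exact: box_code_cts.
rewrite compact_cover => /(_ _ K (fun a => ball a e)) [].
- by move=> a _; exact: ball_open.
- by move=> a Ka; exists a => //; exact: ballxx.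
move=> D DK cov; exists (finmap.enum_fset D); split => [a aD|B KB].
  by have := DK a aD; rewrite inE.
have [a aD Ba] := cov B KB; exists a => //.
by move: Ba; rewrite -ball_normE /= distrC => /ltW.
Qed.

Lemma mul_affine_bound (R : realType) d m (v : 'M[R]_(m, d)) (H : 'M[R]_d) e r :
  0 <= r -> `|v| <= e -> `|H| <= r -> `|v *m (1%:M - H)| <= e + d%:R * e * r.
Proof.
move=> r0 ve Hr; rewrite mulmxBr mulmx1 (le_trans (ler_normB _ _))// lerD//.
rewrite (le_trans (mx_normM _ _))// -mulrA ler_wpM2l// ler_pM//.
Qed.

Lemma norm_delta_le1 (R : realType) m n i j : `|delta_mx i j : 'M[R]_(m, n)| <= 1.
Proof.
apply/mx_norm_leP => // a b; rewrite mxE; case: (_ && _); rewrite ?normr1 ?normr0//.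
Qed.

Section BaseDiffeo.
Context {R : realType} {d : nat} {M : ptopologicalType} (A : smooth_atlas R d M).
Context (M_hausdorff : hausdorff_space M).
Context (c : chart R d M) (Ac : charts A c) (p : 'rV[R]_d) (rho r : R).
Context (rho0 : 0 < rho) (r0 : 0 < r) (r_rho : r < rho).
Context (box2 : forall y, `|y - p| <= 2 * rho -> (c @` dom c) y).
Context (small : r * (d%:R + 8 * d%:R / rho * (1 + 3 * d%:R * rho)) <= 2^-1).

Lemma box_small y : `|y - p| <= r -> (c @` dom c) y.
Proof. by move=> yp; apply: box2; move: (ltW r_rho) rho0; lra. Qed.

Definition affine_on_box (a : 'rV[R]_d) (H : 'M[R]_d) (f : diff1 A) : Prop :=
  forall u, `|u - p| <= r ->
    [/\ dom c (f (param c u)), c (f (param c u)) = p + (u - a) *m (1%:M - H) &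
      forall v, 'd (local_rep c c f) u v = v *m (1%:M - H)].

Lemma mulmxr_cts (B : 'M[R]_d) : continuous (mulmxr B : 'rV[R]_d -> 'rV[R]_d).
Proof.
move=> x; apply: (@mulmx_cts_at R _ 1 d d id (fun=> B)); first by move=> U.
exact: continuous_cst_at.
Qed.

Lemma affine_diffeo a H : `|a - p| <= r -> `|H| <= r -> exists f, affine_on_box a H f.
Proof.
move=> ap Hr; have pa : `|p - a| <= r by rewrite distrC.
have rr : 0 <= r <= rho by rewrite (ltW r0) (ltW r_rho).
have [g [k [gk kg gC kC [g_in g_out]]]] := local_affine_diffeo rho0 rr small pa Hr.
have [f fE] := lift_diffeo Ac M_hausdorff rho0 box2 gk kg gC kC g_out.
exists f => u up; have cu := box_small up; have du := chart_dom_param cu.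
have gi := can_inj gk; rewrite fE; split.
- exact: (lift_dom box2 gi g_out du).
- by rewrite (coord_lift box2 gi g_out du) chart_coordK// g_in// (le_trans up)// ltW.
move=> v; pose L : {linear 'rV[R]_d -> 'rV[R]_d} := mulmxr (1%:M - H).
have near_in : \forall w \near u, `|w - p| <= rho.
  have ub : nbhs u (ball u (rho - r)) by apply: nbhsx_ballx; rewrite subr_gt0.
  apply: (@filterS _ (nbhs u) (nbhs_filter u) _ _ _ ub) => w.
  rewrite -ball_normE /= distrC => /ltW h.
  rewrite -[w](subrK u) -addrA (le_trans (ler_normD _ _))//.
  by move: h up; lra.
have near_aff : \forall w \near u, local_rep c c (chart_lift c g) w = p + (w - a) *m (1%:M - H).
  have h := lift_rep box2 gi g_out cu.
  apply: (@filterS2 _ (nbhs u) (nbhs_filter u) _ _ _ _ h near_in) => w -> wp.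
  exact: g_in.
have aff_u := nbhs_singleton near_aff.
have Lc : continuous L by exact: mulmxr_cts.
have [_ h] : differentiable (local_rep c c (chart_lift c g)) u /\
    'd (local_rep c c (chart_lift c g)) u = L :> ('rV[R]_d -> 'rV[R]_d).
  apply: differentiable_near => // e e0.
  apply: (@filterS _ (nbhs u) (nbhs_filter u) _ _ _ near_aff) => w wE.
  rewrite wE aff_u opprD addrACA subrr add0r -mulmxBl -/L /=.
  by rewrite opprB addrA subrK subrr normr0 mulr_ge0// ltW.
by rewrite h.
Qed.

Section Perturbation.
Context (dr : d%:R * r <= 4^-1).
Context (a : 'rV[R]_d) (H : 'M[R]_d) (Hr : `|H| <= r).
Context (f h : diff1 A) (fP : affine_on_box a H f).

Definition box_set : set M := param c @` [set u | `|u - p| <= r].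

Context (hP : C1_nbhd f c c box_set (r / 4) h).

Lemma perturbed_dom u : `|u - p| <= r -> dom c (h (param c u)).
Proof. by move=> up; have [|] := hP (x := param c u); first by exists u. Qed.

(** Error budget with d r <= 1/4. The point moves off p by at most r/4 (perturbation) + r/4 (net) +
    r/16. With E = B - 1 and Q the error of the derivative, the new frame minus 1 is Q + E Q + (E -
    H) - E H, at most r/4 + r/16 + r/4 + r/4. *)
Lemma perturbed_frame (s : 'rV[R]_d * 'M[R]_d) :
  `|s.1 - p| <= r -> `|s.2 - 1%:M| <= r ->
  `|s.1 - a| <= r / 4 -> `|s.2 - 1%:M - H| <= r / 4 ->
  `|(frame_map c h s).1 - p| <= r /\ `|(frame_map c h s).2 - 1%:M| <= r.
Proof.
case: s => u B /= up B1 ua BH.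
have [_ fu df] := fP up.
have [|_ hf dh] := hP (x := param c u); first by exists u.
have cu := box_small up; rewrite (chart_coordK cu) in dh.
have d0 : 0 <= d%:R :> R by [].
have rr4 : d%:R * (r / 4) * r <= r / 16.
  have -> : d%:R * (r / 4) * r = d%:R * r * (r / 4) by ring.
  have -> : r / 16 = 4^-1 * (r / 4) by field.
  by apply: ler_wpM2r => //; apply: divr_ge0 => //; exact: ltW.
split.
  rewrite /local_rep /=.
  have -> : c (h (param c u)) - p = (c (h (param c u)) - c (f (param c u))) +
      (u - a) *m (1%:M - H).
    by rewrite fu opprD addrA subrK.
  rewrite (le_trans (ler_normD _ _))//.
  have := mul_affine_bound (ltW r0) ua Hr; move: (ltW hf) r0 rr4; lra.
set D := deriv_mx _ _; pose E := B - 1%:M; pose Q := D - (1%:M - H).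
have Q4 : `|Q| <= r / 4.
  have r40 : 0 <= r / 4 by apply: divr_ge0 => //; exact: ltW.
  apply/(mx_norm_leP _ r40) => i j.
  have e1 : 'd (local_rep c c h) u (delta_mx 0 i) = row i D by exact: esym (rowK _ i).
  have e2 : 'd (local_rep c c f) u (delta_mx 0 i) = row i (1%:M - H).
    by rewrite rowE; exact: df.
  have e12 := congr2 (fun a b : 'rV[R]_d => `|a - b|) e1 e2.
  have : `|row i D - row i (1%:M - H)| < r / 4.
    by rewrite -e12; exact: dh (norm_delta_le1 R 0 i).
  move=> /ltW /(mx_norm_leP _ r40)/(_ 0 j).
  by rewrite !mxE.
have expand (X Y : 'M[R]_d) : (1%:M + X) *m (Y + (1%:M - H)) - 1%:M =
    (Y + X *m Y) + (X - H - X *m H).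
  rewrite mulmxDl mul1mx mulmxDr mulmxBr mulmx1.
  by apply/matrixP => i j; rewrite !mxE; ring.
have BE : B *m D - 1%:M = (Q + E *m Q) + (E - H - E *m H).
  rewrite -expand /E /Q subrK; congr (_ *m _ - _).
  by rewrite addrC subrK.
rewrite BE.
have E1 : `|E *m Q| <= r / 16.
  apply: le_trans (mx_normM _ _) _; apply: le_trans rr4.
  by rewrite -mulrA ler_wpM2l// [leRHS]mulrC ler_pM.
have E2 : `|E *m H| <= r / 4.
  apply: le_trans (mx_normM _ _) _.
  have -> : r / 4 = 4^-1 * r by ring.
  apply: (@le_trans _ _ (d%:R * r * r)); last by apply: ler_wpM2r => //; exact: ltW.
  by rewrite -mulrA ler_wpM2l// ler_pM.
have n1 := ler_normD (Q + E *m Q) (E - H - E *m H).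
have n2 := ler_normD Q (E *m Q).
have n3 := ler_normB (E - H) (E *m H).
have n4 : `|E - H| <= r / 4 by [].
by move: n1 n2 n3 n4 E1 E2 Q4 r0; lra.
Qed.

End Perturbation.

End BaseDiffeo.

(** * Conclusion for a perturbed family *)

Section PerturbedSkewProduct.
Context {R : realType} {d : nat} {M : ptopologicalType} (A : smooth_atlas R d M).
Context (M_hausdorff : hausdorff_space M) (M_compact : compact [set: M]).
Context (c : chart R d M) (Ac : charts A c) (p : 'rV[R]_d) (r : R) (r0 : 0 < r).
Context (box : forall y, `|y - p| <= r -> (c @` dom c) y) (dr : d%:R * r < 1).
Context (k : nat) (bit : 'I_k.+1 -> bool) (G : {ptws 'I_k.+1 -> diff1 A}).
Context (G_dom : forall i u, `|u - p| <= r -> dom c (G i (param c u))).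

Local Notation code := (frame_code p r).
Local Notation F := (fun i => frame_map c (G i)).
Local Notation P := (fun s : 'rV[R]_d * 'M[R]_d => param c s.1).
Local Notation L := (realized code bit F P).

Context (F_pick : forall f b, exists i g, bit i = b /\ F i (code f) = code g).

Lemma realized_zero_exponents (mu : probability (Borel (full_shift k * M)%type) R) :
  measurable (~` L : set (Borel (full_shift k * M)%type)) -> mu (~` L) = 0%E ->
  zero_fibered_exponents G mu.
Proof.
move=> mL muL rho; exists (~` L); split => // z /= h Lz; apply: h.
move: Lz => [y oy <-] v v0.
exact: (orbit_zero_exponents Ac r0 box dr G_dom rho oy v0).
Qed.

Lemma perturbed_skew_product :
  (exists L : set (full_shift k * M),
    [/\ compact L,
        skew_product G @` L = L,
        (forall mu : probability (Borel (full_shift k * M)%type) R,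
           invariant_measure (skew_product G) mu ->
           supp mu `<=` L ->
           zero_fibered_exponents G mu) &
        (0 < @top_entropy R _ (skew_product G) L)%E]) /\
  (exists mu : probability (Borel (full_shift k * M)%type) R,
    [/\ ergodic_measure (skew_product G) mu,
        (0 < metric_entropy (skew_product G) mu)%E &
        zero_fibered_exponents G mu]).
Proof.
have St_haus : hausdorff_space ('rV[R]_d * 'M[R]_d)%type.
  by apply: hausdorff_prod2; exact: norm_hausdorff.
have code_cts : continuous code by exact: frame_code_cts.
have CG i : C1_map A (G i) by have [] := diff1P (G i).
have F_cts i f : {for code f, continuous (F i)}.
  exact: (frame_map_cts Ac r0 box (CG i) (G_dom i)).
have P_cts : continuous (P \o code) by exact: (frame_param_cts r0 box).
have G_cts i : continuous (G i) by have [] := CG i.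
have PG i f : P (F i (code f)) = G i (P (code f)).
  exact: (frame_map_param r0 (G_dom i)).
have [nu [nu_erg nu_orb nu_words]] :=
  symbolic_ergodic R St_haus code_cts F_cts F_pick.
have L_closed : closed L := realized_closed St_haus code_cts F_cts P_cts M_hausdorff.
have L_meas : measurable (~` L : set (Borel (full_shift k * M)%type)).
  exact: realized_measurable.
pose mu := realized_measure bit P_cts nu.
split.
  exists L; split.
  - exact: (realized_compact St_haus code_cts F_cts P_cts).
  - exact: (@realized_invariant k _ M code bit F P (fun i => G i) PG).
  - move=> mu' _ suppL; apply: realized_zero_exponents => //.
    have [I [b bb]] := countable_base_skew k A M_compact.
    exact: null_off_support bb L_closed suppL.
  - exact: (@realized_entropy R k _ M code bit F P (fun i => G i) (all_words St_haus code_cts F_cts nu_orb nu_words)).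
exists mu; split.
- exact: (realized_measure_ergodic St_haus code_cts F_cts P_cts G_cts PG nu_erg nu_orb).
- exact: (realized_measure_entropy P_cts (fun i => G i) nu_words).
- apply: realized_zero_exponents => //.
  exact: (realized_measure_realized St_haus code_cts F_cts P_cts nu_orb M_hausdorff).
Qed.

End PerturbedSkewProduct.

Lemma chart_box (R : realType) (d : nat) (M : topologicalType) (c : chart R d M) x :
  dom c x -> exists2 rho, 0 < rho & forall y, `|y - c x| <= 2 * rho -> (c @` dom c) y.
Proof.
move=> dx; have := open_nbhs_nbhs (conj (@chart_open_cod _ _ _ c) (chart_cod dx)).
move=> /nbhs_ballP[e /= e0 h]; exists (e / 4) => [|y yx]; first exact: divr_gt0.
by apply: h; rewrite -ball_normE /= distrC (le_lt_trans yx)//; move: e0; lra.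
Qed.

Lemma small_radius (R : realType) (d : nat) (rho : R) : 0 < rho ->
  exists r, [/\ 0 < r, r < rho, d%:R * r <= 4^-1 &
    r * (d%:R + 8 * d%:R / rho * (1 + 3 * d%:R * rho)) <= 2^-1].
Proof.
move=> rho0; set q := 8 * d%:R / rho * (1 + 3 * d%:R * rho).
have d0 : 0 <= d%:R :> R by [].
have q0 : 0 <= q.
  by rewrite mulr_ge0 ?divr_ge0 ?mulr_ge0 ?addr_ge0 ?mulr_ge0// ltW.
(* Radii up to 1/t satisfy both smallness conditions; the summand 4 keeps t positive when d = 0. *)
pose t := 4 * (d%:R + q) + 4 : R.
have t0 : 0 < t by rewrite /t; lra.
have ht : (d%:R + q) / t <= 4^-1 by rewrite ler_pdivrMr// /t; lra.
exists (Num.min (rho / 2) t^-1).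
have m1 : Num.min (rho / 2) t^-1 <= rho / 2 by rewrite ge_min lexx.
have m2 : Num.min (rho / 2) t^-1 <= t^-1 by rewrite ge_min lexx orbT.
have m0 : 0 < Num.min (rho / 2) t^-1 by rewrite lt_min divr_gt0// invr_gt0.
have h : Num.min (rho / 2) t^-1 * (d%:R + q) <= 4^-1.
  apply: le_trans ht; rewrite mulrC ler_wpM2l// addr_ge0//.
split => //; first by move: m1 rho0; lra.
  apply: le_trans h; rewrite [leLHS]mulrC.
  by apply: ler_wpM2l; [exact: ltW|rewrite lerDl].
by apply: le_trans h _; lra.
Qed.

Theorem theorem2 (R : realType) (d : nat) (M : ptopologicalType)
    (A : smooth_atlas R d M)
    (M_hausdorff : hausdorff_space M)
    (M_compact : compact [set: M])
    (M_connected : connected [set: M]) :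
  exists k : nat, (2 <= k.+1)%N /\
  exists V : set {ptws 'I_k.+1 -> diff1 A},
    [/\ open V, V !=set0 &
      forall G, V G ->
        (exists L : set (full_shift k * M),
          [/\ compact L,
              skew_product G @` L = L,
              (forall mu : probability (Borel (full_shift k * M)%type) R,
                 invariant_measure (skew_product G) mu ->
                 supp mu `<=` L ->
                 zero_fibered_exponents G mu) &
              (0 < @top_entropy R _ (skew_product G) L)%E]) /\
        (exists mu : probability (Borel (full_shift k * M)%type) R,
          [/\ ergodic_measure (skew_product G) mu,
              (0 < metric_entropy (skew_product G) mu)%E &
              zero_fibered_exponents G mu])].
Proof.
pose c := chart_at A point.
have Ac : charts A c := chart_at_charts A point.
have dc : dom c point := chart_at_dom A point.
have [rho rho0 box2] := chart_box dc.
pose p := c point.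
have [r [r0 r_rho dr small]] := small_radius d rho0.
have box := box_small rho0 r_rho box2.
have r40 : 0 < r / 4 by apply: divr_gt0.
have [s1 [s1_box s1_net]] := box_net p r0 r40.
have [s2 [s2_box s2_net]] := box_net (0 : 'M[R]_d) r0 r40.
(* A letter is a label with a net point (a, H). Every net point occurs with both labels, which also
   gives at least two letters. *)
pose s := [seq (b, x) | b <- [:: true; false], x <- [seq (a, H) | a <- s1, H <- s2]].
have sP b a H : a \in s1 -> H \in s2 -> (b, (a, H)) \in s.
  move=> a1 H2; apply: allpairs_f; last exact: allpairs_f.
  by case: b; rewrite !inE.
have s_box x : x \in s -> `|x.2.1 - p| <= r /\ `|x.2.2| <= r.
  move=> /allpairsP[[b [a H]] [_ /allpairsP[[a' H'] [a1 H2 [aE HE]]] ->]] /=.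
  rewrite /= in a1 H2; rewrite aE HE; split; first exact: s1_box.
  by have := s2_box _ H2; rewrite subr0.
have [a0 a01 _] : exists2 a, a \in s1 & `|p - a| <= r / 4.
  by apply: s1_net; rewrite subrr normr0 ltW.
have [H0 H02 _] : exists2 H, H \in s2 & `|0 - H| <= r / 4.
  by apply: s2_net; rewrite subrr normr0 ltW.
have s_size : (1 < size s)%N.
  have s10 : (0 < size s1)%N by case: s1 a01 {s1_box s1_net s sP s_box}.
  have s20 : (0 < size s2)%N by case: s2 H02 {s2_box s2_net s sP s_box}.
  by rewrite /s !size_allpairs /= mul2n -addnn -[1%N]/(0 + 1)%N -addn1 leq_add ?muln_gt0 ?s10.
have [k [f [kE f_s f_onto]]] := finite_enumeration (ltnW s_size).
exists k; split; first by rewrite kE.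
have base i : exists g : diff1 A, affine_on_box c p r (f i).2.1 (f i).2.2 g.
  have [a_box H_box] := s_box _ (f_s i).
  exact: (affine_diffeo M_hausdorff Ac rho0 r0 r_rho box2 small a_box H_box).
have [g gP] := choice base.
pose K := box_set c p r.
(* One C1 neighbourhood for each letter, with tolerance r/4 on the compact box, the margin left by
   the error budget of [perturbed_frame]. *)
pose V : set {ptws 'I_k.+1 -> diff1 A} := [set G | forall i, C1_nbhd (g i) c c K (r / 4) (G i)].
have K_compact : compact K.
  rewrite /K /box_set; apply: continuous_compact; last first.
    rewrite -(box_code_range p r0); apply: continuous_compact; last exact: cantor_compact.
    by apply: continuous_subspaceT; exact: box_code_cts.
  apply: continuous_in_subspaceT => y /set_mem yb.
  exact/chart_param_cts/box.
have K_dom : K `<=` dom c by move=> _ [u /box cu <-]; exact: chart_dom_param.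
have gK i : g i @` K `<=` dom c.
  by move=> _ [_ [u up <-] <-]; have [] := gP i u up.
exists V; split.
- apply: (@ptws_open_finite 'I_k.+1 (diff1 A) (fun i => C1_nbhd (g i) c c K (r / 4))) => i.
  apply: C1_subbase_open.
  by exists (g i), c, c, K, (r / 4); split.
- exists g => i x Kx; split; first by apply: gK; exists x.
    by rewrite subrr normr0.
  by move=> v _; rewrite subrr normr0.
move=> G GV.
have G_dom i u : `|u - p| <= r -> dom c (G i (param c u)).
  exact: (perturbed_dom (GV i)).
have dr1 : d%:R * r < 1 by move: dr; lra.
apply: (@perturbed_skew_product _ _ _ _ M_hausdorff M_compact _ Ac _ _ r0 box dr1
  k (fun i => (f i).1) _ G_dom).
(* It remains to verify [F_pick]: the nets give (a, H) within r/4 of (u, B - 1), and the letter with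
   this pair and label b returns the frame to the box. *)
move=> w b; have [up B1] := frame_code_itv p r0 w.
have [a a1 ua] := s1_net _ up.
have [H H2 BH] := s2_net _ (eq_ind_r (fun B => `|B| <= r) B1 (subr0 _)).
have [i fi] := f_onto _ (sP b _ _ a1 H2).
have gi := gP i; rewrite fi /= in gi.
have Hr : `|H| <= r by have := s2_box _ H2; rewrite subr0.
have [u1 B2] := perturbed_frame rho0 r0 r_rho box2 dr Hr gi (GV i) up B1 ua BH.
have [w' w'E] := frame_code_surj r0 u1 B2.
by exists i, w'; rewrite fi.
Qed.
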